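(* Let $q\in(1,\infty)$ and $t\in\mathbb R$, and let $s\mapsto p(s,t)$, $s\le t$, be the solution of $$p'(s)=-\frac{p(s)}{c(p(s),s)},\quad s\le t;\qquad p(t)=q,$$ where $c(p,s)=\frac{p}{p-1}\|Q^{1/2}(s,-\infty)B^*(s)^{-1}\|^2$. Then for $s<t$, $P_{s,t}$ maps $L^q(\mathbb R^n,\nu_t)$ into $L^{p(s,t)}(\mathbb R^n,\nu_s)$ and $$\|P_{s,t}\varphi\|_{L^{p(s,t)}(\mathbb R^n,\nu_s)}\le\|\varphi\|_{L^q(\mathbb R^n,\nu_t)},\qquad\varphi\in L^q(\mathbb R^n,\nu_t).$$
   Context: Let $n\ge 1$ and let $A,B:\mathbb R\to\mathcal L(\mathbb R^n)$, $f:\mathbb R\to\mathbb R^n$ be continuous and bounded (not necessarily periodic), with $\|B(t)x\|\ge \mu_0\|x\|$ for all $t,x$ and some $\mu_0>0$. Let $U(t,s)$ be the evolution operator of $\xi'=A(t)\xi$, and assume $\omega_0(U):=\inf\{\omega:\exists M,\ \|U(t,s)\|\le Me^{\omega(t-s)}\ \forall s\le t\}<0$. For $-\infty\le s<t$ let $Q(t,s)=\int_s^tU(t,r)B(r)B^*(r)U^*(t,r)dr$ ($Q^{1/2}$ its positive square root), $g(t,s)=\int_s^tU(t,r)f(r)dr$, and $\nu_t=\mathcal N_{g(t,-\infty),Q(t,-\infty)}$ (Gaussian measure on $\mathbb R^n$). For $s<t$, $P_{s,t}\varphi(x)=\int_{\mathbb R^n}\varphi(y)\,\mathcal N_{U(t,s)x+g(t,s),Q(t,s)}(dy)$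 for bounded continuous $\varphi$, extended by density to $L^q(\mathbb R^n,\nu_t)$. *)

(* Defs.v *)
From HB Require Import structures.
From mathcomp Require Import all_boot all_order all_algebra.
From mathcomp Require Import all_classical all_reals all_analysis.
From mathcomp Require Import measurable_realfun.
Set Implicit Arguments. Unset Strict Implicit. Unset Printing Implicit Defensive.
Import Order.TTheory GRing.Theory Num.Theory.
Import numFieldNormedType.Exports.
Local Open Scope classical_set_scope.
Local Open Scope ring_scope.

Section Defs.
Variable R : realType.

Definition enorm n (x : 'cV[R]_n) : R := Num.sqrt (\sum_i (x i 0) ^+ 2).

Definition opnorm n (M : 'M[R]_n) : R :=
  sup [set enorm (M *m x) | x in [set x : 'cV[R]_n | enorm x <= 1]].

Definition sqrtm n (Q : 'M[R]_n) : 'M[R]_n :=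
  xget 0 [set S : 'M[R]_n | [/\ S^T = S,
            (forall x : 'cV[R]_n, 0 <= (x^T *m S *m x) 0 0) & S *m S = Q]].

Definition is_evolution_operator n (A : R -> 'M[R]_n) (U : R -> R -> 'M[R]_n) :=
  forall s, U s s = 1%:M /\
    forall t (i j : 'I_n), is_derive t (1 : R) (fun tau => U tau s i j) ((A t *m U t s) i j).

Definition Qkernel n (U : R -> R -> 'M[R]_n) (B : R -> 'M[R]_n) (t r : R) : 'M[R]_n :=
  U t r *m B r *m (B r)^T *m (U t r)^T.

Definition Qst n U B (t s : R) : 'M[R]_n :=
  \matrix_(i, j) (\int[lebesgue_measure]_(r in `[s, t]) (@Qkernel n U B t r i j)).

Definition Qinf n U B (t : R) : 'M[R]_n :=
  \matrix_(i, j) (\int[lebesgue_measure]_(r in `]-oo, t]) (@Qkernel n U B t r i j)).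

Definition gst n (U : R -> R -> 'M[R]_n) (f : R -> 'cV[R]_n) (t s : R) : 'cV[R]_n :=
  \col_i (\int[lebesgue_measure]_(r in `[s, t]) ((U t r *m f r) i 0)).

Definition ginf n (U : R -> R -> 'M[R]_n) (f : R -> 'cV[R]_n) (t : R) : 'cV[R]_n :=
  \col_i (\int[lebesgue_measure]_(r in `]-oo, t]) ((U t r *m f r) i 0)).

(* Lebesgue integral on R^n of a nonnegative extended-real function,
   computed as an iterated integral (Tonelli) *)
Fixpoint ileb (n : nat) : ('cV[R]_n -> \bar R) -> \bar R :=
  match n return ('cV[R]_n -> \bar R) -> \bar R with
  | 0 => fun F => F 0
  | k.+1 => fun F =>
      (\int[@lebesgue_measure R]_x
         ileb (fun v : 'cV[R]_k => F (col_mx (const_mx x : 'cV[R]_1) v)))%E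
  end.

Definition gdens n (m : 'cV[R]_n) (Q : 'M[R]_n) (y : 'cV[R]_n) : R :=
  (Num.sqrt ((pi *+ 2) ^+ n * \det Q))^-1 *
  expR (- ((y - m)^T *m invmx Q *m (y - m)) 0 0 / 2).

Definition gint n (m : 'cV[R]_n) (Q : 'M[R]_n) (F : 'cV[R]_n -> \bar R) : \bar R :=
  ileb (fun y => ((gdens m Q y)%:E * F y)%E).

Definition gintS n (m : 'cV[R]_n) (Q : 'M[R]_n) (phi : 'cV[R]_n -> R) : \bar R :=
  (gint m Q (fun y => (Num.max (phi y) 0)%:E) -
   gint m Q (fun y => (Num.max (- phi y) 0)%:E))%E.

Definition gaussLnorm n (p : R) (m : 'cV[R]_n) (Q : 'M[R]_n) (F : 'cV[R]_n -> \bar R) : \bar R :=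
  (gint m Q (fun y => `|F y| `^ p) `^ p^-1)%E.

(* measurability on R^n (Borel sigma-algebra = product sigma-algebra on n-tuples) *)
Definition tup2col n (x : n.-tuple R) : 'cV[R]_n := \col_i tnth x i.

Definition Rn_measurable n (phi : 'cV[R]_n -> R) :=
  measurable_fun [set: n.-tuple R] (fun x => phi (tup2col x)).

Definition Rn_measurableE n (phi : 'cV[R]_n -> \bar R) :=
  measurable_fun [set: n.-tuple R] (phi \o @tup2col n : n.-tuple R -> \bar R).

Definition Pst n (U : R -> R -> 'M[R]_n) (B : R -> 'M[R]_n) (f : R -> 'cV[R]_n)
  (s t : R) (phi : 'cV[R]_n -> R) (x : 'cV[R]_n) : \bar R :=
  gintS (U t s *m x + gst U f t s) (Qst U B t s) phi.

Definition cfun n (U : R -> R -> 'M[R]_n) (B : R -> 'M[R]_n) (p s : R) : R :=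
  p / (p - 1) * opnorm (sqrtm (Qinf U B s) *m invmx (B s)^T) ^+ 2.

End Defs.

(* Main.v *)
(* Put kappa(s) = |Q^(1/2)(s,-oo) B*(s)^-1|^2, so that p' = -(p-1)/kappa and p > q > 1 before t.
   For fixed x, h(r) = <U(t,r) Q(r,-oo) U*(t,r) x, x> has derivative |B*(r) U*(t,r) x|^2, which is
   at least h(r)/kappa(r); hence h (p - 1) is nondecreasing, which says
   U(t,s) Q(s,-oo) U*(t,s) <= lambda Q(t,-oo) with lambda = (q-1)/(p(s)-1) < 1.
   Diagonalising both covariances simultaneously turns P_{s,t} into a tensor product of
   one-dimensional Mehler operators u |-> int g(c u + sqrt(1-c^2) v) dgamma(v) with
   c^2 <= lambda, so Nelson's theorem applies coordinatewise.  In its bilinear form it reads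
     int int f(u)^al g(c u + c' v)^be <= (int f)^al (int g)^be,   c^2 al be <= (1-al)(1-be),
   and tensorises by Tonelli.  In dimension one it is proved by doubling: a Taylor expansion
   gives it for steps of size h up to O(h^3), two steps of size h make one of size sqrt 2 h while
   errors add, so reaching size 1 from 2^(-n/2) costs 2^n 2^(-3n/2) -> 0. *)
Require Import Defs.
From HB Require Import structures.
From mathcomp Require Import all_boot all_order all_algebra.
From mathcomp Require Import all_classical all_reals all_analysis.
From mathcomp Require Import measurable_realfun.
From mathcomp Require Import ring lra.
From mathcomp Require complex.
Import Order.TTheory GRing.Theory Num.Theory.
Import numFieldNormedType.Exports.
Local Open Scope classical_set_scope.
Local Open Scope ring_scope.
Set Implicit Arguments. Unset Strict Implicit. Unset Printing Implicit Defensive.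

(** * Scalar inequalities *)

(** The bilinear inequality is dual to contractivity. With [al = (p - 1) / p] and [be = 1 / q] it is
    tested on the [p]-th power of the image and the [q]-th power of the function, and its condition
    on [c] then reads [c ^+ 2 * (p - 1) <= q - 1]. The same condition is a discriminant: the
    second-order term of one small Gaussian step is a quadratic form in the two logarithmic slopes,
    nonpositive for all slopes exactly under it. Doubling needs an error constant that is the same
    at every scale and base point. Hence the class [C11], whose three constants survive Gaussian
    averaging and whose lower bound [e > 0] allows division by the averages. Leaving the class costs
    an L1 approximation, the limit [e] to [0], a truncation from above, and a comparison of the
    image of [phi] with that of its absolute value. The exponent is given only by its equation, so
    [1 < p] has to be extracted before the equation can be simplified. The strict inequality
    [q < p s] makes [lambda < 1], which keeps the covariance of the transition nondegenerate. *)

Section scalar.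
Context {R : realType}.
Implicit Types a b c e K p r s x y : R.

(** Convexity of [expR] between [ln (1 + p)] and [0], with weights [a] and [1 - a]. The point
    [p = -1], where the logarithm is lost, is separate. *)
Lemma powR_bernoulli a p : 0 <= a <= 1 -> -1 <= p -> (1 + p) `^ a <= 1 + a * p.
Proof.
move=> /andP[a0 a1]; rewrite le_eqVlt => /predU1P[<-|p1].
  rewrite subrr /powR eqxx; case: eqVneq => [->|_]; rewrite ?mul0r ?addr0//=.
  by rewrite mulrN1 subr_ge0.
have p0 : 0 < 1 + p by rewrite -ltrBlDl sub0r.
rewrite /powR gt_eqF//.
have := @convex_expR R (Itv01 a0 a1) (ln (1 + p)) 0.
rewrite !convRE/= mulr0 addr0 expR0 mulr1 lnK ?posrE// => /le_trans; apply.
by rewrite mulrDr mulr1 addrAC addrCA subrr addr0.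
Qed.

Lemma derive_ge0_le (F dF : R -> R) a b : a <= b ->
  (forall x, a < x < b -> is_derive x 1 F (dF x)) -> {within `[a, b], continuous F} ->
  (forall x, a < x < b -> 0 <= dF x) -> F a <= F b.
Proof.
rewrite le_eqVlt => /predU1P[<-//|ab] dF' cF dF0.
have dd x : x \in `]a, b[ -> is_derive x 1 F (dF x) by rewrite in_itv; exact: dF'.
have [c /[!in_itv]/= cab E] := MVT ab dd cF.
by rewrite -subr_ge0 E mulr_ge0 ?dF0 ?subr_ge0// ltW.
Qed.

Lemma derive_ge0_le_cc (F dF : R -> R) a b : a <= b ->
  (forall x, a <= x <= b -> is_derive x 1 F (dF x)) ->
  (forall x, a <= x <= b -> 0 <= dF x) -> F a <= F b.
Proof.
move=> ab dF' dF0; apply: (@derive_ge0_le F dF) => // [x /andP[ax xb]||x /andP[ax xb]].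
- by apply: dF'; rewrite !ltW.
- apply: derivable_within_continuous => x /[!in_itv]/= xab.
  by have [] := dF' x xab.
- by apply: dF0; rewrite !ltW.
Qed.

Lemma is_derive_powR1D a x : -1 < x ->
  is_derive x 1 (fun x : R => (1 + x) `^ a) (a * (1 + x) `^ (a - 1)).
Proof.
move=> x1; have x0 : 0 < 1 + x by rewrite -ltrBlDl sub0r.
have d1 : is_derive x 1 (fun x : R => 1 + x) (0 + 1) by exact: is_deriveD.
have := @is_derive1_comp R (@powR R ^~ a) (fun x : R => 1 + x) x _ _ (is_derive1_powR a x0) d1.
by rewrite add0r mulr1.
Qed.

Lemma is_derive_taylor_poly a s c x :
  is_derive x 1 (fun x : R => 1 + a * x - s * x ^+ 2 + c * x ^+ 3) (a - s * x *+ 2 + c * x ^+ 2 *+ 3).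
Proof.
have -> : (fun x : R => 1 + a * x - s * x ^+ 2 + c * x ^+ 3) = horner (1 + a%:P * 'X - s%:P * 'X^2 + c%:P * 'X^3).
  by apply/funext => y; rewrite !hornerE.
apply: (is_derive_eq (@is_derive_poly R _ x)).
rewrite !(derivD, derivB, derivM, derivC, derivXn, derivX, derivN) !hornerE/=.
by ring.
Qed.

Lemma powR_taylor_pos a p : 0 < a < 1 -> 0 <= p ->
  (1 + p) `^ a <= 1 + a * p - a * (1 - a) / 2 * p ^+ 2 + p ^+ 3.
Proof.
move=> /andP[a0 a1] p0.
pose s := a * (1 - a) / 2; rewrite -/s.
pose F x := (1 + a * x - s * x ^+ 2 + 1 * x ^+ 3) - (1 + x) `^ a.
have dF x : 0 <= x -> is_derive x 1 F ((a - s * x *+ 2 + 1 * x ^+ 2 *+ 3) - a * (1 + x) `^ (a - 1)).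
  move=> x0; apply: is_deriveB; first exact: is_derive_taylor_poly.
  by apply: is_derive_powR1D; lra.
have F0 : F 0 = 0.
  by rewrite /F !expr0n/= !mulr0 !addr0 subr0 powR1 subrr.
rewrite -subr_ge0 -[leLHS]F0.
rewrite -(mul1r (p ^+ 3)) -/(F p).
move: F F0 dF => F F0 dF.
apply: (derive_ge0_le_cc p0) => [x /andP[x0 _]|x /andP[x0 _]]; first exact: dF.
have x1 : 0 < 1 + x by lra.
have : (1 + x) `^ (a - 1) <= 1 - (1 - a) * x + x ^+ 2.
  rewrite powRB; last by rewrite (gt_eqF x1)/=; apply: implybT.
  rewrite powRr1 ?(ltW x1)// ler_pdivrMr//.
  apply: (le_trans (powR_bernoulli _ _)); [lra|lra|].
  by nra.
move: ((1 + x) `^ (a - 1)) => w H.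
have {}H := ler_wpM2l (ltW a0) H.
have x2 : 0 <= x ^+ 2 by exact: sqr_ge0.
have ax : a * x ^+ 2 <= x ^+ 2 by rewrite ler_piMl// ltW.
by rewrite /s; lra.
Qed.

Lemma powR_taylor_neg a p : 0 < a < 1 -> -1 < p <= 0 ->
  (1 + p) `^ a <= 1 + a * p - a * (1 - a) / 2 * p ^+ 2 - p ^+ 3.
Proof.
move=> /andP[a0 a1] /andP[p1 p0].
pose s := a * (1 - a) / 2; rewrite -/s.
pose F x := (1 + a * x - s * x ^+ 2 + (-1) * x ^+ 3) - (1 + x) `^ a.
have dF x : -1 < x -> is_derive x 1 F ((a - s * x *+ 2 + (-1) * x ^+ 2 *+ 3) - a * (1 + x) `^ (a - 1)).
  move=> x0; apply: is_deriveB; first exact: is_derive_taylor_poly.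
  exact: is_derive_powR1D.
have F0 : F 0 = 0.
  by rewrite /F !expr0n/= !mulr0 !addr0 subr0 powR1 subrr.
rewrite -subr_ge0 -[leLHS]F0 -(mulN1r (p ^+ 3)) -/(F p) -lerN2.
move: F F0 dF => F F0 dF.
have dNF x : -1 < x -> is_derive x 1 (- F) (- ((a - s * x *+ 2 + (-1) * x ^+ 2 *+ 3) - a * (1 + x) `^ (a - 1))).
  by move=> x1; apply: is_deriveN; exact: dF.
apply: (@derive_ge0_le_cc (- F) _ _ _ p0) => [x /andP[x0 x0']|x /andP[x0 x0']].
  by apply: dNF; exact: lt_le_trans x0.
have x1 : 0 < 1 + x by lra.
have : 1 - (1 - a) * x <= (1 + x) `^ (a - 1).
  rewrite -(opprB 1 a) powRN -[leLHS]invrK lef_pV2 ?posrE ?powR_gt0 ?invr_gt0//; last by nra.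
  apply: (le_trans (powR_bernoulli _ _)); [lra|lra|].
  rewrite -[leRHS]mul1r ler_pdivlMr; last by nra.
  by have := sqr_ge0 ((1 - a) * x); lra.
move: ((1 + x) `^ (a - 1)) => w H.
have {}H := ler_wpM2l (ltW a0) H.
have x2 : 0 <= x ^+ 2 by exact: sqr_ge0.
have ax : a * x ^+ 2 <= x ^+ 2 by rewrite ler_piMl// ltW.
by rewrite /s; lra.
Qed.

Lemma powR_taylor a p : 0 < a < 1 -> -1 < p ->
  (1 + p) `^ a <= 1 + a * p - a * (1 - a) / 2 * p ^+ 2 + `|p| ^+ 3.
Proof.
move=> a01 p1; have [p0|p0] := leP 0 p.
  by rewrite ger0_norm//; exact: powR_taylor_pos.
rewrite ltr0_norm// (_ : (- p) ^+ 3 = - p ^+ 3); last by ring.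
apply: powR_taylor_neg => //; lra.
Qed.

Lemma powR_lip a e K x y : 0 < a < 1 -> 0 < e -> e <= x <= K -> e <= y <= K ->
  `|x `^ a - y `^ a| <= K `^ a / e * `|x - y|.
Proof.
move=> a01 e0.
wlog xy : x y / y <= x => [wl xK yK|].
  have [|/ltW] := leP y x; first by move/wl; apply.
  by move/wl; rewrite distrC [X in _ * X]distrC; apply.
move=> /andP[ex xK] /andP[ey yK].
have y0 : 0 < y by exact: lt_le_trans ey.
have x0 : 0 < x by exact: lt_le_trans ex.
have K0 : 0 < K by exact: lt_le_trans xK.
case/andP : (a01) => a0 a1.
rewrite ger0_norm; last first.
  by rewrite subr_ge0 ge0_ler_powR ?nnegrE// ltW.
rewrite ger0_norm ?subr_ge0//.
have q0 : 0 <= (x - y) / y by rewrite divr_ge0// ?subr_ge0// ltW.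
have -> : x `^ a = y `^ a * (1 + (x - y) / y) `^ a.
  rewrite -powRM ?ltW//; last by lra.
  by congr (_ `^ _); field; rewrite gt_eqF.
rewrite -[X in _ - X]mulr1 -mulrBr -mulrA.
apply: ler_pM; rewrite ?powR_ge0//.
- rewrite subr_ge0; apply: (@le_trans _ _ (1 `^ a)); first by rewrite powR1.
  apply: ge0_ler_powR; rewrite ?nnegrE ?(ltW a0)//; lra.
- by apply: ge0_ler_powR; rewrite ?nnegrE ?(ltW a0) ?(ltW y0) ?(ltW K0).
rewrite lerBlDl; apply: (le_trans (powR_bernoulli _ _)); [lra|lra|].
rewrite lerD2l; apply: (@le_trans _ _ ((x - y) / y)).
  by rewrite ler_piMl// ltW.
by rewrite mulrC ler_wpM2r ?subr_ge0// lef_pV2 ?posrE.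
Qed.

Lemma ler_norm_mul (x y u v : R) : `|x| <= u -> `|y| <= v -> `|x * y| <= u * v.
Proof. by move=> xu yv; rewrite normrM ler_pM. Qed.

(* With [p], [r] the relative increments of the two functions over a Gaussian
   step of size [h] and [X], [Y] their linear parts. *)
Lemma powR_prod_taylor (al be p r X Y h m : R) : 0 < al < 1 -> 0 < be < 1 ->
  -1 < p -> -1 < r -> 0 <= h <= 1 -> 1 <= m ->
  `|p| <= h * m -> `|r| <= h * m -> `|X| <= m -> `|Y| <= m ->
  `|p - h * X| <= h ^+ 2 * m -> `|r - h * Y| <= h ^+ 2 * m ->
  (1 + p) `^ al * (1 + r) `^ be <= 1 + al * p + be * r +
    h ^+ 2 * (al * be * X * Y - al * (1 - al) / 2 * X ^+ 2 - be * (1 - be) / 2 * Y ^+ 2)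
    + 20 * h ^+ 3 * m ^+ 6.
Proof.
move=> a01 b01 p1 r1 /andP[h0 h1] m1 pm rm Xm Ym pX rY.
have m0 : 0 <= m by exact: le_trans m1.
have [/andP[a0 a1] /andP[b0 b1]] := (a01, b01).
set s := al * (1 - al) / 2; set s' := be * (1 - be) / 2.
have s01 : 0 <= s <= 1 by rewrite /s; nra.
have s'01 : 0 <= s' <= 1 by rewrite /s'; nra.
set A2 : R := - s * p ^+ 2 + `|p| ^+ 3.
set B2 : R := - s' * r ^+ 2 + `|r| ^+ 3.
have hX : `|h * X| <= h * m by rewrite normrM (ger0_norm h0) ler_wpM2l.
have hY : `|h * Y| <= h * m by rewrite normrM (ger0_norm h0) ler_wpM2l.
(* Since [h <= 1 <= m], every remainder of order at least three in [h] and at most six in [m] is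
   absorbed into [h ^+ 3 * m ^+ 6]. *)
have mono k l : (3 <= k)%N -> (l <= 6)%N -> h ^+ k * m ^+ l <= h ^+ 3 * m ^+ 6.
  move=> k3 l6; apply: ler_pM; rewrite ?exprn_ge0//; first exact: ler_wiXn2l.
  exact: ler_weXn2l.
have quad (x t : R) : 0 <= t <= 1 -> `|x| <= h * m -> `|- t * x ^+ 2 + `|x| ^+ 3| <= 2 * (h ^+ 2 * m ^+ 3).
  move=> /andP[t0 t1] xm; rewrite (le_trans (ler_normD _ _))// mulrDl !mul1r.
  apply: lerD.
    rewrite normrM normrN (ger0_norm t0) normrX -[leRHS]mul1r; apply: ler_pM => //.
    rewrite (@le_trans _ _ ((h * m) ^+ 2))// ?lerXn2r ?nnegrE ?mulr_ge0//.
    by rewrite exprMn ler_wpM2l ?exprn_ge0// ler_weXn2l.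
  rewrite normrX normr_id (@le_trans _ _ ((h * m) ^+ 3))// ?lerXn2r ?nnegrE ?mulr_ge0//.
  by rewrite exprMn ler_wpM2r ?exprn_ge0// ler_wiXn2l.
have cub (x : R) : `|x| <= h * m -> `|x| ^+ 3 <= h ^+ 3 * m ^+ 6.
  move=> xm; rewrite (@le_trans _ _ ((h * m) ^+ 3))// ?lerXn2r ?nnegrE ?mulr_ge0//.
  by rewrite exprMn mono.
have HA2 : `|A2| <= 2 * (h ^+ 2 * m ^+ 3) by exact: quad.
have HB2 : `|B2| <= 2 * (h ^+ 2 * m ^+ 3) by exact: quad.
have ap : `|al * p| <= h * m by rewrite normrM gtr0_norm// (le_trans _ pm)// ler_piMl// ltW.
have br : `|be * r| <= h * m by rewrite normrM gtr0_norm// (le_trans _ rm)// ler_piMl// ltW.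
have i1 := ler_norm_mul ap HB2.
have i2 := ler_norm_mul br HA2.
have i3 := ler_norm_mul HA2 HB2.
have i4 := ler_norm_mul pm rY.
have i5 := ler_norm_mul pX hY.
have i6 : `|p + h * X| <= 2 * (h * m).
  by rewrite (le_trans (ler_normD _ _))//; lra.
have i7 : `|r + h * Y| <= 2 * (h * m).
  by rewrite (le_trans (ler_normD _ _))//; lra.
have i8 := ler_norm_mul pX i6.
have i9 := ler_norm_mul rY i7.
have c1 := cub _ pm.
have c2 := cub _ rm.
have e1 : h * m * (2 * (h ^+ 2 * m ^+ 3)) <= 2 * (h ^+ 3 * m ^+ 6).
  by rewrite [leLHS](_ : _ = 2 * (h ^+ 3 * m ^+ 4)); [rewrite ler_pM2l// mono|ring].
have e2 : 2 * (h ^+ 2 * m ^+ 3) * (2 * (h ^+ 2 * m ^+ 3)) <= 4 * (h ^+ 3 * m ^+ 6).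
  by rewrite [leLHS](_ : _ = 4 * (h ^+ 4 * m ^+ 6)); [rewrite ler_pM2l// mono|ring].
have e3 : h * m * (h ^+ 2 * m) <= h ^+ 3 * m ^+ 6.
  by rewrite [leLHS](_ : _ = h ^+ 3 * m ^+ 2); [rewrite mono|ring].
have e4 : h ^+ 2 * m * (h * m) <= h ^+ 3 * m ^+ 6 by rewrite mulrC.
have e5 : h ^+ 2 * m * (2 * (h * m)) <= 2 * (h ^+ 3 * m ^+ 6).
  by rewrite mulrCA ler_pM2l.
have Ha := powR_taylor a01 p1; have Hb := powR_taylor b01 r1.
have prE : al * be * (p * r) <= al * be * (h ^+ 2 * X * Y) + 2 * (h ^+ 3 * m ^+ 6).
  have ab1 : 0 <= al * be <= 1.
    by rewrite mulr_ge0 ?(ltW a0) ?(ltW b0)//= mulr_ile1 ?(ltW a0) ?(ltW b0) ?(ltW a1) ?(ltW b1).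
  have : p * r - h ^+ 2 * X * Y <= 2 * (h ^+ 3 * m ^+ 6).
    rewrite (_ : _ - _ = p * (r - h * Y) + (p - h * X) * (h * Y)); last by ring.
    move: i4 i5; rewrite !ler_norml; lra.
  set D := _ - _ => HD; have {}HD : al * be * D <= 2 * (h ^+ 3 * m ^+ 6).
    have [D0|D0] := leP 0 D.
      by rewrite (le_trans _ HD)// ler_piMl//; lra.
    have w0 : 0 <= h ^+ 3 * m ^+ 6 by rewrite mulr_ge0// exprn_ge0.
    apply: (@le_trans _ _ 0); last by lra.
    by rewrite mulr_ge0_le0 ?(ltW D0)//; lra.
  by rewrite -lerBlDl -mulrBr.
have sq (t x Z : R) : 0 <= t <= 1 -> `|(x - h * Z) * (x + h * Z)| <= h ^+ 2 * m * (2 * (h * m)) ->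
    - t * x ^+ 2 <= - t * (h ^+ 2 * Z ^+ 2) + 2 * (h ^+ 3 * m ^+ 6).
  move=> /andP[t0 t1] H.
  have {}H : `|t * ((x - h * Z) * (x + h * Z))| <= 2 * (h ^+ 3 * m ^+ 6).
    rewrite normrM (ger0_norm t0) (le_trans _ e5)// (le_trans _ H)// ler_piMl//.
  by move: H; rewrite ler_norml => /andP[H _]; lra.
have sp := sq s p X s01 i8.
have sr := sq s' r Y s'01 i9.
apply: (@le_trans _ _ ((1 + (al * p + A2)) * (1 + (be * r + B2)))).
  apply: ler_pM; rewrite ?powR_ge0//.
    by move: Ha; rewrite -/s /A2; lra.
  by move: Hb; rewrite -/s' /B2; lra.
have -> : (1 + (al * p + A2)) * (1 + (be * r + B2)) = 1 + al * p + be * r + A2 + B2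
   + al * be * (p * r) + (al * p * B2) + (be * r * A2) + A2 * B2 by ring.
have {}i1 := le_trans (le_trans (ler_norm _) i1) e1.
have {}i2 := le_trans (le_trans (ler_norm _) i2) e1.
have {}i3 := le_trans (le_trans (ler_norm _) i3) e2.
have w0 : 0 <= h ^+ 3 * m ^+ 6 by rewrite mulr_ge0// exprn_ge0.
have A2E : A2 = - s * p ^+ 2 + `|p| ^+ 3 by [].
have B2E : B2 = - s' * r ^+ 2 + `|r| ^+ 3 by [].
rewrite [in leRHS](_ : h ^+ 2 * _ = al * be * (h ^+ 2 * X * Y) + - s * (h ^+ 2 * X ^+ 2)
  + - s' * (h ^+ 2 * Y ^+ 2)); last by ring.
(* The remainders sum to sixteen copies of [h ^+ 3 * m ^+ 6]: eight from the three mixed products,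
   two from the cubes, two from replacing [p * r], four from replacing the squares. The constant
   [20] leaves room. *)
move: (al * p * B2) (be * r * A2) (A2 * B2) i1 i2 i3 => t1 t2 t3 i1 i2 i3.
rewrite A2E B2E.
move: i1 i2 i3 w0; move: (h ^+ 3 * m ^+ 6) (mulrA 20 (h ^+ 3) (m ^+ 6)) e1 e2 e3 e4 e5 c1 c2 prE sp sr => w <-.
clear; lra.
Qed.

End scalar.

(** * Gaussian integrals on the line *)

(* [lebesgue_measure] and [normal_prob] live on [measurableTypeR R]; these
   copies live on [R] itself, where measurability lemmas are stated. *)
Section real_copies.
Context {R : realType}.

Definition leb : set R -> \bar R := @lebesgue_measure R.

Let leb0 : leb set0 = 0%E. Proof. exact: (measure0 (@lebesgue_measure R)). Qed.
Let leb_ge0 A : (0 <= leb A)%E.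
Proof. exact: (measure_ge0 (@lebesgue_measure R)). Qed.
Let leb_sigma : semi_sigma_additive leb.
Proof. exact: (@measure_semi_sigma_additive _ _ _ (@lebesgue_measure R)). Qed.
HB.instance Definition _ := isMeasure.Build _ R _ leb leb0 leb_ge0 leb_sigma.

Let leb_sfin : sigma_finite [set: R] leb.
Proof. exact: (@sigma_finiteT _ _ _ (@lebesgue_measure R)). Qed.
HB.instance Definition _ := @Measure_isSigmaFinite.Build _ _ _ leb leb_sfin.

Variables m s : R.
Definition nrm : set R -> \bar R := normal_prob m s.

Let nrm0 : nrm set0 = 0%E. Proof. exact: (measure0 (normal_prob m s)). Qed.
Let nrm_ge0 A : (0 <= nrm A)%E. Proof. exact: (measure_ge0 (normal_prob m s)). Qed.
Let nrm_sigma : semi_sigma_additive nrm.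
Proof. exact: (@measure_semi_sigma_additive _ _ _ (normal_prob m s)). Qed.
HB.instance Definition _ := isMeasure.Build _ R _ nrm nrm0 nrm_ge0 nrm_sigma.

Let nrmT : nrm setT = 1%E. Proof. exact: (@probability_setT _ _ _ (normal_prob m s)). Qed.
HB.instance Definition _ := @Measure_isProbability.Build _ _ R nrm nrmT.

End real_copies.
Notation gam := (nrm 0 1).

(** * Affine changes of variable on the line *)

Section affine.
Context {R : realType}.
Local Notation mu := (@lebesgue_measure R).
Local Open Scope ereal_scope.

Lemma measurable_affine (a b : R) :
  measurable_fun [set: R] (fun x : R => (a * x + b)%R).
Proof. by apply: measurable_funD => //; exact: measurable_funM. Qed.

Lemma integral_lebE (f : R -> \bar R) :
  measurable_fun [set: R] f -> (forall x, 0 <= f x) ->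
  \int[mu]_x f x = \int[leb]_x f x.
Proof.
move=> mf f0.
have mid : measurable_fun [set: R] (fun x : R => x : measurableTypeR R).
  by move=> _ A mA; rewrite setTI.
have := @ge0_integral_pushforward _ _ _ _ R (fun x : R => x : measurableTypeR R) mid leb setT f measurableT mf (fun x _ => f0 x).
by rewrite preimage_setT /= => <-; exact: eq_measure_integral.
Qed.

Lemma leb_unique (nu : {measure set R -> \bar R}) :
  (forall u v : R, leb `]u, v]%classic = nu `]u, v]%classic) ->
  forall A, measurable A -> leb A = nu A.
Proof.
move=> nuE A mA.
pose nu' : set (measurableTypeR R) -> \bar R := nu.
have m := isMeasure.Build _ (measurableTypeR R) _ nu' (measure0 nu)
  (measure_ge0 nu) (@measure_semi_sigma_additive _ _ _ nu).
pose NU : {measure set (measurableTypeR R) -> \bar R} := HB.pack nu' m.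
by apply: (@lebesgue_measure_unique R NU) => // _ [[u v]] _ <-; exact: nuE.
Qed.

Lemma lebesgue_affine (a b : R) (A : set R) : a != 0%R -> measurable A ->
  leb A = (`|a|%R)%:E * leb ((fun x : R => (a * x + b)%R) @^-1` A).
Proof.
move=> a0 mA.
pose phi := fun x : R => (a * x + b)%R : R.
pose nu := mscale (NngNum (normr_ge0 a)) (pushforward leb phi).
rewrite -[RHS]/(nu (measurable_affine a b) A).
apply: leb_unique => // u v.
rewrite -[RHS]/(`|a|%:E * leb (phi @^-1` `]u, v]%classic))/=.
have [uv|vu] := ltP u v; last first.
  rewrite set_itv_ge ?bnd_simp -?leNgt// preimage_set0 !measure0.
  by rewrite mule0.
have [a_gt0|a_lt0|/eqP] := ltgtP 0%R a; last by rewrite eq_sym (negbTE a0).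
  have -> : (phi @^-1` `]u, v]%classic)%classic = `]((u - b) / a)%R, ((v - b) / a)%R]%classic.
    apply/seteqP; split => x /=; rewrite /phi !in_itv/=.
      by rewrite ltr_pdivrMr// ler_pdivlMr// ltrBlDr lerBrDr (mulrC x).
    by rewrite ltr_pdivrMr// ler_pdivlMr// ltrBlDr lerBrDr (mulrC x).
  rewrite /leb !lebesgue_measure_itv/= !lte_fin uv ltr_pM2r ?invr_gt0// ltrD2r uv.
  rewrite gtr0_norm// -!EFinB -EFinM; congr EFin.
  by field; lra.
(* A negative slope reverses the interval and moves its closed end to the left; the length is
   unaffected. *)
have -> : (phi @^-1` `]u, v]%classic)%classic = `[((v - b) / a)%R, ((u - b) / a)%R[%classic.
  apply/seteqP; split => x /=; rewrite /phi !in_itv/=.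
    by rewrite ltr_ndivlMr// ler_ndivrMr// ltrBlDr lerBrDr (mulrC x) => /andP[-> ->].
  by rewrite ltr_ndivlMr// ler_ndivrMr// ltrBlDr lerBrDr (mulrC x) => /andP[-> ->].
rewrite /leb !lebesgue_measure_itv/= !lte_fin uv ltr_nM2r ?invr_lt0// ltrD2r uv.
rewrite ltr0_norm// -!EFinB -EFinM; congr EFin.
by field; lra.
Qed.

Lemma integral_affine (a b : R) (f : R -> \bar R) : a != 0%R ->
  measurable_fun [set: R] f -> (forall x, 0 <= f x) ->
  \int[leb]_x f x = (`|a|%R)%:E * \int[leb]_x f (a * x + b)%R.
Proof.
move=> a0 mf f0.
pose phi := fun x : R => (a * x + b)%R : R.
have := @ge0_integral_pushforward _ _ _ _ R phi (measurable_affine a b) leb setT f measurableT mf (fun x _ => f0 x).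
rewrite preimage_setT /= => <-.
pose nu := ge0_integral_mscale (pushforward leb phi) measurableT (NngNum (normr_ge0 a)).
rewrite -(nu (measurable_affine a b))//.
apply: eq_measure_integral => A mA _.
by rewrite /mscale/=; exact: lebesgue_affine.
Qed.

End affine.

Section density.
Context {R : realType}.
Local Notation mu := (@leb R).
Local Open Scope ereal_scope.
Import HBNNSimple.

(** For indicators this is the definition of [normal_prob]; simple functions and monotone
    convergence carry it to all nonnegative measurable functions. *)
Lemma integral_normal (m s : R) (f : R -> \bar R) :
  measurable_fun [set: R] f -> (forall x, 0 <= f x) ->
  \int[nrm m s]_x f x = \int[mu]_x (f x * (normal_pdf m s x)%:E).
Proof.
move=> mf f0.
have mp : measurable_fun [set: R] (fun x => (normal_pdf m s x)%:E).
  by apply/measurable_EFinP; exact: measurable_normal_pdf.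
have p0 x : 0 <= (normal_pdf m s x)%:E by rewrite lee_fin normal_pdf_ge0.
pose f_ := nnsfun_approx measurableT mf.
transitivity (limn (fun n => \int[nrm m s]_x (f_ n x)%:E)).
  rewrite -monotone_convergence//.
  - by apply: eq_integral => y _; apply/esym/cvg_lim => //; exact: cvg_nnsfun_approx.
  - by move=> n; exact/measurable_EFinP/measurable_funP.
  - by move=> n y _; rewrite lee_fin.
  - by move=> y _ i j ij; rewrite lee_fin; exact/lefP/nd_nnsfun_approx.
rewrite [X in limn X](_ : _ = (fun n => \int[mu]_x ((f_ n x)%:E * (normal_pdf m s x)%:E))).
  rewrite -monotone_convergence//; last 3 first.
    - move=> n; apply: emeasurable_funM => //.
      exact/measurable_EFinP/measurable_funP.
    - by move=> n x _; rewrite mule_ge0// lee_fin.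
    - by move=> x _ i j ij; rewrite lee_wpmul2r// lee_fin; exact/lefP/nd_nnsfun_approx.
  apply: eq_integral => x _; apply/cvg_lim => //.
  by apply: cvgeZr => //; exact: cvg_nnsfun_approx.
apply/funext => n.
under eq_integral do rewrite fimfunE -fsumEFin//.
rewrite ge0_integral_fsum//; last 2 first.
- by move=> y; exact/measurable_EFinP/measurable_funM.
- by move=> y x _; rewrite nnfun_muleindic_ge0.
have fE x : (f_ n x)%:E * (normal_pdf m s x)%:E = \sum_(k \in range (f_ n))
    (k * \1_(f_ n @^-1` [set k]) x)%:E * (normal_pdf m s x)%:E.
  by rewrite fimfunE -fsumEFin// ge0_mule_fsuml// => r; rewrite nnfun_muleindic_ge0.
under [RHS]eq_integral do rewrite fE.
rewrite ge0_integral_fsum//; last 2 first.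
- by move=> y; apply: emeasurable_funM => //; exact/measurable_EFinP/measurable_funM.
- by move=> y x _; rewrite mule_ge0// nnfun_muleindic_ge0.
apply: eq_fsbigr => r /[!inE] rf; rewrite integralZl_indic_nnsfun//.
have r0 : (0 <= r)%R by case: rf => x _ <-.
under [RHS]eq_integral do rewrite EFinM -muleA.
rewrite ge0_integralZl//; last 2 first.
- by apply: emeasurable_funM => //; apply/measurable_EFinP.
- by move=> x _; rewrite mule_ge0// lee_fin.
congr (_ * _).
rewrite integral_indic//= setIT [LHS]integral_mkcond.
rewrite -[RHS]integral_lebE; last 2 first.
- by apply: emeasurable_funM => //; apply/measurable_EFinP.
- by move=> x; rewrite mule_ge0// lee_fin.
apply: eq_integral => x _; rewrite patchE indicE.
by case: ifPn => _; rewrite ?mul1e ?mul0e.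
Qed.

End density.

(** * Rotation, translation and moments of the standard normal law *)

Section gauss.
Context {R : realType}.
Local Notation mu := (@leb R).
Local Open Scope ereal_scope.

Lemma normal_pdf01E (x : R) :
  normal_pdf 0 1 x = ((Num.sqrt (pi *+ 2))^-1 * expR (- x ^+ 2 / 2))%R.
Proof.
rewrite normal_pdfE ?oner_eq0// /normal_peak /normal_fun expr1n mul1r subr0.
by congr (_ * expR _)%R; congr (_ / _)%R; rewrite mulr2n -natr1.
Qed.

(** Substituting [s = a * x + b * y] turns the inner integral into one against the normal law of
    mean [a * x] and deviation [b], which is why [0 < b] is required. After Tonelli, the symmetry of
    the joint density in [x] and [s] leaves a total mass equal to one. *)
Lemma gauss_rotation (a b : R) (F : R -> \bar R) : (a ^+ 2 + b ^+ 2 = 1)%R -> (0 < b)%R ->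
  measurable_fun [set: R] F -> (forall x, 0 <= F x) ->
  \int[gam]_x \int[gam]_y F (a * x + b * y)%R = \int[gam]_x F x.
Proof.
move=> ab b0 mF F0.
have mp (m s : R) : measurable_fun [set: R] (fun x => (normal_pdf m s x)%:E).
  by apply/measurable_EFinP; exact: measurable_normal_pdf.
have p0 m s (x : R) : 0 <= (normal_pdf m s x)%:E by rewrite lee_fin normal_pdf_ge0.
have mpF : measurable_fun [set: R * R] (fun z : R * R => (normal_pdf (a * z.1) b z.2)%:E).
  apply/measurable_EFinP.
  rewrite (_ : (fun _ => _) = (fun z : R * R => normal_peak b * expR (- (z.2 - a * z.1) ^+ 2 / (b ^+ 2 *+ 2)))%R); last first.
    by apply/funext => z; rewrite normal_pdfE ?gt_eqF.
  apply: measurable_funM => //; apply: measurableT_comp => //.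
  apply: measurable_funM => //; apply: measurableT_comp => //; apply: measurable_funX.
  by apply: measurable_funB => //; apply: measurable_funM.
have mFa x : measurable_fun [set: R] (fun y => F (a * x + b * y)%R).
  by apply: (measurableT_comp mF); apply: measurable_funD.
have step1 x : \int[gam]_y F (a * x + b * y)%R = \int[mu]_s (F s * (normal_pdf (a * x) b s)%:E).
  rewrite integral_normal; [|exact: mFa|by move=> y; exact: F0].
  rewrite [RHS](@integral_affine _ b (a * x)%R); last 3 first.
    by rewrite gt_eqF.
    by apply: emeasurable_funM; [exact: mF|exact: mp].
    by move=> y; rewrite mule_ge0.
  rewrite -ge0_integralZl//; last 2 first.
    apply: emeasurable_funM.
      under eq_fun do rewrite addrC.
      exact: mFa.
    exact: (measurableT_comp (mp _ _) (measurable_affine _ _)).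
    by move=> y _; rewrite mule_ge0.
  apply: eq_integral => y _; rewrite muleCA addrC; congr (_ * _).
  rewrite -EFinM; congr EFin.
  rewrite normal_pdf01E normal_pdfE ?gt_eqF// /normal_peak /normal_fun.
  rewrite gtr0_norm// mulrA; congr (_ * expR _)%R.
    rewrite -mulrnAr sqrtrM ?sqr_ge0// sqrtr_sqr gtr0_norm// invfM mulrA divff ?mul1r//.
    by rewrite gt_eqF.
  by rewrite (_ : (b * y + a * x - a * x = b * y)%R); [field; lra | ring].
under eq_integral do rewrite step1.
have mG : measurable_fun [set: R * R] (fun z : R * R => F z.2 * (normal_pdf (a * z.1) b z.2)%:E).
  by apply: emeasurable_funM => //; exact: (measurableT_comp mF).
have G0 (z : R * R) : 0 <= F z.2 * (normal_pdf (a * z.1) b z.2)%:E.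
  by rewrite mule_ge0.
rewrite [LHS]integral_normal; last 2 first.
- exact: (@measurable_fun_fubini_tonelli_F _ _ _ _ _ leb _ mG).
- by move=> x; apply: integral_ge0 => y _; rewrite mule_ge0.
rewrite integral_normal; [|exact: mF|exact: F0].
transitivity (\int[mu]_x \int[mu]_s (F s * (normal_pdf (a * x) b s)%:E * (normal_pdf 0 1 x)%:E)).
  apply: eq_integral => x _; rewrite -ge0_integralZr//.
    by apply: emeasurable_funM; [exact: mF|exact: mp].
  by move=> y _; rewrite mule_ge0.
rewrite (@fubini_tonelli _ _ _ _ _ mu mu (fun z => F z.2 * (normal_pdf (a * z.1) b z.2)%:E * (normal_pdf 0 1 z.1)%:E)); last 2 first.
- by apply: emeasurable_funM => //; exact: (measurableT_comp (mp _ _)).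
- by move=> z; rewrite mule_ge0.
apply: eq_integral => s _ /=.
(* The joint density of a standard pair with correlation [a] is symmetric, so it factors equally
   well as the law of [s] times the law of [x] given [s]; [a ^+ 2 + b ^+ 2 = 1] is what equates the
   exponents. *)
transitivity (\int[mu]_x ((F s * (normal_pdf 0 1 s)%:E) * (normal_pdf (a * s) b x)%:E)).
  apply: eq_integral => x _; rewrite -!muleA; congr (_ * _); rewrite -!EFinM; congr EFin.
  rewrite !normal_pdf01E !normal_pdfE ?gt_eqF// /normal_fun.
  rewrite [LHS]mulrACA [RHS]mulrACA (mulrC (normal_peak _)); congr (_ * _)%R.
  rewrite -!expRD; congr expR.
  have a2 : (a ^+ 2 = 1 - b ^+ 2)%R by rewrite -ab addrK.
  apply/eqP; rewrite -subr_eq0; apply/eqP.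
  have b2 : (b ^+ 2 != 0)%R by rewrite sqrf_eq0 gt_eqF.
  transitivity (((s ^+ 2 - x ^+ 2) * (a ^+ 2 + b ^+ 2 - 1) / (2 * b ^+ 2))%R); last by rewrite ab subrr mulr0 mul0r.
  by field; lra.
rewrite ge0_integralZl//; last by rewrite mule_ge0.
by rewrite -integral_lebE// integral_normal_pdf mule1.
Qed.

(** The Cameron-Martin formula: translating the variable by [th] multiplies the density by an
    exponential weight. *)
Lemma gauss_shift (th : R) (F : R -> \bar R) :
  measurable_fun [set: R] F -> (forall x, 0 <= F x) ->
  \int[gam]_x F (x + th)%R = \int[gam]_x (F x * (expR (th * x - th ^+ 2 / 2))%:E).
Proof.
move=> mF F0.
have mp (m s : R) : measurable_fun [set: R] (fun x => (normal_pdf m s x)%:E).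
  by apply/measurable_EFinP; exact: measurable_normal_pdf.
have p0 m s (x : R) : 0 <= (normal_pdf m s x)%:E by rewrite lee_fin normal_pdf_ge0.
have me : measurable_fun [set: R] (fun x : R => (expR (th * x - th ^+ 2 / 2))%:E).
  apply/measurable_EFinP; apply: measurableT_comp => //.
  by apply: measurable_funB => //; exact: measurable_funM.
have ma : measurable_fun [set: R] (fun x : R => x + th)%R by exact: measurable_funD.
rewrite integral_normal; [|exact: (measurableT_comp mF ma)|by move=> x; exact: F0].
rewrite integral_normal; last 2 first.
- exact: emeasurable_funM.
- by move=> x; rewrite mule_ge0// lee_fin expR_ge0.
rewrite [RHS](@integral_affine _ 1 th) ?oner_eq0//; last 2 first.
- by apply: emeasurable_funM => //; exact: emeasurable_funM.
- by move=> x; rewrite !mule_ge0// lee_fin expR_ge0.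
rewrite normr1 mul1e; apply: eq_integral => x _; rewrite mul1r -muleA; congr (_ * _).
rewrite -EFinM; congr EFin; rewrite !normal_pdf01E mulrCA; congr (_ * _)%R.
by rewrite -expRD; congr expR; field.
Qed.

Lemma integral_gamN (F : R -> \bar R) :
  measurable_fun [set: R] F -> (forall x, 0 <= F x) ->
  \int[gam]_x F (- x)%R = \int[gam]_x F x.
Proof.
move=> mF F0.
have mp (m s : R) : measurable_fun [set: R] (fun x => (normal_pdf m s x)%:E).
  by apply/measurable_EFinP; exact: measurable_normal_pdf.
have p0 m s (x : R) : 0 <= (normal_pdf m s x)%:E by rewrite lee_fin normal_pdf_ge0.
rewrite integral_normal; [|exact: (measurableT_comp mF)|by move=> x; exact: F0].
rewrite [RHS]integral_normal//.
rewrite [RHS](@integral_affine _ (-1) 0) ?oppr_eq0 ?oner_eq0//; last 2 first.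
- exact: emeasurable_funM.
- by move=> x; rewrite mule_ge0.
rewrite normrN1 mul1e; apply: eq_integral => x _.
by rewrite mulN1r addr0 !normal_pdf01E sqrrN.
Qed.

(** The rate [1 / 4] turns the standard density into [Num.sqrt 2] times the density of variance [2],
    so the integral is read off. It dominates every polynomial and exponential integrand below. *)
Lemma gauss_exp_moment : \int[@nrm R 0 1]_x (expR (x ^+ 2 / 4))%:E < +oo.
Proof.
have mp (m s : R) : measurable_fun [set: R] (fun x => (normal_pdf m s x)%:E).
  by apply/measurable_EFinP; exact: measurable_normal_pdf.
have p0 m s (x : R) : 0 <= (normal_pdf m s x)%:E by rewrite lee_fin normal_pdf_ge0.
rewrite integral_normal; last 2 first.
- apply/measurable_EFinP; apply: measurableT_comp => //.
  by apply: measurable_funM.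
- by move=> x; rewrite lee_fin expR_ge0.
rewrite (_ : \int[mu]_x _ = \int[mu]_x ((Num.sqrt 2)%:E * (normal_pdf 0 (Num.sqrt 2) x)%:E)).
  rewrite ge0_integralZl//.
  by rewrite -integral_lebE// integral_normal_pdf mule1 ltry.
have s2 : (0 < Num.sqrt 2 :> R)%R by rewrite sqrtr_gt0.
apply: eq_integral => x _; rewrite -!EFinM; congr EFin.
rewrite normal_pdf01E normal_pdfE ?gt_eqF// /normal_peak /normal_fun mulrCA [RHS]mulrA.
congr (_ * _)%R.
  by rewrite sqr_sqrtr// -mulrnAr sqrtrM// invfM mulrA divff ?mul1r// gt_eqF.
by rewrite -expRD; congr expR; rewrite subr0 sqr_sqrtr// mulr2n; field.
Qed.

End gauss.

Ltac mfun :=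
  match goal with
  | |- measurable_fun _ (fun x => x) => exact: measurable_id
  | |- measurable_fun _ (fun x => ?c) => exact: measurable_cst
  | |- measurable_fun _ (fun x => x.1) => exact: measurable_fst
  | |- measurable_fun _ (fun x => x.2) => exact: measurable_snd
  | |- measurable_fun _ (fun x => (_ + _)%R) => apply: measurable_funD; mfun
  | |- measurable_fun _ (fun x => (- _)%R) => apply: measurable_funN; mfun
  | |- measurable_fun _ (fun x => (_ * _)%R) => apply: measurable_funM; mfun
  | |- measurable_fun _ (fun x => (_ ^+ _)%R) => apply: measurable_funX; mfun
  | |- measurable_fun _ (fun x => (_ `^ _)%R) => apply: (measurableT_comp (measurable_powR _)); mfun
  | |- measurable_fun _ (fun x => expR _) => apply: (measurableT_comp (@measurable_expR _)); mfun
  | |- measurable_fun _ (fun x => (Num.norm _)%R) => apply: (measurableT_comp (@normr_measurable _ setT)); mfun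
  | |- measurable_fun _ (fun x => EFin _) => apply/measurable_EFinP; mfun
  | |- measurable_fun _ (fun x => (_, _)) => apply: measurable_fun_pair; mfun
  | |- measurable_fun _ (fun x => fst _) => apply: (measurableT_comp measurable_fst); mfun
  | |- measurable_fun _ (fun x => snd _) => apply: (measurableT_comp measurable_snd); mfun
  | H : measurable_fun _ ?f |- measurable_fun _ (fun x => ?f _) => apply: (measurableT_comp H); mfun
  | _ => try by []
  end.

Section bounded_integrals.
Context {d} {T : measurableType d} {R : realType} (P : probability T R).

Lemma bounded_integrable (f : T -> R) (K : R) :
  measurable_fun setT f -> (forall x, `|f x| <= K) ->
  P.-integrable setT (EFin \o f).
Proof.
move=> mf fK; apply: measurable_bounded_integrable => //.
  by apply: (le_lt_trans (probability_le1 _ _)) => //; exact: ltry.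
by exists K; split; [exact: num_real|] => M KM x _; apply: (le_trans (fK x)); exact: ltW.
Qed.

Lemma EFin_Rintegral (f : T -> R) : P.-integrable setT (EFin \o f) ->
  (\int[P]_x (f x)%:E = (\int[P]_x f x)%:E)%E.
Proof. by move=> fi; rewrite fineK//; exact: integrable_fin_num. Qed.

Lemma Rintegral_prob_cst (k : R) : \int[P]_x k = k.
Proof. by rewrite Rintegral_cst//= probability_setT /= mulr1. Qed.

Lemma integrable_prob_cst (k : R) : P.-integrable setT (EFin \o cst k).
Proof. by apply: (@bounded_integrable _ `|k|). Qed.

Lemma integrableRD (f g : T -> R) : P.-integrable setT (EFin \o f) ->
  P.-integrable setT (EFin \o g) -> P.-integrable setT (EFin \o (fun x => f x + g x)).
Proof. by move=> fi gi; rewrite (_ : _ \o _ = (EFin \o f) \+ (EFin \o g))%E//; exact: integrableD. Qed.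

Lemma integrableRB (f g : T -> R) : P.-integrable setT (EFin \o f) ->
  P.-integrable setT (EFin \o g) -> P.-integrable setT (EFin \o (fun x => f x - g x)).
Proof. by move=> fi gi; rewrite (_ : _ \o _ = (EFin \o f) \- (EFin \o g))%E//; exact: integrableB. Qed.

Lemma integrableRZ (k : R) (f : T -> R) : P.-integrable setT (EFin \o f) ->
  P.-integrable setT (EFin \o (fun x => k * f x)).
Proof. by move=> fi; rewrite (_ : _ \o _ = (fun x => k%:E * (EFin \o f) x))%E//; exact: integrableZl. Qed.

Lemma ge_Rintegral (f : T -> R) (e : R) : P.-integrable setT (EFin \o f) ->
  (forall x, e <= f x) -> e <= \int[P]_x f x.
Proof.
move=> fi ef; rewrite -[leLHS]Rintegral_prob_cst.
by apply: le_Rintegral => //; exact: integrable_prob_cst.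
Qed.

Lemma Rintegral_le (f : T -> R) (e : R) : P.-integrable setT (EFin \o f) ->
  (forall x, f x <= e) -> \int[P]_x f x <= e.
Proof.
move=> fi ef; rewrite -[leRHS]Rintegral_prob_cst.
by apply: le_Rintegral => //; exact: integrable_prob_cst.
Qed.

Lemma norm_Rintegral_le (f : T -> R) (e : R) : P.-integrable setT (EFin \o f) ->
  (forall x, `|f x| <= e) -> `|\int[P]_x f x| <= e.
Proof.
move=> fi ef; rewrite ler_norml; apply/andP; split.
  by apply: ge_Rintegral => // x; have := ef x; rewrite ler_norml => /andP[].
by apply: Rintegral_le => // x; have := ef x; rewrite ler_norml => /andP[].
Qed.

End bounded_integrals.

(** * The heat semigroup and a regularity class that it preserves *)

Section heat.
Context {R : realType}.
Implicit Types (f g : R -> R) (h x y e K M : R).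

(** The heat semigroup at time [h ^+ 2 / 2]: multiplying [h] by [Num.sqrt 2] doubles the time. *)
Definition heat h f x : R := \int[@nrm R 0 1]_y f (x + h * y).

(** Here [f1] stands for the derivative. Regularity is phrased as a uniform Taylor inequality
    because such an inequality can be averaged without changing [M]; [f1] is measurable so that it
    can be averaged too. *)
Definition C11 e K M f := [/\ measurable_fun setT f, (forall x, e <= f x <= K) &
  exists f1, [/\ measurable_fun setT f1, (forall x, `|f1 x| <= M) &
    forall x y, `|f (x + y) - f x - f1 x * y| <= M * y ^+ 2]].

Lemma measurable_shift f h x : measurable_fun setT f ->
  measurable_fun setT (fun y => f (x + h * y)).
Proof.
by move=> mf; mfun.
Qed.

(** Tonelli gives measurability for nonnegative integrands only, so [K] is added to the integrand
    and subtracted from the result. *)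
Lemma measurable_Rintegral_bounded {d} {T : measurableType d} (G : T * R -> R) (K : R) :
  measurable_fun setT G -> (forall z, `|G z| <= K) ->
  measurable_fun setT (fun x : T => \int[@nrm R 0 1]_y G (x, y)).
Proof.
move=> mG GK.
have mGx (x : T) : measurable_fun setT (fun y : R => G (x, y)) by exact: measurableT_comp.
have iGx (x : T) : (@nrm R 0 1).-integrable setT (EFin \o (fun y : R => G (x, y))).
  by apply: (@bounded_integrable _ _ _ (@nrm R 0 1) _ K).
have -> : (fun x : T => \int[@nrm R 0 1]_y G (x, y)) =
    (fun x : T => fine (\int[@nrm R 0 1]_y (G (x, y) + K)%:E)%E - K).
  apply/funext => x; rewrite -[X in X = _](addrK K); congr (_ - _).
  rewrite -[X in _ + X](Rintegral_prob_cst (@nrm R 0 1)) -RintegralD//.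
  exact: integrable_prob_cst.
apply: measurable_funB => //; apply: measurableT_comp => //.
apply: (@measurable_fun_fubini_tonelli_F _ _ _ _ _ (@nrm R 0 1) (fun z => (G z + K)%:E)).
  by apply/measurable_EFinP; exact: measurable_funD.
by move=> z; rewrite lee_fin -lerBlDr sub0r; have := GK z; rewrite ler_norml => /andP[].
Qed.

Lemma measurable_heat h f K : measurable_fun setT f -> (forall x, `|f x| <= K) ->
  measurable_fun setT (heat h f).
Proof.
move=> mf fK.
apply: (@measurable_Rintegral_bounded _ R (fun z : R * R => f (z.1 + h * z.2)) K) => //.
by mfun.
Qed.

Lemma C11_norm e K M f x : 0 <= e -> C11 e K M f -> `|f x| <= K.
Proof.
move=> e0 [_ fb _]; have /andP[ef fK] := fb x; rewrite ger0_norm//.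
exact: le_trans ef.
Qed.

(** Averaging the Taylor inequality of [f] gives that of [heat h f], with [heat h f1] as derivative.
    The constants do not deteriorate, so one error constant serves all the doublings. *)
Lemma C11_heat e K M h f : 0 <= e -> C11 e K M f -> C11 e K M (heat h f).
Proof.
move=> e0 Cf; have fK x := C11_norm x e0 Cf.
case: Cf => mf fb [f1 [mf1 f1M taylor]].
have int x : (@nrm R 0 1).-integrable setT (EFin \o (fun y => f (x + h * y))).
  by apply: (@bounded_integrable _ _ _ _ _ K) => //; exact: measurable_shift.
have int1 x : (@nrm R 0 1).-integrable setT (EFin \o (fun y => f1 (x + h * y))).
  by apply: (@bounded_integrable _ _ _ _ _ M) => //; exact: measurable_shift.
split; [exact: measurable_heat fK| |exists (heat h f1); split].
- move=> x; apply/andP; split.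
    by apply: ge_Rintegral => // y; have /andP[] := fb (x + h * y).
  by apply: Rintegral_le => // y; have /andP[] := fb (x + h * y).
- exact: measurable_heat f1M.
- by move=> x; exact: norm_Rintegral_le.
- move=> x y; rewrite /heat mulrC -RintegralZl// -RintegralB// -RintegralB//; last 2 first.
  + exact: integrableRB.
  + exact: integrableRZ.
  apply: norm_Rintegral_le.
    by apply: integrableRB => //; [exact: integrableRB|exact: integrableRZ].
  by move=> z; rewrite (mulrC y) (addrAC x y); exact: taylor.
Qed.

Lemma heatE e K M h f x : 0 <= e -> C11 e K M f ->
  (\int[@nrm R 0 1]_y (f (x + h * y))%:E = (heat h f x)%:E)%E.
Proof.
move=> e0 Cf; rewrite EFin_Rintegral//.
apply: (@bounded_integrable _ _ _ _ _ K) => [|y]; last exact: C11_norm Cf.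
by case: Cf => mf _ _; exact: measurable_shift.
Qed.

Lemma sqrt2V : (Num.sqrt 2)^-1 ^+ 2 + (Num.sqrt 2)^-1 ^+ 2 = 1 :> R.
Proof. by rewrite exprVn sqr_sqrtr//; field. Qed.

Lemma sqrt2V_gt0 : 0 < (Num.sqrt 2)^-1 :> R.
Proof. by rewrite invr_gt0 sqrtr_gt0. Qed.

Lemma gauss_double h (F : R -> \bar R) : measurable_fun setT F -> (forall x, 0 <= F x)%E ->
  (\int[@nrm R 0 1]_x \int[@nrm R 0 1]_y F (h * x + h * y)%R =
   \int[@nrm R 0 1]_x F (Num.sqrt 2 * h * x)%R)%E.
Proof.
move=> mF F0.
rewrite -(@gauss_rotation R (Num.sqrt 2)^-1 (Num.sqrt 2)^-1 (fun w => F (Num.sqrt 2 * h * w))).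
- apply: eq_integral => x _; apply: eq_integral => y _; congr F.
  by field; rewrite gt_eqF// sqrtr_gt0.
- exact: sqrt2V.
- exact: sqrt2V_gt0.
- by apply: (measurableT_comp mF); exact: measurable_funM.
- by move=> x; exact: F0.
Qed.

Lemma heat_heat e K M h f x : 0 <= e -> C11 e K M f ->
  heat h (heat h f) x = heat (Num.sqrt 2 * h) f x.
Proof.
move=> e0 Cf; have [mf fb _] := Cf.
have f0 z : 0 <= f z by have /andP[/(le_trans e0)] := fb z.
apply: EFin_inj; rewrite -(heatE _ _ e0 (C11_heat h e0 Cf)) -(heatE _ _ e0 Cf).
rewrite -(@gauss_double h (fun w => (f (x + w))%:E)).
- apply: eq_integral => y _; rewrite -(heatE _ _ e0 Cf).
  by apply: eq_integral => z _; rewrite addrA.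
- by apply/measurable_EFinP; apply: (measurableT_comp mf); exact: measurable_funD.
- by move=> z; rewrite lee_fin.
Qed.

(** Doubling in each coordinate, after which Tonelli exchanges the two middle variables: the outer
    pair is then the first step and the inner pair the second. *)
Lemma gauss_double2 h (H : R * R -> \bar R) : measurable_fun setT H -> (forall z, 0 <= H z)%E ->
  (\int[@nrm R 0 1]_x \int[@nrm R 0 1]_y H (Num.sqrt 2 * h * x, Num.sqrt 2 * h * y)%R =
   \int[@nrm R 0 1]_x \int[@nrm R 0 1]_y \int[@nrm R 0 1]_x' \int[@nrm R 0 1]_y'
     H (h * x + h * x', h * y + h * y')%R)%E.
Proof.
move=> mH H0.
pose Phi a := (\int[@nrm R 0 1]_y \int[@nrm R 0 1]_y' H (a, h * y + h * y')%R)%E.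
have mHa a : measurable_fun setT (fun y => H (a, y)) by exact: measurableT_comp.
have e1 a : (\int[@nrm R 0 1]_y H (a, Num.sqrt 2 * h * y)%R = Phi a)%E.
  by rewrite /Phi (gauss_double h (mHa a)).
have mPhi : measurable_fun setT Phi.
  rewrite (_ : Phi = fun a => (\int[@nrm R 0 1]_y H (a, Num.sqrt 2 * h * y)%R)%E); last first.
    by apply/funext => a; rewrite e1.
  apply: (@measurable_fun_fubini_tonelli_F _ _ _ _ _ (@nrm R 0 1) (fun z : R * R => H (z.1, Num.sqrt 2 * h * z.2))).
    by mfun.
  by move=> z; exact: H0.
under eq_integral do rewrite e1.
rewrite -(gauss_double h mPhi); last first.
  by move=> a; apply: integral_ge0 => y _; apply: integral_ge0.
apply: eq_integral => x _; rewrite /Phi.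
rewrite (@fubini_tonelli _ _ _ _ _ (@nrm R 0 1) (@nrm R 0 1)
  (fun z => \int[@nrm R 0 1]_y' H (h * x + h * z.1, h * z.2 + h * y')%R))%E//.
- apply: (@measurable_fun_fubini_tonelli_F _ _ _ _ _ (@nrm R 0 1) (fun z : (R * R) * R => H (h * x + h * z.1.1, h * z.1.2 + h * z.2))).
    by mfun.
  by move=> z; exact: H0.
- by move=> z; exact: integral_ge0.
Qed.

End heat.

Lemma prob_integralDc {d} {T : measurableType d} {R : realType} (P : probability T R)
  (f : T -> \bar R) (k : R) : measurable_fun setT f -> (forall x, 0 <= f x)%E -> 0 <= k ->
  (\int[P]_x (f x + k%:E) = \int[P]_x f x + k%:E)%E.
Proof.
move=> mf f0 k0; rewrite ge0_integralD//.
by rewrite integral_cst//= probability_setT mule1.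
Qed.

Section integral_values.
Context {d} {T : measurableType d} {R : realType} (mu : {measure set T -> \bar R}).

(** Integrability travels with the value, so a long sum can be integrated term by term without side
    conditions. *)
Definition has_integral (f : T -> R) v := mu.-integrable setT (EFin \o f) /\ \int[mu]_x f x = v.

Lemma has_integralD f g v w : has_integral f v -> has_integral g w ->
  has_integral (fun x => f x + g x) (v + w).
Proof.
move=> [fi <-] [gi <-]; split; last by rewrite RintegralD.
by rewrite (_ : _ \o _ = (EFin \o f) \+ (EFin \o g))%E//; exact: integrableD.
Qed.

Lemma has_integralZ k f v : has_integral f v -> has_integral (fun x => k * f x) (k * v).
Proof.
move=> [fi <-]; split; last by rewrite RintegralZl.
by rewrite (_ : _ \o _ = (fun x => k%:E * (EFin \o f) x))%E//; exact: integrableZl.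
Qed.

Lemma eq_has_integral f g v w : f =1 g -> v = w -> has_integral f v -> has_integral g w.
Proof. by move=> /funext -> ->. Qed.

Lemma ge0_has_integral (f : T -> R) (v : R) : measurable_fun setT f -> (forall x, 0 <= f x) ->
  (\int[mu]_x (f x)%:E = v%:E)%E -> has_integral f v.
Proof.
move=> mf f0 fv; split; last by rewrite /Rintegral fv.
apply/integrableP; split; first exact/measurable_EFinP.
by under eq_integral do rewrite /= ger0_norm//; rewrite fv ltry.
Qed.

End integral_values.

Section gauss_moments.
Context {R : realType}.
Local Notation G := (@nrm R 0 1).

(** The sixth power matches the factor [m ^+ 6] of [powR_prod_taylor]. Since [24 = 6 * 4], it is at
    most [24 ^+ 6] times [expR (u ^+ 2 / 24) ^+ 6], which is the integrable [expR (u ^+ 2 / 4)]. *)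
Lemma gam_integrable (phi : R -> R) (C : R) : measurable_fun setT phi ->
  (forall u, `|phi u| <= C * (1 + u ^+ 2) ^+ 6) -> G.-integrable setT (EFin \o phi).
Proof.
move=> mphi phiC.
have C0 : 0 <= C by have := le_trans (normr_ge0 _) (phiC 0); rewrite expr0n addr0 expr1n mulr1.
apply/integrableP; split; first exact/measurable_EFinP.
apply: (@le_lt_trans _ _ (\int[G]_u ((C * 24 ^+ 6)%:E * (expR (u ^+ 2 / 4))%:E))%E).
  apply: ge0_le_integral => //.
  - by apply: measurableT_comp => //; exact/measurable_EFinP.
  - by apply: measurable_funeM; mfun.
  move=> u _; rewrite -EFinM lee_fin (le_trans (phiC u))// -mulrA ler_wpM2l//.
  have -> : expR (u ^+ 2 / 4) = expR (u ^+ 2 / 24) ^+ 6.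
    by rewrite -expRM_natl; congr expR; field.
  rewrite -exprMn lerXn2r ?nnegrE//.
  - by rewrite addr_ge0// sqr_ge0.
  rewrite (@le_trans _ _ (24 * (1 + u ^+ 2 / 24)))//.
    by have := sqr_ge0 u; lra.
  by rewrite ler_pM2l// expR_ge1Dx.
rewrite ge0_integralZl//.
- by rewrite lte_mul_pinfty// ?lee_fin ?mulr_ge0//; exact: gauss_exp_moment.
- by mfun.
- by rewrite lee_fin mulr_ge0.
Qed.

(** The positive and negative parts are exchanged by reflection and have finite integrals, so they
    cancel. *)
Lemma gam_mean : \int[G]_u u = 0.
Proof.
have ii : G.-integrable setT (EFin \o (fun u : R => u)).
  apply: (@gam_integrable _ 1) => // u; rewrite mul1r.
  have u1 : 1 <= 1 + u ^+ 2 by have := sqr_ge0 u; lra.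
  rewrite (@le_trans _ _ (1 + u ^+ 2))//; last by rewrite -[leLHS]expr1 ler_weXn2l.
  rewrite -(ger0_norm (sqr_ge0 u)) normrX; have := sqr_ge0 (`|u| - 1); have := normr_ge0 u; nra.
have mp : measurable_fun setT (fun u : R => (Num.max u 0)%:E).
  by apply/measurable_EFinP; exact: measurable_maxr.
have p0 (u : R) : (0 <= (Num.max u 0)%:E)%E by rewrite lee_fin le_max lexx orbT.
have e := integral_gamN mp p0.
rewrite /Rintegral integralE.
rewrite (_ : \int[G]_x _ = \int[G]_x (Num.max x 0)%:E)%E; last first.
  by apply: eq_integral => u _; rewrite funeposE -EFin_max.
rewrite (_ : \int[G]_x (funeneg _) x = \int[G]_x (Num.max (- x) 0)%:E)%E; last first.
  by apply: eq_integral => u _; rewrite funenegE -EFinN -EFin_max.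
rewrite e subee//.
have := integrable_pos_fin_num measurableT ii.
rewrite (_ : \int[G]_x _ = \int[G]_x (Num.max x 0)%:E)%E//.
by apply: eq_integral => u _; rewrite funeposE -EFin_max.
Qed.

Lemma gam_prod (phi psi : R -> R) : G.-integrable setT (EFin \o phi) -> G.-integrable setT (EFin \o psi) ->
  (G \x G)%E.-integrable setT (EFin \o (fun z : R * R => phi z.1 * psi z.2)) /\
  \int[(G \x G)%E]_z (phi z.1 * psi z.2) = \int[G]_u phi u * \int[G]_u psi u.
Proof.
move=> iphi ipsi.
have mphi := measurable_int _ iphi; have mpsi := measurable_int _ ipsi.
have mphi' : measurable_fun setT phi by exact/measurable_EFinP.
have mpsi' : measurable_fun setT psi by exact/measurable_EFinP.
have mm : measurable_fun setT (EFin \o (fun z : R * R => phi z.1 * psi z.2)).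
  by apply/measurable_EFinP; mfun.
have ii : (G \x G)%E.-integrable setT (EFin \o (fun z : R * R => phi z.1 * psi z.2)).
  apply/(@integrable12ltyP _ _ _ _ _ G G _ mm) => /=.
  under eq_integral => x _.
    under eq_integral => y _ do rewrite normrM EFinM.
    rewrite ge0_integralZl//; last by apply/measurable_EFinP; mfun.
    over.
  rewrite /= ge0_integralZr//; last 2 first.
  - by apply/measurable_EFinP; mfun.
  - by apply: integral_ge0 => y _; rewrite lee_fin.
  have /integrableP[_ H1] := iphi; have /integrableP[_ H2] := ipsi.
  by rewrite lte_mul_pinfty ?integral_ge0// ge0_fin_numE// integral_ge0.
split=> //; rewrite /Rintegral -integral12_prod_meas1//=.
rewrite (eq_integral (fun x => (phi x)%:E * (\int[G]_u psi u)%:E)%E); last first.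
  move=> x _; rewrite /fubini_F -(EFin_Rintegral ipsi).
  by under eq_integral do rewrite /= EFinM; rewrite integralZl.
rewrite integralZr// /Rintegral.
by rewrite fineM//; exact: integrable_fin_num.
Qed.

End gauss_moments.

(** * The two-function inequality on the line, up to an error *)

Section deficit.
Context {R : realType}.
Implicit Types (f g : R -> R) (h x y e K M k al be c : R).
Local Notation G := (@nrm R 0 1).

(* The one-dimensional inequality at scale [h], up to an additive error [k]. *)
Definition deficit al be c (c' : R) e K M h k := forall f g, C11 e K M f -> C11 e K M g -> forall x y,
  (\int[G]_u \int[G]_v (f (x + h * u) `^ al * g (y + h * (c * u + c' * v)) `^ be)%:E
   <= (heat h f x `^ al * heat h g y `^ be + k)%:E)%E.

(* A step of size [sqrt 2 * h] is two independent steps of size [h]: condition on the first. *)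
Lemma deficit_double al be c (c' : R) e K M h k : 0 <= e -> 0 <= k ->
  deficit al be c c' e K M h k -> deficit al be c c' e K M (Num.sqrt 2 * h) (2 * k).
Proof.
move=> e0 k0 D f g Cf Cg x y.
have [mf fb _] := Cf; have [mg gb _] := Cg.
have [mPf _ _] := C11_heat h e0 Cf; have [mPg _ _] := C11_heat h e0 Cg.
pose H (z : R * R) := (f (x + z.1) `^ al * g (y + (c * z.1 + c' * z.2)) `^ be)%:E.
have mH : measurable_fun setT H by rewrite /H; mfun.
have H0 z : (0 <= H z)%E by rewrite lee_fin mulr_ge0 ?powR_ge0.
rewrite (_ : (\int[G]_u _ = \int[G]_u \int[G]_v H (Num.sqrt 2 * h * u, Num.sqrt 2 * h * v)%R)%E); last first.
  apply: eq_integral => u _; apply: eq_integral => v _; rewrite /H/=.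
  by congr (_ * g _ `^ _)%:E; ring.
rewrite gauss_double2//.
pose Q (z : R * R) := (heat h f (x + h * z.1) `^ al * heat h g (y + h * (c * z.1 + c' * z.2)) `^ be)%:E.
have mQ : measurable_fun setT Q by rewrite /Q; mfun.
have Q0 z : (0 <= Q z)%E by rewrite lee_fin mulr_ge0 ?powR_ge0.
pose Psi (z : R * R) := (\int[G]_x' \int[G]_y' H (h * z.1 + h * x', h * z.2 + h * y')%R)%E.
have mPsi : measurable_fun setT Psi.
  apply: (@measurable_fun_fubini_tonelli_F _ _ _ _ _ G (fun z : (R * R) * R => \int[G]_y' H (h * z.1.1 + h * z.2, h * z.1.2 + h * y')%R)%E).
    apply: (@measurable_fun_fubini_tonelli_F _ _ _ _ _ G (fun z : ((R * R) * R) * R => H (h * z.1.1.1 + h * z.1.2, h * z.1.1.2 + h * z.2)%R)%E) => //.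
    by mfun.
  by move=> z; exact: integral_ge0.
have Psi0 z : (0 <= Psi z)%E by apply: integral_ge0 => u _; exact: integral_ge0.
have PsiQ z : (Psi z <= Q z + k%:E)%E.
  (* The first use of [D] is at the random base points reached by the first step, which is why
     [deficit] quantifies over all [x] and [y]. *)
  have := D f g Cf Cg (x + h * z.1) (y + h * (c * z.1 + c' * z.2)).
  apply: le_trans; rewrite le_eqVlt; apply/orP; left; apply/eqP.
  apply: eq_integral => u _; apply: eq_integral => v _; rewrite /H/=.
  by congr (f _ `^ _ * g _ `^ _)%:E; ring.
rewrite -[X in (X <= _)%E]/(\int[G]_u \int[G]_v Psi (u, v))%E.
move: Psi mPsi Psi0 PsiQ => Psi mPsi Psi0 PsiQ.
apply: (@le_trans _ _ (\int[G]_u \int[G]_v (Q (u, v) + k%:E))%E).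
  apply: ge0_le_integral => //.
  - by move=> u _; apply: integral_ge0 => v _; exact: (Psi0 (u, v)).
  - exact: (@measurable_fun_fubini_tonelli_F _ _ _ _ _ G _ mPsi Psi0).
  - apply: (@measurable_fun_fubini_tonelli_F _ _ _ _ _ G (fun z => Q z + k%:E)%E).
      exact: emeasurable_funD.
    by move=> z; rewrite adde_ge0// lee_fin.
  - move=> u _; apply: ge0_le_integral => //.
    + exact: measurable_fun_pair2 mPsi.
    + by apply: emeasurable_funD => //; exact: measurable_fun_pair2 mQ.
under eq_integral => u _.
  rewrite prob_integralDc//; last exact: measurable_fun_pair2 mQ.
  over.
rewrite /= prob_integralDc//; last 2 first.
- exact: (@measurable_fun_fubini_tonelli_F _ _ _ _ _ G _ mQ Q0).
- by move=> u; exact: integral_ge0.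
(* The second use of [D] is on the averaged functions, which lie in the same class; the semigroup
   law then recognises scale [Num.sqrt 2 * h]. Each use costs [k], because the law is a
   probability. *)
have := D _ _ (C11_heat h e0 Cf) (C11_heat h e0 Cg) x y.
rewrite (heat_heat _ _ e0 Cf) (heat_heat _ _ e0 Cg) => DD.
apply: (le_trans (leeD2r k%:E DD)); rewrite -EFinD lee_fin; lra.
Qed.

Lemma pow6_ge1 (u : R) : 1 <= 1 + u ^+ 2.
Proof. by have := sqr_ge0 u; lra. Qed.

Lemma pow6_ge (u : R) : 1 + u ^+ 2 <= (1 + u ^+ 2) ^+ 6.
Proof. by rewrite -[leLHS]expr1 ler_weXn2l// pow6_ge1. Qed.

Lemma norm_le1sqr (u : R) : `|u| <= 1 + u ^+ 2.
Proof.
rewrite -(ger0_norm (sqr_ge0 u)) normrX; have := sqr_ge0 (`|u| - 1); have := normr_ge0 u; nra.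
Qed.

Lemma integrable_gam_sqr : G.-integrable setT (EFin \o (fun u : R => u ^+ 2)).
Proof.
apply: (@gam_integrable _ _ 1) => [|u]; first by mfun.
rewrite mul1r ger0_norm ?sqr_ge0// (le_trans _ (pow6_ge u))//; lra.
Qed.

Lemma integrable_gam_id : G.-integrable setT (EFin \o (fun u : R => u)).
Proof.
apply: (@gam_integrable _ _ 1) => [|u]; first by mfun.
by rewrite mul1r (le_trans _ (pow6_ge u))// norm_le1sqr.
Qed.

Lemma integrable_gam_pow6 : G.-integrable setT (EFin \o (fun u : R => (1 + u ^+ 2) ^+ 6)).
Proof.
apply: (@gam_integrable _ _ 1) => [|u]; first by mfun.
by rewrite mul1r ger0_norm// exprn_ge0// (le_trans _ (pow6_ge1 u)).
Qed.

(** The slope is [a = f1 x / heat h f x]. The Gaussian mean kills the linear term, so [heat h f x]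
    differs from [f x] by order [h ^+ 2] only; division by the average costs at most [1 / e]. *)
Lemma heat_expansion e K M h f x (sig := \int[G]_u (u ^+ 2)) : 0 < e -> C11 e K M f ->
  exists2 a, `|a| <= M / e & forall u,
    `|(f (x + h * u) - heat h f x) / heat h f x - h * (a * u)| <= h ^+ 2 * (M / e * (u ^+ 2 + sig)).
Proof.
move=> e0 Cf; have [_ Pb _] := C11_heat h (ltW e0) Cf.
have fK z := C11_norm z (ltW e0) Cf.
case: Cf => mf fb [f1 [mf1 f1M taylor]].
have [P_ge _] := andP (Pb x); have P0 : 0 < heat h f x by exact: lt_le_trans P_ge.
have M0 : 0 <= M by exact: le_trans (f1M 0).
have iPV : (heat h f x)^-1 <= e^-1 by rewrite lef_pV2 ?posrE.
have sig0 : 0 <= sig by apply: Rintegral_ge0 => u _; exact: sqr_ge0.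
exists (f1 x / heat h f x).
  by rewrite normrM normfV (gtr0_norm P0); apply: ler_pM; rewrite ?invr_ge0 ?(ltW P0).
have ifx : G.-integrable setT (EFin \o (fun y => f (x + h * y))).
  by apply: (@bounded_integrable _ _ _ _ _ K) => //; exact: measurable_shift.
have Pf : `|heat h f x - f x| <= h ^+ 2 * (M * sig).
  have iu := integrableRZ (f1 x * h) integrable_gam_id.
  have -> : heat h f x - f x = \int[G]_u (f (x + h * u) - f x - f1 x * h * u).
    rewrite RintegralB//; last by apply: integrableRB => //; exact: integrable_prob_cst.
    rewrite RintegralB//; last exact: integrable_prob_cst.
    rewrite RintegralZl//; last exact: integrable_gam_id.
    by rewrite gam_mean mulr0 subr0 Rintegral_prob_cst.
  have ir : G.-integrable setT (EFin \o (fun u => f (x + h * u) - f x - f1 x * h * u)).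
    by apply: integrableRB => //; apply: integrableRB => //; exact: integrable_prob_cst.
  apply: (le_trans (le_normr_Rintegral _ ir)) => //.
  rewrite mulrCA mulrA -RintegralZl//; last exact: integrable_gam_sqr.
  apply: le_Rintegral => //.
  - exact: integrable_norm.
  - by apply: integrableRZ; exact: integrable_gam_sqr.
  move=> u _; rewrite -mulrA (le_trans (taylor _ _))// exprMn mulrA.
  by rewrite (mulrC M).
move=> u; rewrite (_ : _ - _ = (f (x + h * u) - f x - f1 x * (h * u) - (heat h f x - f x)) / heat h f x); last first.
  by field; rewrite gt_eqF.
rewrite normrM normfV (gtr0_norm P0).
rewrite [leRHS](_ : _ = h ^+ 2 * (M * (u ^+ 2 + sig)) / e); last by field; rewrite gt_eqF.
apply: ler_pM; rewrite ?invr_ge0 ?(ltW P0)//.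
rewrite (le_trans (ler_normB _ _))//.
have := taylor x (h * u); rewrite exprMn; lra.
Qed.

(** After expansion to second order, the first-order terms have mean zero, and
    [c ^+ 2 + c' ^+ 2 = 1] reduces the mean of the second-order terms to [h ^+ 2 * sig] times a
    quadratic form in the slopes [a] and [b], whose discriminant condition is the hypothesis on [c].
    Only the cubic remainder is left. *)
Lemma deficit_one_step al be c (c' : R) e K M : 0 < al < 1 -> 0 < be < 1 ->
  c ^+ 2 + c' ^+ 2 = 1 -> 0 < c' -> c ^+ 2 * (al * be) <= (1 - al) * (1 - be) ->
  0 < e -> 0 <= M -> exists2 C, 0 <= C &
  forall h, 0 <= h <= 1 -> deficit al be c c' e K M h (C * h ^+ 3).
Proof.
move=> al01 be01 cc c'0 hyp e0 M0.
have [/andP[al0 al1] /andP[be0 be1]] := (al01, be01).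
set sig := \int[G]_u (u ^+ 2).
have sig0 : 0 <= sig by apply: Rintegral_ge0 => u _; exact: sqr_ge0.
pose r0 := M / e; have r00 : 0 <= r0 by rewrite divr_ge0// ltW.
(* An increment is its linear part plus a remainder, each at most [r0 * (1 + sig) * V] up to powers
   of [h]; the [2] pays for both, the [1] ensures [1 <= L]. *)
pose L := 1 + 2 * (r0 * (1 + sig)).
have L1 : 1 <= L.
  have : 0 <= r0 * (1 + sig) by rewrite mulr_ge0// addr_ge0.
  by rewrite /L; lra.
have L0 : 0 <= L by exact: le_trans L1.
pose W (u : R) := (1 + u ^+ 2) ^+ 6.
pose om := \int[G]_u W u.
pose KK := K `^ al * K `^ be.
have KK0 : 0 <= KK by rewrite mulr_ge0 ?powR_ge0.
(* [KK] bounds the product of the powers of the averages, [20 * L ^+ 6] comes from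
   [powR_prod_taylor] with [m = L * V], and [om * om] is the integral of [V ^+ 6]. *)
exists (KK * (20 * L ^+ 6 * (om * om))).
  have om0 : 0 <= om.
    by apply: Rintegral_ge0 => u _; rewrite exprn_ge0// addr_ge0// sqr_ge0.
  by rewrite mulr_ge0// mulr_ge0 ?mulr_ge0// exprn_ge0.
move=> h h01 f g Cf Cg x y.
have [h0 h1] := andP h01.
have [mf fb _] := Cf; have [mg gb _] := Cg.
have [_ Pfb _] := C11_heat h (ltW e0) Cf; have [_ Pgb _] := C11_heat h (ltW e0) Cg.
have [a ar ap] := heat_expansion h x e0 Cf.
have [b br bp] := heat_expansion h y e0 Cg.
have EPf := heatE h x (ltW e0) Cf; have EPg := heatE h y (ltW e0) Cg.
move: (heat h f x) (heat h g y) (Pfb x) (Pgb y) ap bp EPf EPg => Pf Pg {Pfb Pgb} /andP[Pfe PfK] /andP[Pge PgK] ap bp EPf EPg.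
have Pf0 : 0 < Pf by exact: lt_le_trans Pfe.
have Pg0 : 0 < Pg by exact: lt_le_trans Pge.
rewrite -/sig -/r0 in ar br ap bp.
have f0 z : 0 < f z by have /andP[/(lt_le_trans e0)] := fb z.
have g0 z : 0 < g z by have /andP[/(lt_le_trans e0)] := gb z.
pose p u := (f (x + h * u) - Pf) / Pf.
pose r w := (g (y + h * w) - Pg) / Pg.
have fE u : f (x + h * u) = Pf * (1 + p u) by rewrite /p; field; rewrite gt_eqF.
have gE u : g (y + h * u) = Pg * (1 + r u) by rewrite /r; field; rewrite gt_eqF.
have p1 u : -1 < p u by rewrite -subr_gt0 opprK addrC -(pmulr_rgt0 _ Pf0) -fE.
have r1 u : -1 < r u by rewrite -subr_gt0 opprK addrC -(pmulr_rgt0 _ Pg0) -gE.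
have bnd (q t w V : R) : `|t| <= r0 -> `|q - h * (t * w)| <= h ^+ 2 * (r0 * (w ^+ 2 + sig)) ->
    1 + w ^+ 2 <= V -> [/\ `|q| <= h * (L * V), `|t * w| <= L * V & `|q - h * (t * w)| <= h ^+ 2 * (L * V)].
  move=> tr qt wV.
  have V1 : 1 <= V by rewrite (le_trans _ wV)// pow6_ge1.
  have tw : `|t * w| <= r0 * V.
    by rewrite normrM; apply: ler_pM => //; rewrite (le_trans (norm_le1sqr w)).
  have k1 : r0 * V <= r0 * (1 + sig) * V.
    by rewrite -mulrA ler_wpM2l// ler_peMl ?lerDl// (le_trans ler01).
  have k2 : r0 * (w ^+ 2 + sig) <= r0 * (1 + sig) * V.
    rewrite -mulrA ler_wpM2l// mulrDl mul1r lerD//; first by lra.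
    by rewrite ler_peMr.
  have V0 : 0 <= V by exact: le_trans V1.
  have k0 : 0 <= r0 * (1 + sig) * V by rewrite mulr_ge0// mulr_ge0// addr_ge0.
  have LV : 2 * (r0 * (1 + sig) * V) <= L * V.
    have -> : L * V = V + 2 * (r0 * (1 + sig) * V) by rewrite /L; ring.
    by rewrite lerDr.
  have tL : `|t * w| <= L * V by lra.
  have h2 : h ^+ 2 <= h by rewrite expr2 ler_piMr.
  have qL : h ^+ 2 * (r0 * (w ^+ 2 + sig)) <= h ^+ 2 * (r0 * (1 + sig) * V).
    by rewrite ler_wpM2l// sqr_ge0.
  split => //.
    have -> : q = (q - h * (t * w)) + h * (t * w) by ring.
    rewrite (le_trans (ler_normD _ _))// (normrM h) (ger0_norm h0).
    have : h ^+ 2 * (r0 * (1 + sig) * V) <= h * (r0 * (1 + sig) * V) by rewrite ler_wpM2r.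
    have : h * `|t * w| <= h * (r0 * (1 + sig) * V) by rewrite ler_wpM2l// (le_trans tw).
    have : h * (2 * (r0 * (1 + sig) * V)) <= h * (L * V) by rewrite ler_wpM2l.
    lra.
  rewrite (le_trans qt)// (le_trans qL)// ler_wpM2l ?sqr_ge0//; lra.
pose s := al * (1 - al) / 2; pose s' := be * (1 - be) / 2.
(* Except for [r], every term is a function of [z.1] times a function of [z.2], with explicit
   factors [1], so that [gam_prod] evaluates it. *)
pose Ub (z : R * R) := (1 + al * p z.1) * 1 + be * r (c * z.1 + c' * z.2) +
   (h ^+ 2 * (al * be * a * b * c - s * a ^+ 2 - s' * b ^+ 2 * c ^+ 2) * (z.1 ^+ 2 * 1) +
    h ^+ 2 * (al * be * a * b * c' - 2 * s' * b ^+ 2 * c * c') * (z.1 * z.2) +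
    h ^+ 2 * (- s' * b ^+ 2 * c' ^+ 2) * (1 * z.2 ^+ 2)) +
   20 * h ^+ 3 * L ^+ 6 * (W z.1 * W z.2).
have FUb (z : R * R) : f (x + h * z.1) `^ al * g (y + h * (c * z.1 + c' * z.2)) `^ be <= Pf `^ al * Pg `^ be * Ub z.
  rewrite fE gE !powRM ?(ltW Pf0) ?(ltW Pg0)//; last 2 first.
    by have := r1 (c * z.1 + c' * z.2); lra.
    by have := p1 z.1; lra.
  rewrite mulrACA ler_wpM2l ?mulr_ge0 ?powR_ge0//.
  set w := c * z.1 + c' * z.2.
  pose V := (1 + z.1 ^+ 2) * (1 + z.2 ^+ 2).
  have V1 : 1 + z.1 ^+ 2 <= V.
    by rewrite ler_peMr ?pow6_ge1// (le_trans ler01)// pow6_ge1.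
  have V2 : 1 + w ^+ 2 <= V.
    have : w ^+ 2 + (c' * z.1 - c * z.2) ^+ 2 = (c ^+ 2 + c' ^+ 2) * (z.1 ^+ 2 + z.2 ^+ 2).
      by rewrite /w; ring.
    rewrite cc mul1r => wE.
    have := sqr_ge0 (c' * z.1 - c * z.2).
    have : 0 <= z.1 ^+ 2 * z.2 ^+ 2 by rewrite mulr_ge0 ?sqr_ge0.
    by rewrite /V; nra.
  have [A1 A2 A3] := bnd _ _ _ _ ar (ap z.1) V1.
  have [B1 B2 B3] := bnd _ _ _ _ br (bp w) V2.
  have LV1 : 1 <= L * V by rewrite -[leLHS]mulr1 ler_pM// (le_trans (pow6_ge1 z.1)).
  have := @powR_prod_taylor R al be (p z.1) (r w) (a * z.1) (b * w) h (L * V) al01 be01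
    (p1 _) (r1 _) h01 LV1 A1 B1 A2 B2 A3 B3.
  move=> /le_trans; apply; rewrite le_eqVlt; apply/orP; left; apply/eqP.
  rewrite /Ub -/w -/s -/s' /W /V /w; ring.
have mr : measurable_fun setT r by rewrite /r; mfun.
have mp : measurable_fun setT p by rewrite /p; mfun.
have hp : has_integral G (fun u => 1 + al * p u) 1.
  have hf : has_integral G (fun u => f (x + h * u)) Pf.
    by apply: ge0_has_integral => [|u|]; [mfun|exact: ltW|].
  have h1' : has_integral G (cst (1 - al)) (1 - al).
    by split; [exact: integrable_prob_cst|rewrite Rintegral_prob_cst].
  apply: eq_has_integral (has_integralD h1' (has_integralZ (al / Pf) hf)).
  - by move=> u; rewrite /p/=; field; rewrite gt_eqF.
  - by field; rewrite gt_eqF.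
have hc : has_integral G (cst 1) 1.
  by split; [exact: integrable_prob_cst|rewrite Rintegral_prob_cst].
have hid : has_integral G (fun u => u) 0.
  by split; [exact: integrable_gam_id|exact: gam_mean].
have hsq : has_integral G (fun u => u ^+ 2) sig.
  by split; first exact: integrable_gam_sqr.
have hW : has_integral G W om.
  by split; first exact: integrable_gam_pow6.
have prodI phi psi v w : has_integral G phi v -> has_integral G psi w ->
    has_integral (G \x G)%E (fun z : R * R => phi z.1 * psi z.2) (v * w).
  by move=> [ip <-] [iq <-]; have [] := gam_prod ip iq.
(* By rotation invariance [c * z.1 + c' * z.2] is standard normal, so the mean of [g] there is [Pg]
   and the relative increment has mean zero. *)
have hr : has_integral (G \x G)%E (fun z : R * R => r (c * z.1 + c' * z.2)) 0.
  have hg : has_integral (G \x G)%E (fun z : R * R => g (y + h * (c * z.1 + c' * z.2))) Pg.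
    apply: ge0_has_integral => [|z|]; [by mfun|exact: ltW|].
    rewrite fubini_tonelli1//; last 2 first.
    - by mfun.
    - by move=> z; rewrite lee_fin ltW.
    rewrite /fubini_F/=.
    rewrite (@gauss_rotation R c c' (fun w => (g (y + h * w))%:E))//.
    - by mfun.
    - by move=> w; rewrite lee_fin ltW.
  apply: eq_has_integral (has_integralD (prodI _ _ _ _ hc (has_integralZ (-1) hc)) (has_integralZ Pg^-1 hg)).
  - by move=> z; rewrite /r/=; field; rewrite gt_eqF.
  - by field; rewrite gt_eqF.
have [iUb vUb] := has_integralD (has_integralD (has_integralD (prodI _ _ _ _ hp hc) (has_integralZ be hr))
  (has_integralD (has_integralD
    (has_integralZ (h ^+ 2 * (al * be * a * b * c - s * a ^+ 2 - s' * b ^+ 2 * c ^+ 2)) (prodI _ _ _ _ hsq hc))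
    (has_integralZ (h ^+ 2 * (al * be * a * b * c' - 2 * s' * b ^+ 2 * c * c')) (prodI _ _ _ _ hid hid)))
    (has_integralZ (h ^+ 2 * (- s' * b ^+ 2 * c' ^+ 2)) (prodI _ _ _ _ hc hsq))))
  (has_integralZ (20 * h ^+ 3 * L ^+ 6) (prodI _ _ _ _ hW hW)).
have C00 : 0 <= Pf `^ al * Pg `^ be by rewrite mulr_ge0 ?powR_ge0.
have mF : measurable_fun setT (fun z : R * R => (f (x + h * z.1) `^ al * g (y + h * (c * z.1 + c' * z.2)) `^ be)%:E).
  by mfun.
have F0 (z : R * R) : (0 <= (f (x + h * z.1) `^ al * g (y + h * (c * z.1 + c' * z.2)) `^ be)%:E)%E.
  by rewrite lee_fin mulr_ge0 ?powR_ge0.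
have := @fubini_tonelli1 _ _ _ _ _ G G _ mF F0; rewrite /fubini_F/= => <-.
apply: (@le_trans _ _ (\int[(G \x G)%E]_z (Pf `^ al * Pg `^ be * Ub z)%:E)%E).
  apply: ge0_le_integral => //.
  - apply/measurable_EFinP; apply: measurable_funM => //.
    by apply/measurable_EFinP; exact: (measurable_int _ iUb).
  - by move=> z _; rewrite lee_fin; exact: FUb.
have [iC vC] := has_integralZ (Pf `^ al * Pg `^ be) (conj iUb erefl : has_integral (G \x G)%E Ub _).
rewrite -[leLHS]fineK; last exact: (integrable_fin_num measurableT iC).
rewrite lee_fin -[leLHS]/(\int[(G \x G)%E]_z (Pf `^ al * Pg `^ be * Ub z)) vC.
rewrite [X in _ * X <= _]vUb !mulr1 !mul1r !mulr0 !addr0.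
(* Multiplying by [4 * s] and completing the square leaves [4 * s * s' - (al * be * c) ^+ 2], which
   is [al * be] times the gap in the hypothesis on [c]. *)
have quadr : al * be * a * b * c - s * a ^+ 2 - s' * b ^+ 2 <= 0.
  have s_gt0 : 0 < s by rewrite /s divr_gt0// mulr_gt0// subr_gt0.
  have s4 : 0 < 4 * s by rewrite mulr_gt0.
  rewrite -(pmulr_lle0 _ s4).
  have -> : (al * be * a * b * c - s * a ^+ 2 - s' * b ^+ 2) * (4 * s) =
     - (2 * s * a - al * be * c * b) ^+ 2 - (4 * s * s' - (al * be * c) ^+ 2) * b ^+ 2 by ring.
  have : 0 <= 4 * s * s' - (al * be * c) ^+ 2.
    rewrite (_ : _ - _ = al * be * ((1 - al) * (1 - be) - c ^+ 2 * (al * be))); last by rewrite /s /s'; field.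
    by rewrite mulr_ge0 ?subr_ge0// mulr_ge0// ltW.
  move=> k0; have := mulr_ge0 k0 (sqr_ge0 b); have := sqr_ge0 (2 * s * a - al * be * c * b); lra.
have CK : Pf `^ al * Pg `^ be <= KK.
  by apply: ler_pM; rewrite ?powR_ge0//; apply: ge0_ler_powR; rewrite ?nnegrE ?(ltW al0) ?(ltW be0) ?(ltW Pf0) ?(ltW Pg0)// (le_trans (ltW Pf0) PfK).
have om2 : 0 <= 20 * h ^+ 3 * L ^+ 6 * (om * om).
  by rewrite !mulr_ge0 ?exprn_ge0 ?(le_trans ler01 L1)//; apply: Rintegral_ge0 => u _; rewrite exprn_ge0// addr_ge0// sqr_ge0.
set Q1 := _ * sig; set Q2 := _ * sig.
have Q12 : Q1 + Q2 <= 0.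
  rewrite /Q1 /Q2 -mulrDl -mulrDr mulr_le0_ge0//.
  rewrite mulr_ge0_le0 ?sqr_ge0//.
  have -> : al * be * a * b * c - s * a ^+ 2 - s' * b ^+ 2 * c ^+ 2 + - s' * b ^+ 2 * c' ^+ 2
    = al * be * a * b * c - s * a ^+ 2 - s' * b ^+ 2 * (c ^+ 2 + c' ^+ 2) by ring.
  by rewrite cc mulr1.
apply: (@le_trans _ _ (Pf `^ al * Pg `^ be * (1 + 20 * h ^+ 3 * L ^+ 6 * (om * om)))).
  by rewrite ler_wpM2l//; lra.
rewrite mulrDr mulr1 lerD2l.
rewrite [leRHS](_ : _ = KK * (20 * h ^+ 3 * L ^+ 6 * (om * om))); last by ring.
by rewrite ler_wpM2r.
Qed.

(* Doubling [n] times from scale [sqrt 2 ^- n] leaves an error of order [2^n (sqrt 2 ^- n)^3]. *)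
Lemma gauss_jensen_C11 al be c (c' : R) e K M f g : 0 < al < 1 -> 0 < be < 1 ->
  c ^+ 2 + c' ^+ 2 = 1 -> 0 < c' -> c ^+ 2 * (al * be) <= (1 - al) * (1 - be) ->
  0 < e -> C11 e K M f -> C11 e K M g ->
  (\int[G]_u \int[G]_v (f u `^ al * g (c * u + c' * v) `^ be)%:E
   <= ((\int[G]_u f u) `^ al * (\int[G]_u g u) `^ be)%:E)%E.
Proof.
move=> al01 be01 cc c'0 hyp e0 Cf Cg.
have M0 : 0 <= M by case: Cf => _ _ [f1 [_ f1M _]]; exact: le_trans (f1M 0).
have [C C0 one] := @deficit_one_step al be c c' e K M al01 be01 cc c'0 hyp e0 M0.
have dbl n : deficit al be c c' e K M 1 (C * (Num.sqrt 2)^-1 ^+ n).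
  have s2 : 0 < Num.sqrt 2 :> R by rewrite sqrtr_gt0.
  have s1 : 0 <= (Num.sqrt 2 : R)^-1 ^+ n <= 1.
    rewrite exprn_ge0 ?(ltW sqrt2V_gt0)//= exprn_ile1 ?(ltW sqrt2V_gt0)//.
    by rewrite invf_le1// -[leLHS]sqrtr1 ler_wsqrtr// ler1n.
  have : forall k : nat, (k <= n)%N -> deficit al be c c' e K M ((Num.sqrt 2) ^+ k * (Num.sqrt 2)^-1 ^+ n) (2 ^+ k * (C * ((Num.sqrt 2)^-1 ^+ n) ^+ 3)).
    elim=> [_|k IH kn]; first by rewrite !mul1r; exact: one.
    rewrite [Num.sqrt 2 ^+ k.+1]exprS [2 ^+ k.+1]exprS -!mulrA.
    apply: deficit_double; rewrite ?(ltW e0)//; last exact/IH/ltnW.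
    by rewrite !mulr_ge0// ?exprn_ge0//; have /andP[] := s1.
  move=> /(_ n (leqnn n)); rewrite -exprMn mulfV ?gt_eqF// expr1n.
  have e2 : 2 ^+ n = (Num.sqrt 2 ^+ n) ^+ 2 :> R by rewrite -exprM mulnC exprM sqr_sqrtr.
  rewrite (_ : 2 ^+ n * _ = C * (Num.sqrt 2)^-1 ^+ n)//.
  by rewrite e2 exprVn; field; rewrite expf_neq0// gt_eqF.
have dd := fun n => dbl n f g Cf Cg 0 0.
have fE : heat 1 f 0 = \int[G]_u f u by apply: eq_Rintegral => u _; rewrite add0r mul1r.
have gE : heat 1 g 0 = \int[G]_u g u by apply: eq_Rintegral => u _; rewrite add0r mul1r.
rewrite fE gE in dd.
rewrite (_ : (\int[G]_u _ = \int[G]_u \int[G]_v (f (0 + 1 * u) `^ al * g (0 + 1 * (c * u + c' * v)) `^ be)%:E)%E); last first.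
  by apply: eq_integral => u _; apply: eq_integral => v _; rewrite !add0r !mul1r.
apply/lee_addgt0Pr => eps eps0.
have z1 : `|(Num.sqrt 2 : R)^-1| < 1.
  rewrite gtr0_norm ?sqrt2V_gt0// invf_lt1 ?sqrtr_gt0//.
  by rewrite -[ltLHS]sqrtr1 ltr_sqrt// ltr1n.
have /cvgrPdist_lt/(_ _ eps0)[N _ /(_ N (leqnn N))] := cvg_geometric C z1.
rewrite sub0r normrN /geometric/= => CN.
apply: (le_trans (dd N)); rewrite -EFinD lee_fin lerD2l.
by apply: le_trans (ltW CN); exact: ler_norm.
Qed.

End deficit.

(** * From regular functions to bounded measurable ones *)

Section density.
Context {R : realType}.
Implicit Types (f g : R -> R) (h x y e K M : R).
Local Notation G := (@nrm R 0 1).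

Lemma maxr_split (u : R) : u = Num.max u 0 - Num.max (- u) 0.
Proof. by rewrite !maxEle; have [u0|u0] := leP u 0; have [v0|v0] := leP (- u) 0; lra. Qed.

Lemma norm_maxr0 (u : R) : `|Num.max u 0| <= `|u|.
Proof. by rewrite maxEle; have [u0|u0] := leP u 0; rewrite ?normr0. Qed.

Lemma expR_sub1_le (v : R) : `|expR v - 1| <= `|v| * expR `|v|.
Proof.
have [v0|v0] := leP 0 v.
  have e1 : 1 <= expR v by rewrite -expR0 ler_expR.
  rewrite !ger0_norm ?subr_ge0//.
  have := expR_ge1Dx (- v); rewrite expRN => H.
  have := ler_wpM2r (expR_ge0 v) H; rewrite mulVf ?gt_eqF ?expR_gt0//; lra.
have e1 : expR v <= 1 by rewrite -expR0 ler_expR ltW.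
rewrite ler0_norm ?subr_le0// ltr0_norm//.
have := expR_ge1Dx v; have : 1 <= expR (- v) by rewrite -expR0 ler_expR; lra.
by nra.
Qed.

Lemma expR_taylor2 (v : R) : `|expR v - 1 - v| <= v ^+ 2 * expR `|v|.
Proof.
have l := expR_ge1Dx v; rewrite ger0_norm; last by lra.
have : expR v - 1 - v <= v * (expR v - 1).
  have := expR_ge1Dx (- v); rewrite expRN => H.
  have := ler_wpM2r (expR_ge0 v) H; rewrite mulVf ?gt_eqF ?expR_gt0//; lra.
move=> /le_trans; apply; apply: (le_trans (ler_norm _)).
rewrite normrM -[leRHS]/(v ^+ 2 * _) -(real_normK (num_real v)) expr2 -mulrA.
by rewrite ler_wpM2l// expR_sub1_le.
Qed.

Lemma gam_integrable_exp (phi : R -> R) (C : R) : measurable_fun setT phi ->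
  (forall u, `|phi u| <= C * expR (u ^+ 2 / 4)) -> G.-integrable setT (EFin \o phi).
Proof.
move=> mphi phiC.
have C0 : 0 <= C by have := le_trans (normr_ge0 _) (phiC 0); rewrite expr0n mul0r expR0 mulr1.
apply/integrableP; split; first exact/measurable_EFinP.
apply: (@le_lt_trans _ _ (\int[G]_u (C%:E * (expR (u ^+ 2 / 4))%:E))%E).
  apply: ge0_le_integral => //.
  - by apply: measurableT_comp => //; exact/measurable_EFinP.
  - by apply: measurable_funeM; mfun.
  by move=> u _; rewrite -EFinM lee_fin phiC.
rewrite ge0_integralZl//.
- by rewrite lte_mul_pinfty//; exact: gauss_exp_moment.
- by mfun.
Qed.

(** A dominating weight for [cameron_martin_taylor]. With [t =]|u| + 1[the remainder needs]4 * expR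
    (2 * t) + 1 <= 5 * expR (2 * t)[, and]2 * t <= 6 + u ^+ 2 / 4[because]([|u| - 4) ^+ 2 >= 0]. *)
Definition cmw (u : R) : R := 5 * expR 6 * expR (u ^+ 2 / 4).

Lemma integrable_cmw : G.-integrable setT (EFin \o cmw).
Proof.
apply: (@gam_integrable_exp _ (5 * expR 6)) => [|u]; first by rewrite /cmw; mfun.
by rewrite ger0_norm// /cmw mulr_ge0 ?mulr_ge0 ?expR_ge0.
Qed.

Lemma cameron_martin_taylor (th u : R) : `|th| <= 1 ->
  `|expR (th * u - th ^+ 2 / 2) - 1 - th * u| <= th ^+ 2 * cmw u.
Proof.
move=> th1; set v : R := th * u - th ^+ 2 / 2; set t : R := `|u| + 1.
have t1 : 1 <= t by rewrite lerDr.
have th2 : th ^+ 2 <= `|th| by rewrite -(real_normK (num_real th)) expr2 ler_piMr.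
have vt : `|v| <= `|th| * t.
  rewrite (le_trans (ler_normB _ _))// normrM (ger0_norm (_ : 0 <= th ^+ 2 / 2)) ?divr_ge0 ?sqr_ge0//.
  rewrite /t mulrDr mulr1; have := normr_ge0 th; lra.
have vt1 : `|v| <= t by rewrite (le_trans vt)// ler_piMl// (le_trans ler01).
rewrite (_ : _ - th * u = (expR v - 1 - v) - th ^+ 2 / 2); last by rewrite /v; ring.
rewrite (le_trans (ler_normB _ _))// (ger0_norm (_ : 0 <= th ^+ 2 / 2)) ?divr_ge0 ?sqr_ge0//.
have v2 : v ^+ 2 <= th ^+ 2 * t ^+ 2.
  rewrite -exprMn -[leLHS]ger0_norm ?sqr_ge0// -[leRHS]ger0_norm ?sqr_ge0// !normrX.
  by rewrite lerXn2r ?nnegrE// normrM (ger0_norm (_ : 0 <= t))// (le_trans ler01).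
have ev : expR `|v| <= expR t by rewrite ler_expR.
have t4 : t ^+ 2 <= 4 * expR t.
  have -> : expR t = expR (t / 2) ^+ 2 by rewrite -expRM_natl; congr expR; field.
  rewrite (_ : 4 = 2 ^+ 2); last by rewrite expr2; ring.
  rewrite -exprMn lerXn2r ?nnegrE//.
  - by rewrite (le_trans ler01).
  have := expR_ge1Dx (t / 2); lra.
have e2 : 4 * expR t * expR t + 1 <= cmw u.
  rewrite (_ : 4 * expR t * expR t = 4 * expR (t + t)); last by rewrite expRD mulrA.
  rewrite (_ : cmw u = 5 * expR (6 + u ^+ 2 / 4)); last by rewrite /cmw -[LHS]mulrA -expRD.
  have : expR (t + t) <= expR (6 + u ^+ 2 / 4).
    rewrite ler_expR /t.
    have : u ^+ 2 = `|u| ^+ 2 by rewrite real_normK ?num_real.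
    move=> ->; have := sqr_ge0 (`|u| - 4); nra.
  have : 1 <= expR (t + t) by rewrite -expR0 ler_expR; lra.
  lra.
apply: (@le_trans _ _ (th ^+ 2 * (4 * expR t * expR t + 1))); last first.
  by rewrite ler_wpM2l ?sqr_ge0.
have := expR_taylor2 v.
have k1 : v ^+ 2 * expR `|v| <= (th ^+ 2 * t ^+ 2) * expR t.
  by apply: ler_pM; rewrite ?sqr_ge0 ?expR_ge0.
have k2 : (th ^+ 2 * t ^+ 2) * expR t <= th ^+ 2 * (4 * expR t * expR t).
  by rewrite -mulrA ler_wpM2l ?sqr_ge0// ler_wpM2r ?expR_ge0.
have := sqr_ge0 th; lra.
Qed.

(** By the Cameron-Martin formula a translation of [x] acts on the Gaussian weight instead of on
    [f], so averaging makes a merely measurable [f] regular. The derivative [f1] is the integral of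
    [f] against the first-order term of the weight. *)
Lemma heat_C11 e K h f : 0 <= e -> measurable_fun setT f -> (forall x, e <= f x <= K) -> 0 < h ->
  exists M, C11 e K M (heat h f).
Proof.
move=> e0 mf fb h0.
have f0 x : 0 <= f x by have /andP[/(le_trans e0)] := fb x.
have fK x : `|f x| <= K by rewrite ger0_norm//; have /andP[] := fb x.
have K0 : 0 <= K by exact: le_trans (fK 0).
have ifx x : G.-integrable setT (EFin \o (fun u => f (x + h * u))).
  by apply: (@bounded_integrable _ _ _ _ _ K) => //; exact: measurable_shift.
have iabs : G.-integrable setT (EFin \o (fun u => `|u|)).
  exact: integrable_norm integrable_gam_id.
pose m1 := \int[G]_u `|u|.
have m10 : 0 <= m1 by exact: Rintegral_ge0.
pose Cw := \int[G]_u cmw u.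
have Cw0 : 0 <= Cw by apply: Rintegral_ge0 => u _; rewrite /cmw !mulr_ge0// expR_ge0.
have iprod x (w : R -> R) : measurable_fun setT w -> G.-integrable setT (EFin \o w) ->
    G.-integrable setT (EFin \o (fun u => f (x + h * u) * w u)).
  move=> mw iw; apply: (@le_integrable _ _ _ _ _ _ _ (EFin \o (fun u => K * w u))) => //.
  - by apply/measurable_EFinP; apply: measurable_funM => //; exact: measurable_shift.
  - by move=> u _ /=; rewrite lee_fin !normrM (ger0_norm K0) ler_wpM2r.
  - exact: integrableRZ.
have bprod x (w : R -> R) : measurable_fun setT w -> G.-integrable setT (EFin \o w) ->
    `|\int[G]_u (f (x + h * u) * w u)| <= K * \int[G]_u `|w u|.
  move=> mw iw; apply: (le_trans (le_normr_Rintegral _ (iprod x w mw iw))) => //.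
  rewrite -RintegralZl//; last exact: integrable_norm.
  apply: le_Rintegral => //.
  - by apply: integrable_norm; exact: iprod.
  - by apply: integrableRZ; exact: integrable_norm.
  by move=> u _; rewrite normrM ler_wpM2r.
pose f1 x := h^-1 * \int[G]_u (f (x + h * u) * u).
(* The first summand bounds the Taylor remainder, with [Cw] for small shifts and [1 + m1] for large
   ones; the second bounds [f1]. *)
pose M := K * (Cw + 1 + m1) / h ^+ 2 + K * m1 / h.
have f1M x : `|f1 x| <= K * m1 / h.
  rewrite /f1 normrM gtr0_norm ?invr_gt0// mulrC ler_wpM2r ?invr_ge0 ?(ltW h0)//.
  by apply: bprod => //; exact: integrable_gam_id.
have M1 : K * m1 / h <= M.
  by rewrite /M lerDr divr_ge0 ?sqr_ge0 ?mulr_ge0 ?addr_ge0.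
have f1m : measurable_fun setT f1.
  apply: measurable_funM => //.
  (* Splitting [u] into its positive and negative parts makes both integrands nonnegative, as
     Tonelli measurability requires. *)
  have -> : (fun x => \int[G]_u (f (x + h * u) * u)) =
     (fun x => fine (\int[G]_u (f (x + h * u) * Num.max u 0)%:E)%E - fine (\int[G]_u (f (x + h * u) * Num.max (- u) 0)%:E)%E).
    apply/funext => x; rewrite -[RHS]RintegralB//.
    + apply: eq_Rintegral => u _; rewrite -mulrBr; congr (_ * _).
      exact: maxr_split.
    + apply: iprod; first exact: measurable_maxr.
      apply: (le_integrable _ _ _ iabs) => //.
        by apply/measurable_EFinP; exact: measurable_maxr.
      move=> u _ /=; rewrite lee_fin normr_id.
      exact: norm_maxr0.
    + apply: iprod; first by apply: measurable_maxr => //; mfun.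
      apply: (le_integrable _ _ _ iabs) => //.
        by apply/measurable_EFinP; apply: measurable_maxr => //; mfun.
      move=> u _ /=; rewrite lee_fin normr_id.
      by rewrite -(normrN u); exact: norm_maxr0.
  apply: measurable_funB; apply: (measurableT_comp (fine_measurable measurableT)).
    apply: (@measurable_fun_fubini_tonelli_F _ _ _ _ _ G (fun z : R * R => (f (z.1 + h * z.2) * Num.max z.2 0)%:E)).
      apply/measurable_EFinP; apply: measurable_funM; first by mfun.
      by apply: measurable_maxr => //; mfun.
    by move=> z; rewrite lee_fin mulr_ge0// le_max lexx orbT.
  apply: (@measurable_fun_fubini_tonelli_F _ _ _ _ _ G (fun z : R * R => (f (z.1 + h * z.2) * Num.max (- z.2) 0)%:E)).
    apply/measurable_EFinP; apply: measurable_funM; first by mfun.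
    by apply: measurable_maxr => //; mfun.
  by move=> z; rewrite lee_fin mulr_ge0// le_max lexx orbT.
exists M; split.
- exact: measurable_heat fK.
- move=> x; apply/andP; split.
    by apply: ge_Rintegral => // y; have /andP[] := fb (x + h * y).
  by apply: Rintegral_le => // y; have /andP[] := fb (x + h * y).
exists f1; split => //.
  by move=> x; exact: le_trans (f1M x) M1.
move=> x y.
pose th := y / h.
have yth : y = h * th by rewrite /th mulrC divfK// gt_eqF.
have f1y : f1 x * y = th * \int[G]_u (f (x + h * u) * u) by rewrite /f1 /th; ring.
have MM : K * (Cw + 1 + m1) * th ^+ 2 <= M * y ^+ 2.
  rewrite (_ : _ * th ^+ 2 = K * (Cw + 1 + m1) / h ^+ 2 * y ^+ 2); last by rewrite /th expr_div_n; ring.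
  by rewrite ler_wpM2r ?sqr_ge0// /M lerDl divr_ge0// ?mulr_ge0// ltW.
have Pb z : 0 <= heat h f z <= K.
  rewrite (_ : 0 <= _)/=; last by apply: Rintegral_ge0.
  by apply: Rintegral_le => // u; have /andP[] := fb (z + h * u).
(* For [|th| > 1] nothing has to cancel: the increment and the linear term are each bounded crudely,
   and [th ^+ 2] dominates both [1] and [|th|]. *)
apply: le_trans MM; have [th1|th1] := leP `|th| 1; last first.
  have th2 : 1 <= th ^+ 2 by rewrite -[leRHS]ger0_norm ?sqr_ge0// normrX exprn_ege1// ltW.
  have thh : `|th| <= th ^+ 2 by rewrite -[leRHS]ger0_norm ?sqr_ge0// normrX expr2 ler_peMr// ltW.
  rewrite (le_trans (ler_normB _ _))//.
  have b1 : `|heat h f (x + y) - heat h f x| <= K.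
    by have := Pb (x + y); have := Pb x; rewrite ler_norml; lra.
  have b2 : `|f1 x * y| <= K * m1 * th ^+ 2.
    rewrite f1y normrM mulrC; apply: ler_pM => //.
    by apply: bprod => //; exact: integrable_gam_id.
  have b3 : K <= K * th ^+ 2 by rewrite ler_peMr.
  have b4 : 0 <= K * Cw * th ^+ 2 by rewrite mulr_ge0 ?sqr_ge0// mulr_ge0.
  rewrite (_ : K * (Cw + 1 + m1) * th ^+ 2 = K * Cw * th ^+ 2 + K * th ^+ 2 + K * m1 * th ^+ 2); last by ring.
  lra.
pose w u := expR (th * u - th ^+ 2 / 2) - 1 - th * u.
have mw : measurable_fun setT w by rewrite /w; mfun.
have iw : G.-integrable setT (EFin \o w).
  apply: (@le_integrable _ _ _ _ _ _ _ (EFin \o cmw)) => //; last exact: integrable_cmw.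
    exact/measurable_EFinP.
  move=> u _ /=; rewrite lee_fin (le_trans (cameron_martin_taylor u th1))//.
  have c0 : 0 <= cmw u by rewrite /cmw !mulr_ge0// expR_ge0.
  rewrite (ger0_norm c0) ler_piMl//.
  by rewrite -[leLHS]ger0_norm ?sqr_ge0// normrX expr2 mulr_ile1.
have ie : G.-integrable setT (EFin \o (fun u => expR (th * u - th ^+ 2 / 2))).
  have := integrableRD iw (integrableRD (integrable_prob_cst G 1) (integrableRZ th integrable_gam_id)).
  by congr (_.-integrable _ _); apply/funext => u; rewrite /w/=; congr EFin; ring.
have shiftE : heat h f (x + y) = \int[G]_u (f (x + h * u) * expR (th * u - th ^+ 2 / 2)).
  have := @gauss_shift R th (fun z => (f (x + h * z))%:E).
  move=> E; rewrite /heat /Rintegral; congr fine.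
  rewrite (_ : \int[G]_x0 _ = \int[G]_u (f (x + h * (u + th)))%:E)%E; last first.
    by apply: eq_integral => u _; congr (f _)%:E; rewrite yth; ring.
  rewrite E//; last 2 first.
  + by apply/measurable_EFinP; exact: measurable_shift.
  + by move=> u; rewrite lee_fin.
rewrite shiftE f1y /heat -RintegralZl//; last first.
  by apply: iprod => //; exact: integrable_gam_id.
rewrite -RintegralB//; last first.
  by apply: iprod => //; mfun.
rewrite -RintegralB//; last 2 first.
- by apply: integrableRB => //; apply: iprod => //; mfun.
- by apply: integrableRZ; apply: iprod => //; exact: integrable_gam_id.
rewrite (_ : Rintegral _ _ _ = \int[G]_u (f (x + h * u) * w u)); last first.
  by apply: eq_Rintegral => u _; rewrite /w; ring.
apply: (le_trans (bprod x w mw iw)).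
rewrite -mulrA ler_wpM2l//.
apply: (@le_trans _ _ (Cw * th ^+ 2)); last first.
  by rewrite ler_wpM2r ?sqr_ge0//; lra.
rewrite mulrC -RintegralZl//; last exact: integrable_cmw.
apply: le_Rintegral => //.
- exact: integrable_norm.
- by apply: integrableRZ; exact: integrable_cmw.
by move=> u _; exact: cameron_martin_taylor.
Qed.

Lemma bounded_prod_integrable (F : R * R -> R) K : measurable_fun setT F -> (forall z, `|F z| <= K) ->
  (G \x G)%E.-integrable setT (EFin \o F).
Proof.
move=> mF FK.
have ic : G.-integrable setT (EFin \o cst (1 : R)) by exact: integrable_prob_cst.
have i1 := (has_integralZ K (conj (gam_prod ic ic).1 erefl : has_integral (G \x G)%E _ _)).1.
apply: (le_integrable _ _ _ i1) => //; first exact/measurable_EFinP.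
by move=> z _ /=; rewrite lee_fin !mulr1 (le_trans (FK z))// ler_norm.
Qed.

(** Dominated convergence on the product space along [h = 1 / (n + 1)]; the norm of [f - heat h f]
    is at most the averaged increment. *)
Lemma heat_approx K f : continuous f -> (forall x, `|f x| <= K) ->
  forall eps : R, 0 < eps -> exists2 h, 0 < h & (\int[G]_x (`|f x - heat h f x|)%:E <= eps%:E)%E.
Proof.
move=> cf fK eps eps0.
have mf : measurable_fun setT f by exact: continuous_measurable_fun.
pose F n (z : R * R) := `|f z.1 - f (z.1 + n.+1%:R^-1 * z.2)|.
have mF n : measurable_fun setT (F n) by rewrite /F; mfun.
have F0 n z : 0 <= F n z by rewrite /F.
have FK n z : `|F n z| <= K + K.
  by rewrite normr_id (le_trans (ler_normB _ _))// lerD.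
have : (\int[(G \x G)%E]_z (F n z)%:E)%E @[n --> \oo] --> (\int[(G \x G)%E]_z (cst 0%E z))%E.
  apply: (@dominated_cvg _ _ _ (G \x G)%E setT measurableT (fun n z => (F n z)%:E) (cst 0%E) (cst (K + K)%:E)) => //.
  - by move=> n; exact/measurable_EFinP.
  - move=> z _; apply: cvg_EFin; first by apply: nearW.
    rewrite /F/=; rewrite -[X in _ --> X](normr0 R) -[X in `|X|](subrr (f z.1)).
    apply: cvg_norm; apply: cvgB; first exact: cvg_cst.
    have Hz : (z.1 + n.+1%:R^-1 * z.2 : R) @[n --> \oo] --> (z.1 : R).
      rewrite -[X in _ --> X]addr0 -[X in _ + X](mul0r z.2).
      apply: cvgD; first exact: cvg_cst.
      apply: cvgM; last exact: cvg_cst.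
      exact: cvg_harmonic.
    exact: (@cvg_comp _ _ _ (fun n : nat => z.1 + n.+1%:R^-1 * z.2 : R) f _ _ _ Hz (cf z.1)).
  - exact: (@bounded_prod_integrable (cst (K + K)) `|K + K|).
  - by move=> n z _; rewrite lee_fin; exact: FK.
rewrite integral0 => /fine_cvgP[_ /cvgrPdist_lt/(_ _ eps0)[N _ /(_ N (leqnn N))]].
rewrite /= sub0r normrN => H.
exists N.+1%:R^-1; first by rewrite invr_gt0.
have iF := bounded_prod_integrable (mF N) (FK N).
apply: (@le_trans _ _ (\int[(G \x G)%E]_z (F N z)%:E)%E); last first.
  rewrite -[leLHS]fineK; last exact: (integrable_fin_num measurableT iF).
  by rewrite lee_fin (le_trans (ler_norm _))// ltW.
have mEF : measurable_fun setT (fun z => (F N z)%:E) by exact/measurable_EFinP.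
rewrite (@fubini_tonelli1 _ _ _ _ _ G G _ mEF); last by move=> z; rewrite lee_fin F0.
have mH := measurable_heat N.+1%:R^-1 mf fK.
apply: ge0_le_integral => //.
- by apply/measurable_EFinP; mfun.
- apply: (@measurable_fun_fubini_tonelli_F _ _ _ _ _ G (fun z => (F N z)%:E)); last by move=> z; rewrite lee_fin F0.
  exact: mEF.
move=> x _; rewrite /fubini_F.
have ix : G.-integrable setT (EFin \o (fun u => f (x + N.+1%:R^-1 * u))).
  by apply: (@bounded_integrable _ _ _ _ _ K) => //; exact: measurable_shift.
have ii : G.-integrable setT (EFin \o (fun u => f x - f (x + N.+1%:R^-1 * u))).
  by apply: integrableRB => //; exact: integrable_prob_cst.
rewrite (_ : f x - _ = \int[G]_u (f x - f (x + N.+1%:R^-1 * u))); last first.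
  by rewrite RintegralB//; [rewrite Rintegral_prob_cst|exact: integrable_prob_cst].
rewrite /F/= (EFin_Rintegral (integrable_norm ii)) lee_fin.
exact: le_normr_Rintegral.
Qed.

(** L1 approximation by continuous functions is taken on an interval for Lebesgue measure and
    transferred through the bound [Cp] on the Gaussian density; outside the interval both functions
    lie in the range from [e] to [K] and the mass is small. *)
Lemma continuous_approx e K f : measurable_fun setT f -> (forall x, e <= f x <= K) ->
  forall eps : R, 0 < eps -> exists g, [/\ continuous g, (forall x, e <= g x <= K) &
    (\int[G]_x (`|f x - g x|)%:E <= eps%:E)%E].
Proof.
move=> mf fb eps eps0.
have eK : e <= K by have /andP[] := fb 0 => /le_trans; apply.
pose sig := \int[G]_u (u ^+ 2).
have sig0 : 0 <= sig by apply: Rintegral_ge0 => u _; exact: sqr_ge0.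
(* Markov's inequality bounds the mass outside [-N, N] by sig / N^2 *)
have [N N0 HN] : exists2 N : R, 0 < N & (K - e) * sig / N ^+ 2 <= eps / 2.
  exists (1 + 2 * ((K - e) * sig) / eps); first by rewrite ltr_wpDr ?divr_ge0 ?mulr_ge0 ?subr_ge0// ltW.
  set t := 2 * ((K - e) * sig) / eps.
  have t0 : 0 <= t by rewrite divr_ge0 ?mulr_ge0 ?subr_ge0// ltW.
  rewrite (_ : (K - e) * sig = t * eps / 2); last by rewrite /t; field; rewrite gt_eqF.
  rewrite ler_pdivrMr ?exprn_gt0 ?ltr_wpDr//.
  rewrite (_ : t * eps / 2 = eps / 2 * t); last by ring.
  by rewrite ler_pM2l ?divr_gt0//; nra.
pose E : set R := `[- N, N]%classic.
pose Cp : R := normal_peak 1.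
have Cp0 : 0 < Cp by rewrite normal_peak_gt0// oner_eq0.
have lE : (@lebesgue_measure R E < +oo)%E.
  by rewrite /E lebesgue_measure_itv/=; case: ifP => _; rewrite ltry.
have iE : (@lebesgue_measure R).-integrable E (EFin \o f).
  apply: measurable_bounded_integrable.
  - exact: measurable_itv.
  - exact: lE.
  - by move=> mE B mB; have := mf measurableT B mB; rewrite setTI => mfB; exact: measurableI.
  exists (`|e| + `|K|); split; [exact: num_real|] => M KM x _; apply: le_trans (ltW KM).
  have /andP[ef fK] := fb x; rewrite ler_norml.
  have := ler_norm K; have := ler_norm (- e); rewrite normrN; have := normr_ge0 K; have := normr_ge0 e; lra.
have [g_ [cg ig cvg]] := approximation_continuous_integrable (measurable_itv _) lE iE.
have eps2 : 0 < eps / 2 / Cp by rewrite !divr_gt0.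
have /fine_cvgP[fin /cvgrPdist_lt/(_ _ eps2)] := cvg.
move=> near2; have [n _ /(_ n (leqnn n))[fn]] := filterI fin near2.
rewrite /= sub0r normrN => Hn.
(* Clamping to the range of [f] keeps continuity and does not increase the distance to [f]. *)
pose g x := Num.max e (Num.min K (g_ n x)).
have gb x : e <= g x <= K by rewrite le_max lexx/= ge_max eK ge_min lexx.
have cgn : continuous g.
  have -> : g = fun x => (e + (K + g_ n x - `|K - g_ n x|) / 2 + `|e - (K + g_ n x - `|K - g_ n x|) / 2|) / 2.
    by apply/funext => x; rewrite /g maxr_absE minr_absE.
  have c1 : continuous (fun x => (K + g_ n x - `|K - g_ n x|) / 2).
    move=> x; apply: cvgM; last exact: cvg_cst.
    apply: cvgB; first by apply: cvgD; [exact: cvg_cst|exact: cg].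
    by apply: cvg_norm; apply: cvgB; [exact: cvg_cst|exact: cg].
  move=> x; apply: cvgM; last exact: cvg_cst.
  apply: cvgD; first by apply: cvgD; [exact: cvg_cst|exact: c1].
  by apply: cvg_norm; apply: cvgB; [exact: cvg_cst|exact: c1].
have mg : measurable_fun setT g by exact: continuous_measurable_fun.
have mgn : measurable_fun setT (g_ n) by exact: continuous_measurable_fun.
exists g; split => //.
have fg x : `|f x - g x| <= `|f x - g_ n x|.
  have /andP[ef fK] := fb x; rewrite /g maxEle minEle.
  have [k|k] := leP K (g_ n x).
    rewrite eK !ler0_norm; lra.
  have [l|l] := leP e (g_ n x) => //.
  rewrite !ger0_norm; lra.
have fgK x : `|f x - g x| <= K - e.
  by have /andP[? ?] := fb x; have /andP[? ?] := gb x; rewrite ler_norml; lra.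
rewrite integral_normal; last 2 first.
- by apply/measurable_EFinP; mfun.
- by move=> x; rewrite lee_fin.
have mpdf : measurable_fun setT (fun x : R => (normal_pdf 0 1 x)%:E).
  by apply/measurable_EFinP; exact: measurable_normal_pdf.
have pdf0 (x : R) : 0 <= normal_pdf 0 1 x by exact: normal_pdf_ge0.
have Em : measurable E by exact: measurable_itv.
apply: (@le_trans _ _ (\int[leb]_x (((fun x => (Cp * `|f x - g_ n x|)%:E) \_ E) x + (((K - e) / N ^+ 2) * x ^+ 2 * normal_pdf 0 1 x)%:E))%E).
  apply: ge0_le_integral => //.
  - by move=> x _; rewrite -EFinM lee_fin mulr_ge0.
  - by apply: emeasurable_funM => //; apply/measurable_EFinP; mfun.
  - apply: emeasurable_funD.
      apply/(measurable_restrictT _ Em); apply: measurable_funTS.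
      by apply/measurable_EFinP; mfun.
    by apply/measurable_EFinP; apply: measurable_funM; [mfun|exact/measurable_EFinP].
  move=> x _; rewrite patchE; case: ifPn => [_|xE].
    rewrite -EFinM -EFinD lee_fin ler_wpDr//.
      by rewrite mulr_ge0// mulr_ge0 ?sqr_ge0// divr_ge0 ?subr_ge0// sqr_ge0.
    by rewrite mulrC; apply: ler_pM => //; apply: normal_pdf_ub; rewrite oner_eq0.
  rewrite add0e -EFinM lee_fin ler_wpM2r//.
  rewrite (le_trans (fgK x))// mulrAC -mulrA ler_peMr ?subr_ge0//.
  rewrite ler_pdivlMr ?exprn_gt0// mul1r -(real_normK (num_real x)) lerXn2r ?nnegrE ?(ltW N0)//.
  apply: ltW; rewrite ltNge; apply/negP => xN; move/negP: xE; apply.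
  by rewrite inE /E/= in_itv/= -ler_norml.
rewrite ge0_integralD//; last 4 first.
- by move=> x _; rewrite patchE; case: ifPn => // _; rewrite lee_fin mulr_ge0// ltW.
- apply/(measurable_restrictT _ Em); apply: measurable_funTS.
  by apply/measurable_EFinP; mfun.
- by move=> x _; rewrite lee_fin mulr_ge0// mulr_ge0 ?sqr_ge0// divr_ge0 ?subr_ge0// sqr_ge0.
- by apply/measurable_EFinP; apply: measurable_funM; [mfun|exact/measurable_EFinP].
have -> : eps = eps / 2 + eps / 2 by field.
rewrite EFinD; apply: leeD.
  rewrite -integral_lebE; last 2 first.
  - apply/(measurable_restrictT _ Em); apply: measurable_funTS.
    by apply/measurable_EFinP; mfun.
  - by move=> x; rewrite patchE; case: ifPn => // _; rewrite lee_fin mulr_ge0// ltW.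
  rewrite -integral_mkcond.
  under eq_integral do rewrite EFinM.
  rewrite ge0_integralZl//; last 2 first.
  - by move=> mE B mB; have := (_ : measurable_fun setT (fun x => (`|f x - g_ n x|)%:E)) measurableT B mB; rewrite setTI => H; apply: measurableI => //; apply: H; apply/measurable_EFinP; mfun.
  - by rewrite lee_fin ltW.
  rewrite -[X in (_ * X)%E]fineK// -EFinM lee_fin mulrC -ler_pdivlMr//.
  by rewrite (le_trans (ler_norm _))// ltW.
rewrite (_ : \int[leb]_x _ = \int[G]_x ((K - e) / N ^+ 2 * x ^+ 2)%:E)%E; last first.
  rewrite integral_normal//; last 2 first.
  - by apply/measurable_EFinP; mfun.
  - by move=> x; rewrite lee_fin mulr_ge0 ?sqr_ge0// divr_ge0 ?subr_ge0// sqr_ge0.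
rewrite EFin_Rintegral; last by apply: integrableRZ; exact: integrable_gam_sqr.
rewrite RintegralZl//; last exact: integrable_gam_sqr.
by rewrite lee_fin mulrAC.
Qed.

Lemma C11W e K M M' f : M <= M' -> C11 e K M f -> C11 e K M' f.
Proof.
move=> MM [mf fb [f1 [mf1 f1M ft]]]; split=> //; exists f1; split => // [x|x y].
  exact: le_trans (f1M x) MM.
by rewrite (le_trans (ft x y))// ler_wpM2r ?sqr_ge0.
Qed.

Lemma C11_approx e K f : 0 <= e -> measurable_fun setT f -> (forall x, e <= f x <= K) ->
  forall eps : R, 0 < eps -> exists g M, C11 e K M g /\ (\int[G]_x (`|f x - g x|)%:E <= eps%:E)%E.
Proof.
move=> e0 mf fb eps eps0.
have eps2 : 0 < eps / 2 by rewrite divr_gt0.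
have [g [cg gb fg]] := continuous_approx mf fb eps2.
have gK x : `|g x| <= K.
  by have /andP[/(le_trans e0) g0 gK] := gb x; rewrite ger0_norm.
have mg : measurable_fun setT g by exact: continuous_measurable_fun.
have [h h0 hg] := heat_approx cg gK eps2.
have [M CM] := heat_C11 e0 mg gb h0.
have [mH _ _] := CM.
exists (heat h g), M; split => //.
apply: (@le_trans _ _ (\int[G]_x ((`|f x - g x|)%:E + (`|g x - heat h g x|)%:E))%E).
  apply: ge0_le_integral => //.
  - by mfun.
  - by apply: emeasurable_funD; mfun.
  by move=> x _; rewrite -EFinD lee_fin -[X in `|X|](_ : (f x - g x) + (g x - heat h g x) = _) ?ler_normD//; ring.
rewrite ge0_integralD//; [|by mfun|by mfun].
have -> : eps = eps / 2 + eps / 2 by field.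
by rewrite EFinD; exact: leeD.
Qed.

Lemma jensen_error_arith (x y a b p q eps : R) : x <= y + a + b ->
  2 * p + 2 * q <= eps -> b <= q -> a <= p -> x + p + q <= y + eps.
Proof. lra. Qed.

(** On values between [e] and [K] powers are Lipschitz, so both sides depend continuously on [f] and
    [g] in L1, where regular functions are dense. *)
Lemma gauss_jensen_pos al be c (c' : R) e K f g : 0 < al < 1 -> 0 < be < 1 ->
  c ^+ 2 + c' ^+ 2 = 1 -> 0 < c' -> c ^+ 2 * (al * be) <= (1 - al) * (1 - be) ->
  0 < e -> measurable_fun setT f -> (forall x, e <= f x <= K) ->
  measurable_fun setT g -> (forall x, e <= g x <= K) ->
  (\int[G]_u \int[G]_v (f u `^ al * g (c * u + c' * v) `^ be)%:E
   <= ((\int[G]_u f u) `^ al * (\int[G]_u g u) `^ be)%:E)%E.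
Proof.
move=> al01 be01 cc c'0 hyp e0 mf fb mg gb.
have [/andP[al0 al1] /andP[be0 be1]] := (al01, be01).
have eK : e <= K by have /andP[] := fb 0 => /le_trans; apply.
have K0 : 0 < K by exact: lt_le_trans eK.
pose La := K `^ al / e; pose Lb := K `^ be / e.
have La0 : 0 <= La by rewrite divr_ge0 ?powR_ge0// ltW.
have Lb0 : 0 <= Lb by rewrite divr_ge0 ?powR_ge0// ltW.
pose A := La * K `^ be; pose B := K `^ al * Lb.
have A0 : 0 <= A by rewrite mulr_ge0// powR_ge0.
have B0 : 0 <= B by rewrite mulr_ge0// powR_ge0.
have lip (u u' v v' : R) : e <= u <= K -> e <= u' <= K -> e <= v <= K -> e <= v' <= K ->
    u `^ al * v `^ be <= u' `^ al * v' `^ be + A * `|u - u'| + B * `|v - v'|.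
  move=> ub ub' vb vb'.
  have l1 := powR_lip al01 e0 ub ub'; have l2 := powR_lip be01 e0 vb vb'.
  have vK : v `^ be <= K `^ be.
    by case/andP: vb => ev vK; apply: ge0_ler_powR; rewrite ?nnegrE ?(ltW be0) ?(ltW K0)// (le_trans (ltW e0)).
  have uK : u' `^ al <= K `^ al.
    by case/andP: ub' => ev vK'; apply: ge0_ler_powR; rewrite ?nnegrE ?(ltW al0) ?(ltW K0)// (le_trans (ltW e0)).
  have -> : u `^ al * v `^ be = u' `^ al * v' `^ be + (u `^ al - u' `^ al) * v `^ be + u' `^ al * (v `^ be - v' `^ be) by ring.
  rewrite -!addrA lerD2l; apply: lerD.
    rewrite /A mulrAC; apply: (@le_trans _ _ (`|u `^ al - u' `^ al| * v `^ be)).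
      by rewrite ler_wpM2r ?powR_ge0// ler_norm.
    by apply: ler_pM => //; rewrite powR_ge0.
  rewrite /B -mulrA; apply: (@le_trans _ _ (u' `^ al * `|v `^ be - v' `^ be|)).
    by rewrite ler_wpM2l ?powR_ge0// ler_norm.
  by apply: ler_pM => //; rewrite powR_ge0.
apply/lee_addgt0Pr => eps eps0.
(* Each approximation error enters once on either side, so the total cost is [2 * (A + B) * del]. *)
pose del := eps / (2 * (A + B + 1)).
have AB1 : 0 < A + B + 1 by rewrite ltr_wpDl// addr_ge0.
have del0 : 0 < del by rewrite divr_gt0// mulr_gt0.
have [f' [M1 [Cf' ff']]] := C11_approx (ltW e0) mf fb del0.
have [g' [M2 [Cg' gg']]] := C11_approx (ltW e0) mg gb del0.
have Cf : C11 e K (Num.max M1 M2) f' by apply: C11W Cf'; rewrite le_max lexx.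
have Cg : C11 e K (Num.max M1 M2) g' by apply: C11W Cg'; rewrite le_max lexx orbT.
have [mf' fb' _] := Cf; have [mg' gb' _] := Cg.
have J := gauss_jensen_C11 al01 be01 cc c'0 hyp e0 Cf Cg.
have nonneg (z : R) : e <= z <= K -> `|z| <= K.
  by move=> /andP[ez zK]; rewrite ger0_norm// (le_trans (ltW e0)).
have ib (k : R -> R) : measurable_fun setT k -> (forall x, e <= k x <= K) -> G.-integrable setT (EFin \o k).
  by move=> mk kb; apply: (@bounded_integrable _ _ _ _ _ K) => // x; exact: nonneg.
have eb (k : R -> R) : measurable_fun setT k -> (forall x, e <= k x <= K) -> e <= \int[G]_x k x <= K.
  move=> mk kb; apply/andP; split.
    by apply: ge_Rintegral; [exact: ib|move=> x; have /andP[] := kb x].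
  by apply: Rintegral_le; [exact: ib|move=> x; have /andP[] := kb x].
have diff (k k' : R -> R) : measurable_fun setT k -> (forall x, e <= k x <= K) ->
   measurable_fun setT k' -> (forall x, e <= k' x <= K) ->
   (\int[G]_x (`|k x - k' x|)%:E <= del%:E)%E -> `|\int[G]_x k' x - \int[G]_x k x| <= del.
  move=> mk kb mk' kb' kk.
  have ik := ib _ mk kb; have ik' := ib _ mk' kb'.
  rewrite distrC -RintegralB//.
  apply: (le_trans (le_normr_Rintegral _ (integrableRB ik ik'))) => //.
  by move: kk; rewrite (EFin_Rintegral (integrable_norm (integrableRB ik ik'))) lee_fin.
have I2 := lip _ _ _ _ (eb _ mf' fb') (eb _ mf fb) (eb _ mg' gb') (eb _ mg gb).
have D1 := diff _ _ mf fb mf' fb' ff'.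
have D2 := diff _ _ mg gb mg' gb' gg'.
pose F (z : R * R) := (f' z.1 `^ al * g' (c * z.1 + c' * z.2) `^ be)%:E.
pose D (z : R * R) := (A%:E * (`|f z.1 - f' z.1|)%:E)%E.
pose H (z : R * R) := (B%:E * (`|g (c * z.1 + c' * z.2) - g' (c * z.1 + c' * z.2)|)%:E)%E.
have mF : measurable_fun setT F by rewrite /F; mfun.
have mD : measurable_fun setT D by rewrite /D; apply: measurable_funeM; mfun.
have mH : measurable_fun setT H by rewrite /H; apply: measurable_funeM; mfun.
have F0 z : (0 <= F z)%E by rewrite lee_fin mulr_ge0 ?powR_ge0.
have D0 z : (0 <= D z)%E by rewrite mule_ge0// lee_fin.
have H0 z : (0 <= H z)%E by rewrite mule_ge0// lee_fin.
apply: (@le_trans _ _ (\int[(G \x G)%E]_z (F z + D z + H z))%E).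
  have := @fubini_tonelli1 _ _ _ _ _ G G (fun z : R * R => (f z.1 `^ al * g (c * z.1 + c' * z.2) `^ be)%:E).
  rewrite /fubini_F/= => <-; last 2 first.
  - by mfun.
  - by move=> z; rewrite lee_fin mulr_ge0 ?powR_ge0.
  apply: ge0_le_integral => //.
  - by move=> z _; rewrite lee_fin mulr_ge0 ?powR_ge0.
  - by mfun.
  - by apply: emeasurable_funD => //; exact: emeasurable_funD.
  by move=> z _; rewrite /F /D /H -!EFinM -!EFinD lee_fin; exact: lip.
rewrite ge0_integralD//; [|by move=> z _; rewrite adde_ge0|exact: emeasurable_funD].
rewrite ge0_integralD// !fubini_tonelli1//.
have DD : (\int[G]_x fubini_F G D x <= (A * del)%:E)%E.
  rewrite /fubini_F /D/=.
  under eq_integral do rewrite integral_cst//= probability_setT mule1 EFinM.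
  rewrite ge0_integralZl//; last by mfun.
  by rewrite [leRHS]EFinM; apply: lee_wpmul2l; rewrite ?lee_fin.
have HH : (\int[G]_x fubini_F G H x <= (B * del)%:E)%E.
  rewrite /fubini_F /H/=.
  (* The argument of [g] is again standard normal, so its error has the same L1 size as at a single
     variable. *)
  rewrite (@gauss_rotation R c c' (fun w => B%:E * (`|g w - g' w|)%:E)%E)//; last 2 first.
  - by apply: measurable_funeM; mfun.
  - by move=> w; rewrite mule_ge0// lee_fin.
  rewrite ge0_integralZl//; last by mfun.
  by rewrite [leRHS]EFinM; apply: lee_wpmul2l; rewrite ?lee_fin.
apply: (le_trans (leeD (leeD J DD) HH)).
rewrite -!EFinD lee_fin.
have : A * `|\int[G]_x f' x - \int[G]_x f x| <= A * del by rewrite ler_wpM2l.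
have : B * `|\int[G]_x g' x - \int[G]_x g x| <= B * del by rewrite ler_wpM2l.
have : 2 * (A * del) + 2 * (B * del) <= eps.
  have -> : eps = 2 * (A + B + 1) * del by rewrite /del; field; rewrite gt_eqF.
  rewrite (_ : 2 * (A + B + 1) * del = 2 * (A * del) + 2 * (B * del) + 2 * del); last by ring.
  by rewrite lerDl mulr_ge0// ltW.
by move=> *; apply: (jensen_error_arith I2).
Qed.

(** A ratio [z / (x + y)] in the unit interval is at most its own power [a]; the two ratios add up
    to one. *)
Lemma powR_subadd (a x y : R) : 0 < a < 1 -> 0 <= x -> 0 <= y -> (x + y) `^ a <= x `^ a + y `^ a.
Proof.
move=> /andP[a0 a1]; rewrite le_eqVlt => /predU1P[<- y0|x0].
  by rewrite add0r powR0 ?gt_eqF// add0r.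
rewrite le_eqVlt => /predU1P[<-|y0].
  by rewrite addr0 powR0 ?gt_eqF// addr0.
have s0 : 0 < x + y by rewrite addr_gt0.
have k (z : R) : 0 < z -> z <= x + y -> z / (x + y) * (x + y) `^ a <= z `^ a.
  move=> z0 zs.
  have -> : z `^ a = (z / (x + y)) `^ a * (x + y) `^ a.
    by rewrite -powRM ?divr_ge0 ?(ltW z0) ?(ltW s0)// divfK// gt_eqF.
  rewrite ler_wpM2r ?powR_ge0// ger1_powR ?(ltW a1)// divr_gt0//=.
  by rewrite ler_pdivrMr// mul1r.
have := k x x0; have := k y y0.
rewrite lerDl lerDr (ltW x0) (ltW y0) => /(_ isT) ky /(_ isT) kx.
apply: le_trans (lerD kx ky).
by rewrite -mulrDl -mulrDl divff ?gt_eqF// mul1r.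
Qed.

(** Adding [e] to both functions only increases the left side, while subadditivity of powers bounds
    the growth of the right side; then [e] tends to [0]. *)
Lemma gauss_jensen al be c (c' : R) K f g : 0 < al < 1 -> 0 < be < 1 ->
  c ^+ 2 + c' ^+ 2 = 1 -> 0 < c' -> c ^+ 2 * (al * be) <= (1 - al) * (1 - be) ->
  measurable_fun setT f -> (forall x, 0 <= f x <= K) ->
  measurable_fun setT g -> (forall x, 0 <= g x <= K) ->
  (\int[G]_u \int[G]_v (f u `^ al * g (c * u + c' * v) `^ be)%:E
   <= ((\int[G]_u f u) `^ al * (\int[G]_u g u) `^ be)%:E)%E.
Proof.
move=> al01 be01 cc c'0 hyp mf fb mg gb.
have [/andP[al0 al1] /andP[be0 be1]] := (al01, be01).
have ib (k : R -> R) : measurable_fun setT k -> (forall x, 0 <= k x <= K) -> G.-integrable setT (EFin \o k).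
  by move=> mk kb; apply: (@bounded_integrable _ _ _ _ _ K) => // x; have /andP[? ?] := kb x; rewrite ger0_norm.
set a := \int[G]_u f u; set b := \int[G]_u g u.
have a0 : 0 <= a by apply: Rintegral_ge0 => x _; have /andP[] := fb x.
have b0 : 0 <= b by apply: Rintegral_ge0 => x _; have /andP[] := gb x.
have step e : 0 < e -> (\int[G]_u \int[G]_v (f u `^ al * g (c * u + c' * v) `^ be)%:E
   <= ((a `^ al + e `^ al) * (b `^ be + e `^ be))%:E)%E.
  move=> e0.
  have fe x : e <= f x + e <= K + e by have /andP[? ?] := fb x; lra.
  have ge x : e <= g x + e <= K + e by have /andP[? ?] := gb x; lra.
  have mfe : measurable_fun setT (fun x => f x + e) by mfun.
  have mge : measurable_fun setT (fun x => g x + e) by mfun.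
  have := gauss_jensen_pos al01 be01 cc c'0 hyp e0 mfe fe mge ge.
  rewrite !RintegralD//; try exact: integrable_prob_cst; try exact: ib.
  rewrite !Rintegral_prob_cst -/a -/b => J.
  apply: (@le_trans _ _ (((a + e) `^ al * (b + e) `^ be)%:E)); last first.
    by rewrite lee_fin; apply: ler_pM; rewrite ?powR_ge0//; apply: powR_subadd => //; exact: ltW.
  apply: le_trans J.
  have := @fubini_tonelli1 _ _ _ _ _ G G (fun z : R * R => (f z.1 `^ al * g (c * z.1 + c' * z.2) `^ be)%:E).
  rewrite /fubini_F/= => <-; last 2 first.
  - by mfun.
  - by move=> z; rewrite lee_fin mulr_ge0 ?powR_ge0.
  have := @fubini_tonelli1 _ _ _ _ _ G G (fun z : R * R => ((f z.1 + e) `^ al * (g (c * z.1 + c' * z.2) + e) `^ be)%:E).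
  rewrite /fubini_F/= => <-; last 2 first.
  - by mfun.
  - by move=> z; rewrite lee_fin mulr_ge0 ?powR_ge0.
  apply: ge0_le_integral => //.
  - by move=> z _; rewrite lee_fin mulr_ge0 ?powR_ge0.
  - by mfun.
  - by mfun.
  move=> z _; rewrite lee_fin; have /andP[f0 _] := fb z.1; have /andP[g0 _] := gb (c * z.1 + c' * z.2).
  by apply: ler_pM; rewrite ?powR_ge0//; apply: ge0_ler_powR; rewrite ?nnegrE ?(ltW al0) ?(ltW be0) ?addr_ge0 ?lerDl ?(ltW e0).
apply/lee_addgt0Pr => eps eps0.
(* Expanding the perturbed product costs at most [t] times [a]^ al + b [^ be + 1] once both powers
   of [e] are at most [t] and [t <= 1]. *)
pose t := Num.min 1 (eps / (a `^ al + b `^ be + 1)).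
have ab0 : 0 < a `^ al + b `^ be + 1 by rewrite ltr_wpDl// addr_ge0 ?powR_ge0.
have t0 : 0 < t by rewrite lt_min ltr01 divr_gt0.
have t1 : t <= 1 by rewrite ge_min lexx.
have te : t * (a `^ al + b `^ be + 1) <= eps.
  by rewrite -ler_pdivlMr// ge_min lexx orbT.
pose e := Num.min (t `^ al^-1) (t `^ be^-1).
have e0 : 0 < e by rewrite lt_min !powR_gt0.
have ea : e `^ al <= t.
  rewrite -[leRHS](powRr1 (ltW t0)) -(mulVf (lt0r_neq0 al0)) powRrM.
  by apply: ge0_ler_powR; rewrite ?nnegrE ?powR_ge0 ?(ltW al0) ?(ltW e0)// ge_min lexx.
have eb : e `^ be <= t.
  rewrite -[leRHS](powRr1 (ltW t0)) -(mulVf (lt0r_neq0 be0)) powRrM.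
  by apply: ge0_ler_powR; rewrite ?nnegrE ?powR_ge0 ?(ltW be0) ?(ltW e0)// ge_min lexx orbT.
apply: (le_trans (step e e0)); rewrite -EFinD lee_fin.
move: (a `^ al) (b `^ be) (e `^ al) (e `^ be) (powR_ge0 a al) (powR_ge0 b be) (powR_ge0 e al) (powR_ge0 e be) ea eb te => p q r s p0 q0 r0 s0 ra sb te.
have : r * q <= t * q by rewrite ler_wpM2r.
have : p * s <= p * t by rewrite ler_wpM2l.
have : r * s <= t * 1 by apply: ler_pM => //; lra.
lra.
Qed.

End density.

(** * Iterated integrals and linear changes of variables *)

Section vector_measurability.
Context {R : realType}.

(** Kept convertible to the column built inside [ileb], so that [ileb] and [iint] unfold in step. *)
Definition vcons n (x : R) (v : 'cV[R]_n) : 'cV[R]_n.+1 := col_mx (const_mx x : 'cV[R]_1) v.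

Lemma vcons0 n x (v : 'cV[R]_n) : vcons x v ord0 0 = x.
Proof. by rewrite /vcons mxE; case: splitP => // j _; rewrite mxE. Qed.

Lemma vconsS n x (v : 'cV[R]_n) (i : 'I_n) : vcons x v (lift ord0 i) 0 = v i 0.
Proof.
rewrite /vcons mxE; case: splitP => [[j]|j]; rewrite /= /bump leq0n add1n.
  by case: j.
by rewrite add1n => -[ij]; congr (v _ _); exact: val_inj.
Qed.

Lemma vconsP n (w : 'cV[R]_n.+1) : w = vcons (w ord0 0) (\col_i w (lift ord0 i) 0).
Proof.
apply/colP => i; case: (unliftP ord0 i) => [j ->|->]; first by rewrite vconsS mxE.
by rewrite vcons0.
Qed.

(** Columns carry no measurable structure here; measurability into them is read coordinate by
    coordinate and transported to tuples. *)
Definition vmeas {d} {T : measurableType d} n (h : T -> 'cV[R]_n) :=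
  forall i, measurable_fun setT (fun x => h x i 0).

Lemma vmeas_tup2col n : vmeas (@tup2col R n).
Proof.
move=> i; rewrite (_ : (fun _ => _) = (fun x : n.-tuple R => tnth x i)); first exact: measurable_tnth.
by apply/funext => x; rewrite mxE.
Qed.

Lemma vmeas_cst {d} {T : measurableType d} n (w : 'cV[R]_n) : vmeas (fun _ : T => w).
Proof. by move=> i; exact: measurable_cst. Qed.

Lemma vmeas_comp {d d'} {T : measurableType d} {T' : measurableType d'} n (h : T -> 'cV[R]_n) (a : T' -> T) :
  measurable_fun setT a -> vmeas h -> vmeas (fun x => h (a x)).
Proof. by move=> ma mh i; exact: (measurableT_comp (mh i) ma). Qed.

Lemma vmeas_vcons {d} {T : measurableType d} n (a : T -> R) (h : T -> 'cV[R]_n) :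
  measurable_fun setT a -> vmeas h -> vmeas (fun x => vcons (a x) (h x)).
Proof.
move=> ma mh i; case: (unliftP ord0 i) => [j ->|->].
  by under eq_fun do rewrite vconsS; exact: mh.
by under eq_fun do rewrite vcons0.
Qed.

Lemma vmeas_mul {d} {T : measurableType d} m n (M : 'M[R]_(m, n)) (h : T -> 'cV[R]_n) :
  vmeas h -> vmeas (fun x => M *m h x).
Proof.
move=> mh i; under eq_fun do rewrite mxE.
by apply: measurable_sum => j; apply: measurable_funM => //; exact: mh.
Qed.

Lemma vmeas_add {d} {T : measurableType d} n (h k : T -> 'cV[R]_n) :
  vmeas h -> vmeas k -> vmeas (fun x => h x + k x).
Proof. by move=> mh mk i; under eq_fun do rewrite mxE; apply: measurable_funD. Qed.

Definition pmeas {d} {T : measurableType d} n (F : T -> 'cV[R]_n -> \bar R) :=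
  measurable_fun setT (fun z : T * n.-tuple R => F z.1 (tup2col z.2)).

Lemma pmeas_comp {d d'} {T : measurableType d} {T' : measurableType d'} n
    (F : T -> 'cV[R]_n -> \bar R) (a : T' -> T) (h : T' -> 'cV[R]_n) :
  pmeas F -> measurable_fun setT a -> vmeas h -> measurable_fun setT (fun x => F (a x) (h x)).
Proof.
move=> mF ma mh.
pose k x : n.-tuple R := [tuple h x i 0 | i < n].
have hk x : h x = tup2col (k x) by apply/colP => i; rewrite mxE tnth_mktuple.
have -> : (fun x => F (a x) (h x)) = (fun z : T * n.-tuple R => F z.1 (tup2col z.2)) \o (fun x => (a x, k x)).
  by apply/funext => x /=; rewrite -hk.
apply: measurableT_comp => //; apply: measurable_fun_pair => //.
apply/measurable_fun_tnthP => i; rewrite (_ : _ \o _ = fun x => h x i 0); first exact: mh.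
by apply/funext => x /=; rewrite tnth_mktuple.
Qed.

Lemma Rn_measurableE_comp {d} {T : measurableType d} n (F : 'cV[R]_n -> \bar R) (h : T -> 'cV[R]_n) :
  Rn_measurableE F -> vmeas h -> measurable_fun setT (fun x => F (h x)).
Proof.
move=> mF mh; apply: (@pmeas_comp _ _ T T n (fun _ => F) id h) => //.
exact: (measurableT_comp mF measurable_snd).
Qed.

Lemma Rn_measurableE_pmeas {d} {T : measurableType d} n (F : T -> 'cV[R]_n -> \bar R) t :
  pmeas F -> Rn_measurableE (F t).
Proof.
by move=> mF; apply: (pmeas_comp mF) => //; exact: vmeas_tup2col.
Qed.

End vector_measurability.

Section vector_cons.
Context {R : realType}.

Lemma pmeas_vcons {d} {T : measurableType d} n (F : T -> 'cV[R]_n.+1 -> \bar R) :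
  pmeas F -> pmeas (fun (z : T * R) v => F z.1 (vcons z.2 v)).
Proof.
move=> mF; apply: (pmeas_comp mF); first by mfun.
apply: vmeas_vcons; first by mfun.
exact: (vmeas_comp measurable_snd (@vmeas_tup2col R n)).
Qed.

Lemma Rn_measurableE_vcons n (F : 'cV[R]_n.+1 -> \bar R) :
  Rn_measurableE F -> pmeas (fun (x : R) (v : 'cV[R]_n) => F (vcons x v)).
Proof.
move=> mF; apply: (Rn_measurableE_comp mF); apply: vmeas_vcons; first by mfun.
exact: (vmeas_comp measurable_snd (@vmeas_tup2col R n)).
Qed.

Lemma Rn_measurableE_vcons1 n (F : 'cV[R]_n.+1 -> \bar R) x :
  Rn_measurableE F -> Rn_measurableE (fun v => F (vcons x v)).
Proof. by move=> mF; apply: (@Rn_measurableE_pmeas _ _ _ _ (fun x v => F (vcons x v)) x); exact: Rn_measurableE_vcons. Qed.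

End vector_cons.

Section iterated_integral.
Context {R : realType} (mu : {sigma_finite_measure set R -> \bar R}).
Local Open Scope ereal_scope.

(** The measure is a parameter: [leb] recovers [ileb], and the standard normal law gives the
    standard Gaussian integral in dimension [n]. *)
Fixpoint iint (n : nat) : ('cV[R]_n -> \bar R) -> \bar R :=
  match n return ('cV[R]_n -> \bar R) -> \bar R with
  | 0 => fun F => F 0%R
  | k.+1 => fun F => \int[mu]_x iint (fun v : 'cV[R]_k => F (vcons x v))
  end.

Lemma iint_ge0 n (F : 'cV[R]_n -> \bar R) : (forall v, 0 <= F v) -> 0 <= iint F.
Proof. by elim: n F => [|n IH] F F0 //=; apply: integral_ge0 => x _; exact: IH. Qed.

Lemma eq_iint n (F G : 'cV[R]_n -> \bar R) : F =1 G -> iint F = iint G.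
Proof. by move=> /funext ->. Qed.

(** The parameter space varies in the induction, because peeling off a coordinate replaces [t] by a
    pair. *)
Lemma measurable_iint {d} {T : measurableType d} n (F : T -> 'cV[R]_n -> \bar R) :
  pmeas F -> (forall t v, 0 <= F t v) -> measurable_fun setT (fun t => iint (F t)).
Proof.
elim: n d T F => [|n IH] d T F mF F0 /=.
  by apply: (pmeas_comp mF) => //; exact: vmeas_cst.
apply: (@measurable_fun_fubini_tonelli_F _ _ _ _ _ mu (fun z : T * R => iint (fun v => F z.1 (vcons z.2 v)))).
  by apply: IH => //; exact: pmeas_vcons.
by move=> z; exact: iint_ge0.
Qed.

Lemma iint_swap {d} {T : measurableType d} (nu : {sigma_finite_measure set T -> \bar R}) n
    (F : T -> 'cV[R]_n -> \bar R) : pmeas F -> (forall t v, 0 <= F t v) ->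
  \int[nu]_t iint (F t) = iint (fun v => \int[nu]_t F t v).
Proof.
elim: n F => [//|n IH] F mF F0 /=.
have mG : measurable_fun setT (fun z : T * R => iint (fun v => F z.1 (vcons z.2 v))).
  by apply: measurable_iint => //; exact: pmeas_vcons.
rewrite (@fubini_tonelli _ _ _ _ _ nu mu _ mG); last by move=> z; exact: iint_ge0.
apply: eq_integral => x _ /=; apply: (IH (fun t v => F t (vcons x v))) => //.
apply: (pmeas_comp mF); first by mfun.
by apply: vmeas_vcons => //; exact: (vmeas_comp measurable_snd (@vmeas_tup2col R n)).
Qed.

Lemma measurable_iint_vcons n (F : 'cV[R]_n.+1 -> \bar R) :
  Rn_measurableE F -> (forall v, 0 <= F v) ->
  measurable_fun setT (fun x : R => iint (fun v => F (vcons x v))).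
Proof. by move=> mF F0; apply: measurable_iint => //; exact: Rn_measurableE_vcons. Qed.

Lemma le_iint n (F G : 'cV[R]_n -> \bar R) : Rn_measurableE F -> Rn_measurableE G ->
  (forall v, 0 <= F v) -> (forall v, F v <= G v) -> iint F <= iint G.
Proof.
elim: n F G => [|n IH] F G mF mG F0 FG /=; first exact: FG.
have G0 v : 0 <= G v by exact: le_trans (FG v).
apply: ge0_le_integral => //.
- by move=> x _; exact: iint_ge0.
- exact: measurable_iint_vcons.
- exact: measurable_iint_vcons.
- by move=> x _; apply: IH => //; exact: Rn_measurableE_vcons1.
Qed.

Lemma iintZl n k (F : 'cV[R]_n -> \bar R) : Rn_measurableE F -> (forall v, 0 <= F v) -> 0 <= k ->
  iint (fun v => k * F v) = k * iint F.
Proof.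
elim: n F => [//|n IH] F mF F0 k0 /=.
rewrite -ge0_integralZl//; last by move=> x _; exact: iint_ge0.
  apply: eq_integral => x _; apply: IH => //.
  exact: Rn_measurableE_vcons1.
exact: measurable_iint_vcons.
Qed.

Lemma cvg_iint n (F_ : nat -> 'cV[R]_n -> \bar R) (F : 'cV[R]_n -> \bar R) :
  (forall k, Rn_measurableE (F_ k)) -> (forall k v, 0 <= F_ k v) ->
  (forall v, {homo F_^~ v : k l / (k <= l)%N >-> k <= l}) ->
  (forall v, F_ k v @[k --> \oo] --> F v) -> iint (F_ k) @[k --> \oo] --> iint F.
Proof.
elim: n F_ F => [|n IH] F_ F mF F0 nd cF /=; first exact: cF.
rewrite (_ : \int[mu]_x _ = \int[mu]_x limn (fun k => iint (fun v => F_ k (vcons x v)))); last first.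
  by apply: eq_integral => x _; apply/esym/cvg_lim => //; apply: IH => // k; exact: Rn_measurableE_vcons1.
apply: cvg_monotone_convergence => //.
- by move=> k; exact: measurable_iint_vcons.
- by move=> k x _; exact: iint_ge0.
- move=> x _ k l kl; apply: le_iint => //; try exact: Rn_measurableE_vcons1.
  by move=> v; exact: nd.
Qed.

End iterated_integral.

(** * Linear changes of variables and Gaussian integrals in several dimensions *)

Section linear_change.
Context {R : realType}.
Local Open Scope ereal_scope.

Lemma iint_lebE n (F : 'cV[R]_n -> \bar R) : Rn_measurableE F -> (forall v, 0 <= F v) ->
  ileb F = iint leb F.
Proof.
elim: n F => [//|n IH] F mF F0 /=; rewrite -integral_lebE.
- apply: eq_integral => x _; apply: IH => //; exact: Rn_measurableE_vcons1.
- exact: measurable_iint_vcons.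
- by move=> x; exact: iint_ge0.
Qed.

Lemma Rn_measurableE_lin m n (F : 'cV[R]_m -> \bar R) (M : 'M[R]_(m, n)) (a : 'cV[R]_m) :
  Rn_measurableE F -> Rn_measurableE (fun v => F (M *m v + a)%R).
Proof.
move=> mF; apply: (Rn_measurableE_comp mF); apply: vmeas_add; last exact: vmeas_cst.
by apply: vmeas_mul; exact: vmeas_tup2col.
Qed.

Lemma iint_leb_shift n (F : 'cV[R]_n -> \bar R) (a : 'cV[R]_n) : Rn_measurableE F ->
  (forall v, 0 <= F v) -> iint leb F = iint leb (fun v => F (v + a)%R).
Proof.
elim: n F a => [|n IH] F a mF F0 /=; first by congr F; apply/colP => -[].
rewrite (@integral_affine _ 1 (a ord0 ord0)) ?oner_eq0//; last 2 first.
- exact: measurable_iint_vcons.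
- by move=> x; exact: iint_ge0.
rewrite normr1 mul1e; apply: eq_integral => x _; rewrite mul1r.
rewrite (IH _ (\col_i a (lift ord0 i) ord0)); last 2 first.
- exact: Rn_measurableE_vcons1.
- by move=> v; exact: F0.
apply: eq_iint => v; congr F; rewrite [in RHS](vconsP a); apply/colP => i.
rewrite [RHS]mxE; case: (unliftP ord0 i) => [j ->|->].
  by rewrite !vconsS !mxE.
by rewrite !vcons0.
Qed.

(** The change of variables formula as a property of the matrix: it is stable under products, so it
    has to be checked only on elementary factors. *)
Definition leb_linear n (M : 'M[R]_n) := forall F : 'cV[R]_n -> \bar R,
  Rn_measurableE F -> (forall v, 0 <= F v) ->
  iint leb F = (`|\det M|%R)%:E * iint leb (fun v => F (M *m v)).

Lemma leb_linear_mul n (M N : 'M[R]_n) : leb_linear M -> leb_linear N -> leb_linear (M *m N).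
Proof.
move=> lM lN F mF F0; rewrite lM// lN//; last first.
  by have := Rn_measurableE_lin M 0 mF; under eq_fun do rewrite addr0.
rewrite muleA -EFinM -normrM -det_mulmx; congr (_ * _).
by apply: eq_iint => v; rewrite mulmxA.
Qed.

Lemma block_vcons n (a : 'M[R]_1) (r : 'M[R]_(1, n)) (c : 'M[R]_(n, 1)) (D : 'M[R]_n) x (v : 'cV[R]_n) :
  (block_mx a r c D : 'M[R]_n.+1) *m vcons x v =
  vcons (a 0 0 * x + (r *m v) 0 0)%R (D *m v + c *m (const_mx x : 'cV[R]_1)).
Proof.
rewrite /vcons -[LHS]/((block_mx a r c D : 'M[R]_(1 + n)) *m col_mx (const_mx x) v).
have -> : const_mx (a 0 0 * x + (r *m v) 0 0)%R = (a *m const_mx x + r *m v)%R :> 'cV[R]_1.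
  by apply/matrixP => i j; rewrite !mxE !ord1 big_ord1 !mxE.
by rewrite mul_block_col (addrC (D *m v)%R).
Qed.

Lemma leb_linear_lower n (c : 'M[R]_(n, 1)) : leb_linear (block_mx 1%:M 0 c 1%:M : 'M[R]_n.+1).
Proof.
move=> F mF F0; rewrite (@det_lblock _ 1 n) !det1 mulr1 normr1 mul1e /=.
apply: eq_integral => x _.
rewrite (@iint_leb_shift _ _ (c *m (const_mx x : 'cV[R]_1))); last 2 first.
- exact: Rn_measurableE_vcons1.
- by move=> v; exact: F0.
by apply: eq_iint => v; rewrite block_vcons mul1mx mul0mx !mxE mul1r addr0.
Qed.

(** With the first coordinate moved innermost by [iint_swap], the shear is a translation of that
    coordinate by an amount depending on the others. *)
Lemma leb_linear_upper n (r : 'M[R]_(1, n)) : leb_linear (block_mx 1%:M r 0 1%:M : 'M[R]_n.+1).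
Proof.
move=> F mF F0; rewrite (@det_ublock _ 1 n) !det1 mulr1 normr1 mul1e /=.
have E x (v : 'cV[R]_n) : (block_mx 1%:M r 0 1%:M : 'M[R]_n.+1) *m vcons x v = vcons (x + (r *m v) 0 0)%R v.
  by rewrite block_vcons mul1mx mul0mx addr0 mxE mul1r.
rewrite !iint_swap//; last 2 first.
- apply: (Rn_measurableE_comp mF).
  by apply: vmeas_mul; apply: vmeas_vcons; [mfun|exact: (vmeas_comp measurable_snd (@vmeas_tup2col R n))].
- exact: Rn_measurableE_vcons.
apply: eq_iint => v.
rewrite (@integral_affine _ 1 ((r *m v) ord0 ord0)) ?oner_eq0//; last first.
  apply: (Rn_measurableE_comp mF); apply: vmeas_vcons => //; exact: vmeas_cst.
by rewrite normr1 mul1e; apply: eq_integral => x _; rewrite E mul1r.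
Qed.

Lemma leb_linear_diag n (a : R) (S : 'M[R]_n) : a != 0%R -> leb_linear S ->
  leb_linear (block_mx (a%:M : 'M[R]_1) 0 0 S : 'M[R]_n.+1).
Proof.
move=> a0 lS F mF F0; rewrite (@det_ublock _ 1 n) det_scalar1 normrM EFinM -muleA /=.
rewrite (@integral_affine _ a 0) ?oner_eq0//; last 2 first.
- exact: measurable_iint_vcons.
- by move=> x; exact: iint_ge0.
congr (_ * _); rewrite -ge0_integralZl//; last 2 first.
- have mG : Rn_measurableE (fun v => F ((block_mx (a%:M : 'M[R]_1) 0 0 S : 'M[R]_n.+1) *m v)).
    by have := Rn_measurableE_lin (block_mx (a%:M : 'M[R]_1) 0 0 S : 'M[R]_n.+1) 0 mF; under eq_fun do rewrite addr0.
  exact: measurable_iint_vcons mG _.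
- by move=> x _; exact: iint_ge0.
apply: eq_integral => x _.
rewrite (lS _ (Rn_measurableE_vcons1 (a * x + 0)%R mF))//.
congr (_ * _); apply: eq_iint => v.
by rewrite block_vcons !mul0mx !addr0 !mxE addr0 mulr1n.
Qed.

(* Induction on the size: LDU decomposition of the first row and column, after a shear
   making the corner entry nonzero. *)
Lemma leb_linear_unit n (M : 'M[R]_n) : M \in unitmx -> leb_linear M.
Proof.
elim: n M => [|n IH] M uM.
  move=> F mF F0; rewrite det_mx00 normr1 mul1e/=; congr F.
  by apply/colP => -[].
have nz (N : 'M[R]_(1 + n)) : N \in unitmx -> N ord0 ord0 != 0%R -> leb_linear (N : 'M[R]_n.+1).
  move=> uN N0.
  set a := N ord0 ord0 in N0.
  set r := ursubmx N; set c := dlsubmx N; set D := drsubmx N.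
  have aE : ulsubmx N = a%:M.
    by rewrite [LHS]mx11_scalar !mxE; congr (N _ _)%:M; apply: val_inj.
  pose S := (D - a^-1 *: (c *m r))%R.
  have NE : N = (block_mx 1%:M 0 (a^-1 *: c) 1%:M : 'M[R]_(1 + n)) *m (block_mx a%:M 0 0 S : 'M[R]_(1 + n)) *m (block_mx 1%:M (a^-1 *: r) 0 1%:M : 'M[R]_(1 + n)).
    rewrite !mulmx_block !mul0mx !mulmx0 !mul1mx !mulmx1 !addr0 !add0r.
    rewrite -[LHS]submxK aE -/r -/c -/D; congr block_mx.
    - by rewrite -scalemxAr mul_scalar_mx scalerA mulVf// scale1r.
    - by rewrite mul_mx_scalar scalerA mulfV// scale1r.
    - by rewrite mul_mx_scalar scalerA mulfV// scale1r -scalemxAr /S addrC subrK.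
  have uS : S \in unitmx.
    move: uN; rewrite NE !unitmx_mul => /andP[/andP[_ +] _].
    by rewrite !unitmxE (@det_ublock _ 1 n) det_scalar1 unitrM => /andP[].
  rewrite NE; apply: leb_linear_mul; last exact: leb_linear_upper.
  by apply: leb_linear_mul; [exact: leb_linear_lower|apply: leb_linear_diag => //; exact: IH].
have [M0|M0] := eqVneq (M ord0 ord0) 0%R; last exact: (nz M).
have [i Mi] : exists i : 'I_n, M (lift ord0 i) ord0 != 0%R.
  apply/existsP; rewrite -[X in is_true X]negbK; apply/negP; rewrite negb_exists => /forallP Mz.
  move: uM; rewrite unitmxE (expand_det_col _ ord0) big1 ?unitr0// => j _.
  case: (unliftP ord0 j) => [k ->|->]; last by rewrite M0 mul0r.
  by have := Mz k; rewrite negbK => /eqP ->; rewrite mul0r.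
pose E (s : R) : 'M[R]_(1 + n) := block_mx 1%:M (s *: delta_mx ord0 i) 0 1%:M.
have EE : E (-1)%R *m E 1%R = 1%:M.
  rewrite /E mulmx_block !mul0mx !mulmx0 !mul1mx !mulmx1 !addr0 !add0r scaleN1r scale1r addrN.
  by rewrite -scalar_mx_block.
have -> : M = E (-1)%R *m (E 1%R *m M) by rewrite mulmxA EE mul1mx.
apply: leb_linear_mul; first exact: leb_linear_upper.
apply: nz.
  rewrite unitmx_mul uM andbT unitmxE (@det_ublock _ 1 n) !det1 mulr1; exact: unitr1.
suff -> : (E 1%R *m M) ord0 ord0 = M (lift ord0 i) ord0 by [].
rewrite -[M in LHS](@vsubmxK _ 1 n) /E mul_block_col mul1mx scale1r.
rewrite (_ : ord0 = lshift n ord0 :> 'I_(1 + n)); last exact: val_inj.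
rewrite col_mxEu mxE -rowE !mxE (_ : lshift n ord0 = ord0 :> 'I_(1 + n)); last exact: val_inj.
by rewrite M0 add0r; congr (M _ _); apply: val_inj.
Qed.

Definition gdens1 n (z : 'cV[R]_n) : R := \prod_i normal_pdf 0 1 (z i 0).

Lemma gdens1_ge0 n (z : 'cV[R]_n) : (0 <= gdens1 z)%R.
Proof. by apply: prodr_ge0 => i _; exact: normal_pdf_ge0. Qed.

Lemma vmeas_gdens1 {d} {T : measurableType d} n (h : T -> 'cV[R]_n) :
  vmeas h -> measurable_fun setT (fun x => gdens1 (h x)).
Proof.
move=> mh; apply: measurable_prod => i _.
by apply: measurableT_comp (mh i); exact: measurable_normal_pdf.
Qed.

Lemma iint_gdens1 n (F : 'cV[R]_n -> \bar R) : Rn_measurableE F -> (forall v, 0 <= F v) ->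
  iint leb (fun z => (gdens1 z)%:E * F z) = iint (@nrm R 0 1) F.
Proof.
elim: n F => [|n IH] F mF F0 /=; first by rewrite /gdens1 big_ord0 mul1e.
rewrite integral_normal//; last 2 first.
- exact: measurable_iint_vcons.
- by move=> x; exact: iint_ge0.
apply: eq_integral => x _.
rewrite -(IH _ (Rn_measurableE_vcons1 x mF))//.
rewrite muleC -iintZl ?lee_fin ?normal_pdf_ge0//; last 2 first.
- apply: emeasurable_funM; last exact: Rn_measurableE_vcons1.
  by apply/measurable_EFinP; apply: vmeas_gdens1; exact: vmeas_tup2col.
- by move=> v; rewrite mule_ge0// lee_fin gdens1_ge0.
apply: eq_iint => v; rewrite muleA -EFinM /gdens1 big_ord_recl vcons0.
congr ((_ * _)%:E * _); apply: eq_bigr => i _; congr normal_pdf.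
by rewrite -[RHS](vconsS x v).
Qed.

(** The factor [A] turns the quadratic form into the squared norm of [z], and the Jacobian [|det A|]
    cancels the root of [det (A *m A^T)]. *)
Lemma gdens_factor n (m : 'cV[R]_n) (A : 'M[R]_n) (z : 'cV[R]_n) : A \in unitmx ->
  (`|\det A| * gdens m (A *m A^T) (A *m z + m) = gdens1 z)%R.
Proof.
move=> uA.
have dA : \det A != 0%R by move: uA; rewrite unitmxE unitfE.
rewrite /gdens addrK det_mulmx det_tr -expr2 trmx_mul.
rewrite (_ : z^T *m A^T *m _ *m _ = z^T *m z); last first.
  rewrite -!mulmxA; congr (_ *m _); rewrite !mulmxA.
  suff -> : A^T *m invmx (A *m A^T) *m A = 1%:M by rewrite mul1mx.
  have uAT : A^T \in unitmx by rewrite unitmx_tr.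
  have AE : A = (A *m A^T) *m invmx A^T by rewrite -mulmxA mulmxV// mulmx1.
  rewrite [X in _ *m X]AE -mulmxA (mulmxA (invmx _)) mulVmx ?mul1mx ?mulmxV//.
  by rewrite unitmx_mul uA.
have pi0 : (0 <= pi *+ 2 :> R)%R by rewrite mulrn_wge0// pi_ge0.
rewrite sqrtrM ?exprn_ge0// sqrtr_sqr invfM mulrA mulrCA mulfV ?normr_eq0// mulr1.
rewrite /gdens1; under eq_bigr do rewrite normal_pdf01E.
rewrite big_split /= prodr_const card_ord exprVn; congr (_ * _)%R.
  congr (_^-1)%R; elim: (n) => [|k IH]; first by rewrite !expr0 sqrtr1.
  by rewrite !exprS sqrtrM// IH.
have -> : ((z^T *m z) ord0 ord0 = \sum_i z i ord0 ^+ 2)%R.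
  by rewrite mxE; apply: eq_bigr => i _; rewrite mxE expr2.
by rewrite -expR_sum -mulr_suml sumrN.
Qed.

(** The factor [A] of [Q] is left free: the simultaneous diagonalisation prescribes it, and it need
    not be the symmetric root. *)
Lemma gint_iint n (m : 'cV[R]_n) (Q A : 'M[R]_n) (F : 'cV[R]_n -> \bar R) :
  A \in unitmx -> A *m A^T = Q -> Rn_measurableE F -> (forall v, 0 <= F v) ->
  gint m Q F = iint (@nrm R 0 1) (fun z => F (A *m z + m)%R).
Proof.
move=> uA <- mF F0; rewrite /gint.
have mg : Rn_measurableE (fun y => (gdens m (A *m A^T) y)%:E).
  apply/measurable_EFinP; rewrite /gdens; apply: measurable_funM => //.
  apply: measurableT_comp => //; apply: measurable_funM => //; apply: measurableT_comp => //.
  under eq_fun do rewrite mxE.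
  apply: measurable_sum => i; apply: measurable_funM.
    under eq_fun do rewrite mxE.
    apply: measurable_sum => j; apply: measurable_funM => //.
    under eq_fun do rewrite !mxE.
    by apply: measurable_funB => //; exact: measurable_tnth.
  under eq_fun do rewrite !mxE.
  by apply: measurable_funB => //; exact: measurable_tnth.
have g0 y : (0 <= gdens m (A *m A^T) y)%R by rewrite mulr_ge0 ?invr_ge0 ?sqrtr_ge0 ?expR_ge0.
have mgF : Rn_measurableE (fun y => (gdens m (A *m A^T) y)%:E * F y) by apply: emeasurable_funM.
have gF0 y : 0 <= (gdens m (A *m A^T) y)%:E * F y by rewrite mule_ge0// lee_fin.
rewrite iint_lebE// (iint_leb_shift m)//.
have mgFs : Rn_measurableE (fun y => (gdens m (A *m A^T) (y + m)%R)%:E * F (y + m)%R).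
  by have := Rn_measurableE_lin 1%:M m mgF; under eq_fun do rewrite mul1mx.
rewrite (leb_linear_unit uA mgFs); last by move=> v; exact: gF0.
rewrite -(@iintZl _ _ _ _ _ (Rn_measurableE_lin A m mgF)) ?lee_fin//.
rewrite -iint_gdens1//; last exact: (Rn_measurableE_lin A m mF).
by apply: eq_iint => z; rewrite muleA -EFinM gdens_factor.
Qed.

End linear_change.

(** * Hypercontractivity of tensor products *)

Section tensor.
Context {R : realType}.
Notation G := (@nrm R 0 1).

Definition mehler n (d : 'I_n -> R) (z w : 'cV[R]_n) : 'cV[R]_n :=
  \col_i (d i * z i 0 + Num.sqrt (1 - d i ^+ 2) * w i 0).

Lemma mehler_vcons n (d : 'I_n.+1 -> R) x u (z w : 'cV[R]_n) :
  mehler d (vcons x z) (vcons u w) =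
  vcons (d ord0 * x + Num.sqrt (1 - d ord0 ^+ 2) * u) (mehler (d \o lift ord0) z w).
Proof.
apply/colP => i; rewrite mxE; case: (unliftP ord0 i) => [j ->|->].
  by rewrite !vconsS mxE.
by rewrite !vcons0.
Qed.

Lemma vmeas_mehler {d} {T : measurableType d} n (c : 'I_n -> R) (h k : T -> 'cV[R]_n) :
  vmeas h -> vmeas k -> vmeas (fun x => mehler c (h x) (k x)).
Proof.
move=> mh mk i; under eq_fun do rewrite mxE.
by apply: measurable_funD; apply: measurable_funM => //; exact: mh || exact: mk.
Qed.

Lemma Rn_measurable_comp {d} {T : measurableType d} n (f : 'cV[R]_n -> R) (h : T -> 'cV[R]_n) :
  Rn_measurable f -> vmeas h -> measurable_fun setT (fun x => f (h x)).
Proof.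
move=> mf mh; apply/measurable_EFinP.
by apply: (@Rn_measurableE_comp R _ T n (EFin \o f) h) => //; exact/measurable_EFinP.
Qed.

Local Open Scope ereal_scope.

Lemma iint_cst n (k : \bar R) : iint G (fun _ : 'cV[R]_n => k) = k.
Proof.
elim: n => [//|n IH] /=; under eq_integral do rewrite IH.
by rewrite integral_cst//= [X in _ * X](_ : _ = 1) ?mule1//; exact: probability_setT.
Qed.

Definition riint n (f : 'cV[R]_n -> R) : R := fine (iint G (EFin \o f)).

Lemma iint_bounded n (f : 'cV[R]_n -> R) K : Rn_measurable f -> (forall v, 0 <= f v <= K)%R ->
  iint G (EFin \o f) = (riint f)%:E /\ (0 <= riint f <= K)%R.
Proof.
move=> mf fK.
have f0 : 0 <= iint G (EFin \o f) by apply: iint_ge0 => v /=; rewrite lee_fin; have /andP[] := fK v.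
have f1 : iint G (EFin \o f) <= K%:E.
  rewrite -(iint_cst n K%:E); apply: le_iint.
  - exact/measurable_EFinP.
  - exact: measurable_cst.
  - by move=> v /=; rewrite lee_fin; have /andP[] := fK v.
  - by move=> v /=; rewrite lee_fin; have /andP[] := fK v.
have E : iint G (EFin \o f) = (riint f)%:E.
  by rewrite /riint fineK// ge0_fin_numE// (le_lt_trans f1)// ltry.
by split=> //; rewrite -!lee_fin -E f0.
Qed.

(** For fixed first coordinates [x] and [u] the induction hypothesis applies to the slices and
    leaves [F x]^ al * H (a * x + b * u) [^ be], the integrand of the one-dimensional inequality. *)
Lemma gauss_jensenn n (al be : R) (c : 'I_n -> R) K (f g : 'cV[R]_n -> R) :
  (0 < al < 1)%R -> (0 < be < 1)%R -> (forall i, c i ^+ 2 < 1)%R ->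
  (forall i, c i ^+ 2 * (al * be) <= (1 - al) * (1 - be))%R ->
  Rn_measurable f -> (forall v, 0 <= f v <= K)%R ->
  Rn_measurable g -> (forall v, 0 <= g v <= K)%R ->
  iint G (fun z => iint G (fun w => (f z `^ al * g (mehler c z w) `^ be)%:E)) <=
  (riint f `^ al * riint g `^ be)%:E.
Proof.
move=> al01 be01; elim: n c f g => [|n IH] c f g c1 hyp mf fK mg gK /=.
  by rewrite /riint /= [mehler _ _ _](_ : _ = 0%R)//; apply/colP => -[].
set a := c ord0; set b : R := Num.sqrt (1 - a ^+ 2)%R.
pose F x := riint (fun v => f (vcons x v)).
pose H x := riint (fun v => g (vcons x v)).
have mf1 x : Rn_measurable (fun v => f (vcons x v)).
  by apply: (Rn_measurable_comp mf); apply: vmeas_vcons => //; exact: vmeas_tup2col.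
have mg1 x : Rn_measurable (fun v => g (vcons x v)).
  by apply: (Rn_measurable_comp mg); apply: vmeas_vcons => //; exact: vmeas_tup2col.
have FE x : iint G (EFin \o (fun v => f (vcons x v))) = (F x)%:E /\ (0 <= F x <= K)%R by exact: iint_bounded.
have HE x : iint G (EFin \o (fun v => g (vcons x v))) = (H x)%:E /\ (0 <= H x <= K)%R by exact: iint_bounded.
have mF : measurable_fun setT F.
  apply/measurable_EFinP; rewrite (_ : _ \o _ = fun x => iint G (fun v => (EFin \o f) (vcons x v))).
    apply: measurable_iint_vcons; first exact/measurable_EFinP.
    by move=> v; rewrite lee_fin; have /andP[] := fK v.
  by apply/funext => x /=; rewrite -(FE x).1.
have mH : measurable_fun setT H.
  apply/measurable_EFinP; rewrite (_ : _ \o _ = fun x => iint G (fun v => (EFin \o g) (vcons x v))).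
    apply: measurable_iint_vcons; first exact/measurable_EFinP.
    by move=> v; rewrite lee_fin; have /andP[] := gK v.
  by apply/funext => x /=; rewrite -(HE x).1.
have -> : riint f = (\int[G]_x F x)%R.
  by rewrite /riint /Rintegral /=; congr fine; apply: eq_integral => x _; rewrite -(FE x).1.
have -> : riint g = (\int[G]_x H x)%R.
  by rewrite /riint /Rintegral /=; congr fine; apply: eq_integral => x _; rewrite -(HE x).1.
have b0 : (0 < b)%R by rewrite sqrtr_gt0 subr_gt0; exact: c1.
have ab : (a ^+ 2 + b ^+ 2 = 1)%R by rewrite sqr_sqrtr ?subr_ge0 ?(ltW (c1 ord0))// addrC subrK.
apply: le_trans (gauss_jensen al01 be01 ab b0 (hyp ord0) mF (fun x => (FE x).2) mH (fun x => (HE x).2)).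
pose K4 (x u : R) (z w : 'cV[R]_n) := (f (vcons x z) `^ al * g (vcons (a * x + b * u) (mehler (c \o lift ord0) z w)) `^ be)%:E.
have K40 x u z w : 0 <= K4 x u z w by rewrite lee_fin mulr_ge0// powR_ge0.
(* Arbitrary measurable arguments are allowed, so that this one fact serves every order and depth of
   the nested integrals. *)
have mK4 : forall d (T : measurableType d) (x u : T -> R) (z w : T -> 'cV[R]_n),
    measurable_fun setT x -> measurable_fun setT u -> vmeas z -> vmeas w ->
    measurable_fun setT (fun t => K4 (x t) (u t) (z t) (w t)).
  move=> d T x u z w mx mu mz mw; apply/measurable_EFinP; apply: measurable_funM.
    apply: (measurableT_comp (measurable_powR al)).
    by apply: (Rn_measurable_comp mf); exact: vmeas_vcons.
  apply: (measurableT_comp (measurable_powR be)); apply: (Rn_measurable_comp mg).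
  apply: vmeas_vcons; last exact: vmeas_mehler.
  by apply: measurable_funD; apply: measurable_funM.
have vt m : vmeas (@tup2col R m) by exact: vmeas_tup2col.
have v1 : forall d (T : measurableType d) m, vmeas (fun t : T * m.-tuple R => tup2col t.2).
  move=> d T m; exact: (vmeas_comp measurable_snd (vt m)).
have v2 : forall d d' (T : measurableType d) (T' : measurableType d') m, vmeas (fun t : T * m.-tuple R * T' => tup2col t.1.2).
  move=> d d' T T' m; by apply: (@vmeas_comp R _ _ _ _ m (fun t : T * m.-tuple R => tup2col t.2) fst measurable_fst); exact: v1.
(* The definition of [iint] places the first noise coordinate [u] inside the integral over [z]; it
   must come out before the induction hypothesis applies. *)
have KE x : iint G (fun z => \int[G]_u iint G (K4 x u z)) = \int[G]_u iint G (fun z => iint G (K4 x u z)).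
  rewrite -(@iint_swap _ _ _ _ _ n (fun u z => iint G (K4 x u z)))//.
    apply: (@measurable_iint _ _ _ _ n (fun t : R * n.-tuple R => K4 x t.1 (tup2col t.2))) => //.
    by apply: mK4; [mfun|mfun|exact: v2|exact: v1].
  by move=> u v; exact: iint_ge0.
have -> : \int[G]_x iint G (fun z => \int[G]_u iint G (fun w => (f (vcons x z) `^ al * g (mehler c (vcons x z) (vcons u w)) `^ be)%:E))
   = \int[G]_x \int[G]_u iint G (fun z => iint G (K4 x u z)).
  apply: eq_integral => x _; rewrite -KE; apply: eq_iint => z; apply: eq_integral => u _.
  by apply: eq_iint => w; rewrite mehler_vcons.
have mI : measurable_fun setT (fun t : R * R => iint G (fun z => iint G (K4 t.1 t.2 z))).
  apply: (@measurable_iint _ _ _ _ n (fun (t : R * R) z => iint G (K4 t.1 t.2 z))).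
    apply: (@measurable_iint _ _ _ _ n (fun t : (R * R) * n.-tuple R => K4 t.1.1 t.1.2 (tup2col t.2))) => //.
    by apply: mK4; [mfun|mfun|exact: v2|exact: v1].
  by move=> t v; exact: iint_ge0.
have I0 x u : 0 <= iint G (fun z => iint G (K4 x u z)) by do 2 (apply: iint_ge0 => ?).
have mJ : measurable_fun setT (fun t : R * R => (F t.1 `^ al * H (a * t.1 + b * t.2)%R `^ be)%:E).
  by apply/measurable_EFinP; mfun.
have pr (x : R) : measurable_fun setT (fun u : R => (x, u)) by mfun.
have J0 (t : R * R) : 0 <= (F t.1 `^ al * H (a * t.1 + b * t.2)%R `^ be)%:E.
  by rewrite lee_fin mulr_ge0// powR_ge0.
apply: ge0_le_integral => //.
- by move=> x _; apply: integral_ge0 => u _.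
- by apply: (@measurable_fun_fubini_tonelli_F _ _ _ _ _ G _ mI) => t; exact: I0.
- by apply: (@measurable_fun_fubini_tonelli_F _ _ _ _ _ G _ mJ) => t; exact: J0.
move=> x _; apply: ge0_le_integral => //.
- exact: (measurableT_comp mI (pr x)).
- exact: (measurableT_comp mJ (pr x)).
move=> u _; apply: (IH (c \o lift ord0)) => //.
- by move=> i; exact: c1.
- by move=> i; exact: hyp.
Qed.

Lemma Rn_measurableE_mehler n (c : 'I_n -> R) (F : 'cV[R]_n -> \bar R) :
  Rn_measurableE F -> (forall v, 0 <= F v) ->
  Rn_measurableE (fun z => iint G (fun w => F (mehler c z w))).
Proof.
move=> mF F0.
apply: (@measurable_iint _ _ _ _ n (fun (t : n.-tuple R) w => F (mehler c (tup2col t) w))) => //.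
apply: (Rn_measurableE_comp mF); apply: vmeas_mehler.
  exact: (vmeas_comp measurable_fst (@vmeas_tup2col R n)).
exact: (vmeas_comp measurable_snd (@vmeas_tup2col R n)).
Qed.

Lemma powR_le_bound (x K a : R) : (0 <= a)%R -> (0 <= x <= K)%R -> (0 <= x `^ a <= K `^ a)%R.
Proof.
move=> a0 /andP[x0 xK]; rewrite powR_ge0/= ge0_ler_powR// nnegrE//.
exact: le_trans xK.
Qed.

(* Duality: test the bilinear inequality against the power [p - 1] of the image itself. *)
Lemma mehler_contract_bounded n (p q : R) (c : 'I_n -> R) K (f : 'cV[R]_n -> R) :
  (1 < q)%R -> (1 < p)%R -> (forall i, c i ^+ 2 < 1)%R ->
  (forall i, c i ^+ 2 * (p - 1) <= q - 1)%R ->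
  Rn_measurable f -> (forall v, 0 <= f v <= K)%R ->
  iint G (fun z => iint G (fun w => (f (mehler c z w))%:E) `^ p) `^ p^-1 <=
  iint G (fun z => (f z `^ q)%:E) `^ q^-1.
Proof.
move=> q1 p1 c1 hyp mf fK.
have [q0 p0] : (0 < q)%R /\ (0 < p)%R by split; lra.
have f0 v : 0 <= (f v)%:E by rewrite lee_fin; have /andP[] := fK v.
pose N z := riint (fun w => f (mehler c z w)).
have NE z : iint G (EFin \o (fun w => f (mehler c z w))) = (N z)%:E /\ (0 <= N z <= K)%R.
  apply: iint_bounded => //; apply: (Rn_measurable_comp mf).
  by apply: vmeas_mehler; [exact: vmeas_cst|exact: vmeas_tup2col].
have mN : Rn_measurable N.
  apply/measurable_EFinP.
  rewrite (_ : _ \o _ = (fun z => iint G (fun w => (EFin \o f) (mehler c z w))) \o @tup2col R n).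
    by apply: Rn_measurableE_mehler => //; exact/measurable_EFinP.
  by apply/funext => x /=; rewrite -(NE _).1.
have N0 z : (0 <= N z)%R by have /andP[] := (NE z).2.
have mNp : Rn_measurable (fun z => N z `^ p)%R by exact: (measurableT_comp (measurable_powR p) mN).
have mfq : Rn_measurable (fun z => f z `^ q)%R by exact: (measurableT_comp (measurable_powR q) mf).
pose K' := Num.max (K `^ p)%R (K `^ q)%R.
have Npb z : (0 <= N z `^ p <= K')%R.
  by have /andP[-> /= h] := powR_le_bound (ltW p0) (NE z).2; rewrite le_max h.
have fqb z : (0 <= f z `^ q <= K')%R.
  by have /andP[-> /= h] := powR_le_bound (ltW q0) (fK z); rewrite le_max h orbT.
have al01 : (0 < (p - 1) / p < 1)%R.
  by rewrite divr_gt0 ?subr_gt0//= ltr_pdivrMr// mul1r ltrBlDr ltrDl.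
have be01 : (0 < q^-1 < 1)%R by rewrite invr_gt0 q0 invf_lt1.
have hyp' i : (c i ^+ 2 * ((p - 1) / p * q^-1) <= (1 - (p - 1) / p) * (1 - q^-1))%R.
  rewrite -subr_ge0 (_ : _ - _ = (q - 1 - c i ^+ 2 * (p - 1)) / (p * q))%R.
    by rewrite divr_ge0 ?subr_ge0// mulr_ge0// ltW.
  by field; rewrite !gt_eqF.
have := gauss_jensenn al01 be01 c1 hyp' mNp Npb mfq fqb.
have [IE /andP[I0 _]] := iint_bounded mNp Npb.
have [JE /andP[J0 _]] := iint_bounded mfq fqb.
(* Since [N]^ p[raised to]al[is]N [^ (p - 1)], a constant for the inner integral, that integral
   supplies the missing factor [N]. *)
rewrite (_ : iint G _ = iint G (EFin \o (fun z => N z `^ p)%R)); last first.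
  apply: eq_iint => z /=.
  rewrite (@eq_iint _ _ _ _ (fun w => (N z `^ (p - 1))%:E * (EFin \o f) (mehler c z w))); last first.
    move=> w /=; rewrite -EFinM -!powRrM mulrC mulfV ?gt_eqF// powRr1; last by have /andP[] := fK (mehler c z w).
    by rewrite (mulrC p) mulfVK ?gt_eqF// mulrC.
  have mff : Rn_measurableE (fun w => (EFin \o f) (mehler c z w)).
    apply/measurable_EFinP; apply: (Rn_measurable_comp mf).
    by apply: vmeas_mehler; [exact: vmeas_cst|exact: vmeas_tup2col].
  rewrite (iintZl _ mff) ?lee_fin ?powR_ge0//; last by move=> v; exact: f0.
  by rewrite (NE z).1 -EFinM mulrC mulr_powRB1.
rewrite (_ : iint G (fun z => iint G _ `^ p) = iint G (EFin \o (fun z => N z `^ p)%R)); last first.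
  by apply: eq_iint => z; rewrite (NE z).1.
rewrite IE -/(EFin \o (fun z => f z `^ q)%R) JE !poweR_EFin !lee_fin.
set I := riint _; set J := riint _ => IJ.
(* The inequality reads [I <= I]^ ((p - 1) / p) * J [^ q^-1]. Boundedness of [f] makes [I] a real
   number, so the power of [I] can be divided out when it is nonzero. *)
have [->|Ipos] := eqVneq I 0%R; first by rewrite powR0 ?powR_ge0// invr_neq0// gt_eqF.
have {}Ipos : (0 < I)%R by rewrite lt_neqAle eq_sym Ipos.
have aI : (0 < I `^ ((p - 1) / p))%R by exact: powR_gt0.
rewrite -(ler_pM2l aI); apply: le_trans IJ.
rewrite -powRD ?(gt_eqF Ipos) ?implybT// -[X in (_ <= X)%R]powRr1 ?(ltW Ipos)//.
by rewrite (_ : ((p - 1) / p + p^-1 = 1)%R)//; field; rewrite gt_eqF.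
Qed.

Lemma poweRVK (x : \bar R) p : (0 < p)%R -> 0 <= x -> x `^ p^-1 `^ p = x.
Proof. by move=> p0 x0; rewrite -poweRrM mulVf ?gt_eqF// poweRe1. Qed.

Lemma poweRKV (x : \bar R) p : (0 < p)%R -> 0 <= x -> x `^ p `^ p^-1 = x.
Proof. by move=> p0 x0; rewrite -poweRrM mulfV ?gt_eqF// poweRe1. Qed.

(** A monotone limit is a supremum, and the power commutes with suprema because it is increasing
    with increasing inverse; infinite values are covered as well. *)
Lemma cvg_poweR_nondecreasing (a : nat -> \bar R) l p : (0 < p)%R ->
  (forall k, 0 <= a k) -> {homo a : k m / (k <= m)%N >-> k <= m} ->
  a k @[k --> \oo] --> l -> a k `^ p @[k --> \oo] --> l `^ p.
Proof.
move=> p0 a0 nda al.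
have lE : l = ereal_sup (range a).
  exact: (cvg_unique _ al (ereal_nondecreasing_cvgn nda)).
have nn (x : \bar R) : 0 <= x -> x \in `[0, +oo] by move=> x0; rewrite in_itv/= x0 leey.
have al' k : a k <= l by rewrite lE; apply: ereal_sup_ubound; exists k.
have l0 : 0 <= l by exact: le_trans (al' 0%N).
have ndp : {homo (fun k => a k `^ p) : k m / (k <= m)%N >-> k <= m}.
  by move=> k m km; apply: gt0_ler_poweR; rewrite ?(ltW p0) ?nn//; exact: nda.
suff -> : l `^ p = ereal_sup (range (fun k => a k `^ p)) by exact: ereal_nondecreasing_cvgn.
set S := ereal_sup _.
have aS k : a k `^ p <= S by apply: ereal_sup_ubound; exists k.
have S0 : 0 <= S by apply: le_trans (aS 0%N); exact: poweR_ge0.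
apply/eqP; rewrite eq_le; apply/andP; split; last first.
  apply: ge_ereal_sup => _ [k _ <-].
  by apply: gt0_ler_poweR; rewrite ?(ltW p0) ?nn//; exact: al'.
rewrite -[leRHS](poweRVK p0 S0).
apply: gt0_ler_poweR; rewrite ?(ltW p0) ?nn ?poweR_ge0//.
rewrite lE; apply: ge_ereal_sup => _ [k _ <-].
rewrite -[leLHS](poweRKV p0 (a0 k)).
by apply: gt0_ler_poweR; rewrite ?invr_ge0 ?(ltW p0) ?nn ?poweR_ge0//; exact: aS.
Qed.

(** Truncations [min f k] increase to [f]; monotone convergence passes through both nested integrals
    and the power between them. *)
Lemma mehler_contract n (p q : R) (c : 'I_n -> R) (f : 'cV[R]_n -> R) :
  (1 < q)%R -> (1 < p)%R -> (forall i, c i ^+ 2 < 1)%R ->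
  (forall i, c i ^+ 2 * (p - 1) <= q - 1)%R ->
  Rn_measurable f -> (forall v, 0 <= f v)%R ->
  iint G (fun z => iint G (fun w => (f (mehler c z w))%:E) `^ p) `^ p^-1 <=
  iint G (fun z => (f z `^ q)%:E) `^ q^-1.
Proof.
move=> q1 p1 c1 hyp mf f0.
have [q0 p0] : (0 < q)%R /\ (0 < p)%R by split; lra.
pose f_ k v := Num.min (f v) k%:R.
have mf_ k : Rn_measurable (f_ k) by exact: measurable_minr.
have fb k v : (0 <= f_ k v <= k%:R)%R by rewrite le_min f0 ler0n ge_min lexx orbT.
have fe k v : 0 <= (f_ k v)%:E by rewrite lee_fin; have /andP[] := fb k v.
have mfe k : Rn_measurableE (fun v => (f_ k v)%:E) by apply/measurable_EFinP; exact: mf_.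
pose M k z := iint G (fun w => (f_ k (mehler c z w))%:E).
have M0 k z : 0 <= M k z by exact: iint_ge0.
have mM k : Rn_measurableE (M k) by apply: (@Rn_measurableE_mehler _ c (fun v => (f_ k v)%:E)).
have mw k z : Rn_measurableE (fun w => (f_ k (mehler c z w))%:E).
  apply/measurable_EFinP; apply: (Rn_measurable_comp (mf_ k)).
  by apply: vmeas_mehler; [exact: vmeas_cst|exact: vmeas_tup2col].
have ndf v : {homo f_^~ v : k l / (k <= l)%N >-> (k <= l)%R}.
  by move=> k l kl; rewrite le_min !ge_min lexx/= ler_nat kl orbT.
have cM z : M k z @[k --> \oo] --> iint G (fun w => (f (mehler c z w))%:E).
  apply: cvg_iint => //.
    by move=> w k l kl; rewrite lee_fin ndf.
  move=> w; apply: cvg_near_cst; near=> k.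
  by rewrite /f_ min_l//; near: k; exact: nbhs_infty_ger.
have ndM z : {homo M^~ z : k l / (k <= l)%N >-> k <= l}.
  by move=> k l kl; apply: le_iint => // w; rewrite lee_fin ndf.
have ci : iint G (fun z => M k z `^ p) @[k --> \oo] -->
    iint G (fun z => iint G (fun w => (f (mehler c z w))%:E) `^ p).
  apply: cvg_iint => //.
  - by move=> k; apply: (measurableT_comp (measurable_poweR p)); exact: mM.
  - by move=> k v; exact: poweR_ge0.
  - move=> v k l kl; apply: gt0_ler_poweR; rewrite ?(ltW p0)//; last exact: ndM.
    by rewrite in_itv/= M0 leey.
    by rewrite in_itv/= M0 leey.
  - by move=> v; apply: cvg_poweR_nondecreasing => //; exact: cM.
have nn (x : \bar R) : 0 <= x -> x \in `[0, +oo] by move=> x0; rewrite in_itv/= x0 leey.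
set J := iint G (fun z => (f z `^ q)%:E).
have J0 : 0 <= J by apply: iint_ge0 => v; rewrite lee_fin powR_ge0.
have bd k : iint G (fun z => M k z `^ p) <= (J `^ q^-1) `^ p.
  have I0 : 0 <= iint G (fun z => M k z `^ p) by apply: iint_ge0 => v; exact: poweR_ge0.
  rewrite -[leLHS](poweRVK p0 I0).
  apply: gt0_ler_poweR; rewrite ?(ltW p0)//; try (apply: nn; exact: poweR_ge0).
  apply: le_trans (mehler_contract_bounded q1 p1 c1 hyp (mf_ k) (fb k)) _.
  apply: gt0_ler_poweR; rewrite ?invr_ge0 ?(ltW q0)//.
  - by apply: nn; apply: iint_ge0 => v; rewrite lee_fin powR_ge0.
  - exact: nn.
  apply: le_iint.
  - by apply/measurable_EFinP; exact: (measurableT_comp (measurable_powR q) (mf_ k)).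
  - by apply/measurable_EFinP; exact: (measurableT_comp (measurable_powR q) mf).
  - by move=> v; rewrite lee_fin powR_ge0.
  - move=> v; rewrite lee_fin ge0_ler_powR ?(ltW q0)// ?nnegrE//; first by have /andP[] := fb k v.
    by rewrite ge_min lexx.
rewrite -[leRHS](poweRKV p0 (poweR_ge0 _ _)).
apply: gt0_ler_poweR; rewrite ?invr_ge0 ?(ltW p0) ?nn ?poweR_ge0//.
  by apply: iint_ge0 => v; exact: poweR_ge0.
by apply: (cvge_to_le ci); apply: nearW => k; exact: bd.
Unshelve. all: by end_near.
Qed.

End tensor.

(** * Real symmetric matrices *)

Section spectral_theorem.
Import complex.
Context {R : realType}.

(** Over the complex numbers the matrix is Hermitian, so its spectral decomposition supplies an
    eigenvalue, and a real one. Being an eigenvalue descends to the real matrix. *)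
Lemma symmetric_eigen n (S : 'M[R]_n.+1) : S^T = S ->
  exists (a : R) (v : 'rV[R]_n.+1), v *m S = a *: v /\ v != 0.
Proof.
move=> symS.
pose f : {rmorphism R -> complex R} := real_complex R.
pose M := map_mx f S.
have hM : M \is hermsymmx.
  apply/is_hermitianmxP; rewrite expr0 scale1r -map_trmx; apply/matrixP => i j.
  rewrite !mxE -[in LHS]symS mxE; apply/esym/CrealP.
  by apply/complex_realP; exists (S j i).
have : exists a, eigenvalue S a.
  have := hermitian_spectral_diag_real hM => /mxOverP/(_ ord0 ord0)/complex_realP[a aE].
  exists a; rewrite -(eigenvalue_map f); apply/eigenvalueP.
  exists (row ord0 (spectralmx M)).
    have /orthomx_spectralP ME := hermitian_normalmx hM.
    have uP := spectral_unit M.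
    rewrite -row_mul [X in _ *m X]ME !mulmxA mulmxV// mul1mx.
    by apply/rowP => j; rewrite mul_diag_mx !mxE aE.
  apply/eqP => r0; have uP := spectral_unit M.
  have : row ord0 (spectralmx M *m invmx (spectralmx M)) = 0 by rewrite row_mul r0 mul0mx.
  rewrite mulmxV// => /rowP/(_ ord0); rewrite !mxE eqxx => /eqP; apply/negP; exact: oner_neq0.
by move=> [a /eigenvalueP[v vS v0]]; exists a, v.
Qed.

Lemma mxnorm_gt0 n (v : 'rV[R]_n) : v != 0 -> 0 < (v *m v^T) ord0 ord0.
Proof.
move=> v0; rewrite mxE lt_neqAle sumr_ge0 => [|i _]; last by rewrite mxE -expr2 sqr_ge0.
rewrite andbT; apply: contra v0 => /eqP/esym/eqP; rewrite psumr_eq0 => [/allP h|i _]; last by rewrite mxE -expr2 sqr_ge0.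
apply/eqP/rowP => i; have /implyP/(_ isT) := h i (mem_index_enum i).
by rewrite mxE -expr2 sqrf_eq0 mxE => /eqP.
Qed.

(** The reflection that exchanges the unit vectors [e] and [v], with mirror orthogonal to
    [u = v - e]. Equal lengths give [e *m u^T = - (k / 2)], where [k] is the squared length of
    [u]. *)
Lemma householder n (v : 'rV[R]_n.+1) : v *m v^T = 1%:M ->
  exists H : 'M[R]_n.+1, [/\ H^T = H, H *m H = 1%:M & delta_mx ord0 ord0 *m H = v].
Proof.
move=> v1; pose e : 'rV[R]_n.+1 := delta_mx ord0 ord0.
have e1 : e *m e^T = 1%:M.
  by rewrite trmx_delta mul_delta_mx; apply/matrixP => i j; rewrite !ord1 !mxE.
have [ve|ve] := eqVneq v e.
  by exists 1%:M; rewrite trmx1 mulmx1 ve mulmx1.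
pose u := v - e; pose k := (u *m u^T) ord0 ord0.
have k0 : 0 < k by apply: mxnorm_gt0; rewrite subr_eq0.
have uu : u *m u^T = k%:M by rewrite [LHS]mx11_scalar.
have eu : e *m u^T = (- (k / 2))%:M.
  pose c := (e *m v^T) ord0 ord0.
  have ev : e *m v^T = c%:M by rewrite [LHS]mx11_scalar.
  have ve' : v *m e^T = c%:M by rewrite -[LHS]trmxK trmx_mul trmxK ev tr_scalar_mx.
  have kE : k = 2 - 2 * c.
    rewrite /k /u linearB/= mulmxBl !mulmxBr v1 e1 ev ve' !mxE eqxx !mulr1n; ring.
  rewrite linearB/= mulmxBr ev e1 -raddfB/= kE; congr (_%:M); by field.
have [T TE] : exists T, T = u^T *m u by exists (u^T *m u).
have TT : T *m T = k *: T.
  by rewrite TE mulmxA -(mulmxA u^T) uu mul_mx_scalar -scalemxAl.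
have eT : e *m T = - (k / 2) *: u by rewrite TE mulmxA eu mul_scalar_mx.
exists (1%:M - (2 / k) *: T); split.
- by rewrite linearB/= linearZ/= trmx1 TE trmx_mul trmxK.
- rewrite mulmxBr mulmx1 mulmxBl mul1mx -scalemxAl -scalemxAr TT !scalerA.
  rewrite (_ : 2 / k * (2 / k) * k = 2 / k + 2 / k); last by field; rewrite gt_eqF.
  by rewrite scalerDl opprB addrK subrK.
- rewrite -/e mulmxBr mulmx1 -scalemxAr eT scalerA.
  rewrite (_ : 2 / k * - (k / 2) = -1); last by field; rewrite gt_eqF.
  by rewrite scaleN1r opprK /u addrC subrK.
Qed.

(* Deflation: a reflection sends a unit eigenvector to the first basis vector. *)
Lemma real_spectral n (S : 'M[R]_n) : S^T = S ->
  exists (O : 'M[R]_n) (d : 'rV[R]_n), O *m O^T = 1%:M /\ S = O^T *m diag_mx d *m O.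
Proof.
elim: n S => [|n IH] S symS.
  by exists 1%:M, 0; split; apply/matrixP => -[].
have [a [v0 [v0S v00]]] := symmetric_eigen symS.
pose k := (v0 *m v0^T) ord0 ord0.
have k0 : 0 < k := mxnorm_gt0 v00.
pose v := (Num.sqrt k)^-1 *: v0.
have v1 : v *m v^T = 1%:M.
  rewrite /v linearZ/= -scalemxAl -scalemxAr scalerA -expr2 exprVn sqr_sqrtr ?(ltW k0)//.
  by rewrite [_ *m _]mx11_scalar -/k scale_scalar_mx mulVf// gt_eqF.
have vS : v *m S = a *: v by rewrite /v -scalemxAl v0S !scalerA mulrC.
have [H [HT HH He]] := householder v1.
pose S1 : 'M[R]_(1 + n) := H *m S *m H.
have SE : S = H *m S1 *m H by rewrite /S1 !mulmxA HH mul1mx -mulmxA HH mulmx1.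
have S1T : S1^T = S1 by rewrite !trmx_mul HT symS mulmxA.
have vH : v *m H = delta_mx ord0 ord0 by rewrite -He -mulmxA HH mulmx1.
have r0 : (delta_mx ord0 ord0 : 'rV[R]_(1 + n)) *m S1 = a *: delta_mx ord0 ord0.
  by rewrite !mulmxA He vS -scalemxAl vH.
clearbody S1.
have S1i j : S1 ord0 j = a * (j == ord0)%:R.
  have := congr1 (fun r : 'rV[R]_(1 + n) => r ord0 j) r0.
  by rewrite -rowE !mxE.
have ur : ursubmx S1 = 0.
  apply/matrixP => i j; rewrite !mxE ord1 (_ : lshift n ord0 = ord0 :> 'I_(1 + n)); last exact: val_inj.
  by rewrite S1i mulr0.
have dl : dlsubmx S1 = 0 by rewrite -[LHS]trmxK trmx_dlsub S1T ur trmx0.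
have ul : ulsubmx S1 = a%:M.
  rewrite [LHS]mx11_scalar !mxE (_ : lshift n ord0 = ord0 :> 'I_(1 + n)); last exact: val_inj.
  by rewrite S1i mulr1.
have S1E : S1 = block_mx a%:M 0 0 (drsubmx S1) by rewrite -[LHS]submxK ur dl ul.
have [|P1 [d1 [PP1 d1E]]] := IH (drsubmx S1); first by rewrite trmx_drsub S1T.
pose P2 : 'M[R]_(1 + n) := block_mx 1%:M 0 0 P1.
have P2T : P2^T = block_mx 1%:M 0 0 P1^T by rewrite tr_block_mx !trmx0 trmx1.
have P2P : P2 *m P2^T = 1%:M.
  by rewrite P2T mulmx_block !mul0mx !mulmx0 !mulmx1 !addr0 !add0r PP1 -scalar_mx_block.
pose d2 : 'rV[R]_(1 + n) := row_mx (a%:M : 'M[R]_1) d1.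
have S1P : S1 = P2^T *m diag_mx d2 *m P2.
  rewrite P2T S1E diag_mx_row !mulmx_block !mul0mx !mulmx0 !mulmx1 !mul1mx !addr0 !add0r -d1E !mul0mx.
  by congr block_mx; rewrite [RHS]mx11_scalar !mxE.
exists (P2 *m H), d2; split.
  by rewrite (trmx_mul P2 H) HT mulmxA -(mulmxA P2) HH mulmx1.
by rewrite SE (trmx_mul P2 H) HT S1P !mulmxA.
Qed.

Definition qform n (S : 'M[R]_n) (x : 'cV[R]_n) : R := (x^T *m S *m x) ord0 ord0.

Lemma qform_conj n (S : 'M[R]_n) (O : 'M[R]_n) x : qform (O^T *m S *m O) x = qform S (O *m x).
Proof. by rewrite /qform trmx_mul !mulmxA. Qed.

Lemma qform_diag n (d : 'rV[R]_n) x : qform (diag_mx d) x = \sum_i d ord0 i * x i ord0 ^+ 2.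
Proof.
rewrite /qform mxE; apply: eq_bigr => i _; rewrite mul_mx_diag !mxE; ring.
Qed.

Lemma qform_diag_delta n (d : 'rV[R]_n) i : qform (diag_mx d) (delta_mx i ord0) = d ord0 i.
Proof.
rewrite qform_diag (bigD1 i)//= big1 => [|j ji]; rewrite mxE ?eqxx ?(negbTE ji)/=; last by rewrite expr0n mulr0.
by rewrite expr1n mulr1 addr0.
Qed.

Lemma diag_mx_mul n (d e : 'rV[R]_n) : diag_mx d *m diag_mx e = diag_mx (\row_i (d ord0 i * e ord0 i)).
Proof.
apply/matrixP => i j; rewrite mul_diag_mx !mxE; case: eqP => [->|_]; first by rewrite !mulr1n.
by rewrite !mulr0n mulr0.
Qed.

Lemma psd_sqrt n (Q : 'M[R]_n) : Q^T = Q -> (forall x, 0 <= qform Q x) ->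
  exists S : 'M[R]_n, [/\ S^T = S, (forall x, 0 <= qform S x) & S *m S = Q].
Proof.
move=> QT Q0; have [P [d [OO QE]]] := real_spectral QT.
have d0 i : 0 <= d ord0 i.
  have := Q0 (P^T *m delta_mx i ord0).
  by rewrite QE qform_conj mulmxA OO mul1mx qform_diag_delta.
pose e : 'rV[R]_n := \row_i Num.sqrt (d ord0 i).
exists (P^T *m diag_mx e *m P); split.
- by rewrite !trmx_mul trmxK tr_diag_mx mulmxA.
- move=> x; rewrite qform_conj qform_diag; apply: sumr_ge0 => i _.
  by rewrite mxE mulr_ge0 ?sqrtr_ge0 ?sqr_ge0.
- rewrite -!mulmxA (mulmxA P P^T) OO mul1mx (mulmxA (diag_mx e) (diag_mx e)) diag_mx_mul QE -mulmxA.
  congr (_ *m (diag_mx _ *m _)); apply/rowP => i; rewrite !mxE -expr2 sqr_sqrtr//.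
Qed.

(** [sqrtm] is a choice with default [0], so its properties rest on the existence of a root. *)
Lemma sqrtmP n (Q : 'M[R]_n) : Q^T = Q -> (forall x, 0 <= qform Q x) ->
  (sqrtm Q)^T = sqrtm Q /\ sqrtm Q *m sqrtm Q = Q.
Proof.
move=> QT Q0; have [S SP] := psd_sqrt QT Q0.
by have [? _ ?] := @xgetPex _ 0 [set S : 'M[R]_n | [/\ S^T = S,
            (forall x : 'cV[R]_n, 0 <= (x^T *m S *m x) 0 0) & S *m S = Q]] (ex_intro _ S SP).
Qed.

Definition posdef n (Q : 'M[R]_n) := Q^T = Q /\ forall x, x != 0 -> 0 < qform Q x.

Lemma posdef_ge0 n (Q : 'M[R]_n) x : posdef Q -> 0 <= qform Q x.
Proof.
move=> [_ Q0]; have [->|/Q0/ltW//] := eqVneq x 0.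
by rewrite /qform mulmx0 mxE.
Qed.

Lemma qform_neq0_unit n (Q : 'M[R]_n) : (forall x, x != 0 -> 0 < qform Q x) -> Q \in unitmx.
Proof.
move=> Q0; rewrite unitmxE unitfE; apply/negP => /det0P[v v0 vQ].
have /Q0 : v^T != 0 by rewrite -(trmx0 _ 1 n) (inj_eq trmx_inj).
by rewrite /qform trmxK vQ mul0mx mxE ltxx.
Qed.

Lemma posdef_cholesky n (Q : 'M[R]_n) : posdef Q -> exists2 C : 'M[R]_n, C \in unitmx & C *m C^T = Q.
Proof.
move=> pQ; have [QT Q0] := pQ.
have [S [ST S0 SS]] := psd_sqrt QT (fun x => posdef_ge0 x pQ).
exists S; last by rewrite ST.
by have := qform_neq0_unit Q0; rewrite -SS unitmx_mul => /andP[].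
Qed.

(** Normalising [Qt] to the identity by [C0] turns [V *m Qs *m V^T] into a symmetric [N] with
    eigenvalues in the interval from [0] to [lam]. An orthogonal diagonalisation of [N] fixes
    [C = C0 *m P^T]; then [V *m A = C *m diag_mx d], with [d] the roots of the eigenvalues, defines
    [A]. *)
Lemma simultaneous_diag n (V Qs Qt : 'M[R]_n) (lam : R) : V \in unitmx -> posdef Qs -> posdef Qt ->
  (forall x, qform (V *m Qs *m V^T) x <= lam * qform Qt x) ->
  exists (A C : 'M[R]_n) (d : 'rV[R]_n), [/\ A \in unitmx /\ C \in unitmx,
    A *m A^T = Qs, C *m C^T = Qt, V *m A = C *m diag_mx d & forall i, d ord0 i ^+ 2 <= lam].
Proof.
move=> uV pQs pQt le; have [[QsT Qs0] [QtT Qt0]] := (pQs, pQt).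
have [C0 uC0 C0E] := posdef_cholesky pQt.
have [W WE] : exists W, W = invmx C0 *m V by exists (invmx C0 *m V).
have uW : W \in unitmx by rewrite WE unitmx_mul unitmx_inv uC0.
pose N := W *m Qs *m W^T.
have NT : N^T = N by rewrite /N trmx_mul trmx_mul trmxK QsT mulmxA.
have Nq x : qform N x = qform Qs (W^T *m x).
  by rewrite -qform_conj trmxK.
have [P [e [OO NE]]] := real_spectral NT.
have OtO : P^T *m P = 1%:M by apply: mulmx1C.
have eE i : e ord0 i = qform N (P^T *m delta_mx i ord0).
  by rewrite NE qform_conj mulmxA OO mul1mx qform_diag_delta.
have dnz (i : 'I_n) : delta_mx i ord0 != 0 :> 'cV[R]_n.
  by apply/eqP => /colP/(_ i); rewrite !mxE !eqxx => /eqP; rewrite oner_eq0.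
have e0 i : 0 < e ord0 i.
  rewrite eE Nq; apply: Qs0; apply/eqP => h; have /eqP := dnz i; apply.
  rewrite -[LHS]mul1mx -OO -mulmxA -[P^T *m _]mul1mx.
  have uWT : W^T \in unitmx by rewrite unitmx_tr.
  by rewrite -(mulVmx uWT) -(mulmxA (invmx _)) h !mulmx0.
have ele i : e ord0 i <= lam.
  rewrite eE; set x := P^T *m _.
  have -> : qform N x = qform (V *m Qs *m V^T) ((invmx C0)^T *m x).
    by rewrite -(qform_conj _ (invmx C0)^T) trmxK /N WE trmx_mul !mulmxA.
  apply: le_trans (le _) _.
  rewrite -(qform_conj _ (invmx C0)^T) trmxK -C0E !mulmxA mulVmx// mul1mx -trmx_mul mulVmx// trmx1.
  by rewrite /qform mulmx1 /x trmx_mul trmxK -mulmxA (mulmxA P) OO mul1mx trmx_delta mul_delta_mx mxE !eqxx mulr1.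
pose d : 'rV[R]_n := \row_i Num.sqrt (e ord0 i).
have dd : diag_mx d *m diag_mx d = diag_mx e.
  by rewrite diag_mx_mul; congr diag_mx; apply/rowP => i; rewrite !mxE -expr2 sqr_sqrtr// ltW.
have ud : diag_mx d \in unitmx.
  rewrite unitmxE det_diag unitfE; apply/prodf_neq0 => i _.
  by rewrite mxE gt_eqF// sqrtr_gt0.
have uO : P^T \in unitmx by case: (mulmx1_unit OtO).
exists (invmx V *m (C0 *m P^T) *m diag_mx d), (C0 *m P^T), d; split.
- by rewrite !unitmx_mul unitmx_inv uV uC0 uO ud.
- have -> : invmx V *m (C0 *m P^T) *m diag_mx d *m (invmx V *m (C0 *m P^T) *m diag_mx d)^T =
      invmx V *m C0 *m N *m (invmx V *m C0)^T.
    rewrite NE -dd !(trmx_mul _ (diag_mx d)) !(trmx_mul _ (C0 *m _)) !(trmx_mul _ P^T) trmxK tr_diag_mx.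
    by rewrite (trmx_mul _ C0) !mulmxA.
  rewrite /N WE !trmx_mul -!mulmxA (mulmxA C0 (invmx C0)) mulmxV// mul1mx (mulmxA (invmx V) V) mulVmx// mul1mx.
  rewrite (mulmxA _^T C0^T) -trmx_mul mulmxV// trmx1 mul1mx -trmx_mul mulVmx// trmx1 mulmx1//.
- by rewrite trmx_mul trmxK -mulmxA (mulmxA P^T) OtO mul1mx.
- by rewrite !mulmxA mulmxV// mul1mx.
- by move=> i; rewrite mxE sqr_sqrtr ?(ltW (e0 i)).
Qed.

End spectral_theorem.

(** * Contraction between two nondegenerate Gaussian measures *)

Section gaussian_contraction.
Context {R : realType}.
Notation G := (@nrm R 0 1).
Local Open Scope ereal_scope.

(** If both parts are infinite then so is [c], and the value given to the difference is harmless. *)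
Lemma abse_sub_le (a b c : \bar R) : 0 <= a -> 0 <= b -> a <= c -> b <= c -> `|a - b| <= c.
Proof.
move: a b c => [a| |] [b| |] [c| |] //=; rewrite ?leey// !lee_fin => a0 b0 ac bc.
rewrite ler_norml; apply/andP; split; lra.
Qed.

Lemma measurable_gint_affine n (V E Q : 'M[R]_n) (g : 'cV[R]_n) (F : 'cV[R]_n -> \bar R) :
  E \in unitmx -> E *m E^T = Q -> Rn_measurableE F -> (forall v, 0 <= F v) ->
  Rn_measurableE (fun x => gint (V *m x + g)%R Q F).
Proof.
move=> uE EQ mF F0.
rewrite (_ : (fun x => _) = fun x => iint G (fun w => F (E *m w + (V *m x + g))%R)); last first.
  by apply/funext => x; rewrite (gint_iint _ uE EQ).
apply: (@measurable_iint _ _ _ _ n (fun (t : n.-tuple R) w => F (E *m w + (V *m tup2col t + g))%R)) => //.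
apply: (Rn_measurableE_comp mF); apply: vmeas_add.
  by apply: vmeas_mul; exact: (vmeas_comp measurable_snd (@vmeas_tup2col R n)).
apply: vmeas_add; last exact: vmeas_cst.
by apply: vmeas_mul; exact: (vmeas_comp measurable_fst (@vmeas_tup2col R n)).
Qed.

(** In the coordinates [A *m z + ms] at the source and [C *m z + mt] at the target both measures are
    standard and the transition is [mehler] with the coefficients [d]. *)
Lemma gauss_contract n (V Qs Qt Qd : 'M[R]_n) (ms mt g : 'cV[R]_n) (p q lam : R) (phi : 'cV[R]_n -> R) :
  (1 < q)%R -> (1 < p)%R -> (lam < 1)%R -> (lam * (p - 1) <= q - 1)%R ->
  V \in unitmx -> posdef Qs -> posdef Qt ->
  (forall x, qform (V *m Qs *m V^T) x <= lam * qform Qt x)%R ->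
  Qt = (Qd + V *m Qs *m V^T)%R -> mt = (g + V *m ms)%R -> Rn_measurable phi ->
  let P x := gintS (V *m x + g)%R Qd phi in
  Rn_measurableE P /\
  gaussLnorm p ms Qs P <= gaussLnorm q mt Qt (fun y => (phi y)%:E).
Proof.
move=> q1 p1 lam1 lampq uV pQs pQt le QtE mtE mphi P.
have [q0 p0] : (0 < q)%R /\ (0 < p)%R by split; lra.
have [A [C [d [[uA uC] AE CE VA dlam]]]] := simultaneous_diag uV pQs pQt le.
have d1 i : (d ord0 i ^+ 2 < 1)%R by exact: le_lt_trans (dlam i) _.
pose d' : 'rV[R]_n := \row_i Num.sqrt (1 - d ord0 i ^+ 2)%R.
pose E := C *m diag_mx d'.
have uE : E \in unitmx.
  rewrite unitmx_mul uC unitmxE det_diag unitfE; apply/prodf_neq0 => i _.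
  by rewrite mxE gt_eqF// sqrtr_gt0 subr_gt0.
(* [Qd] is the difference [Qt - V *m Qs *m V^T], which is diagonal in the coordinates of [C] with
   entries [1 - d i ^+ 2]; these are positive because [lam < 1]. *)
have EE : E *m E^T = Qd.
  have -> : Qd = (Qt - V *m Qs *m V^T)%R by rewrite QtE addrK.
  rewrite -AE !mulmxA VA -mulmxA -trmx_mul VA -CE !trmx_mul !tr_diag_mx !mulmxA.
  rewrite /E -!(mulmxA C (diag_mx _)) !diag_mx_mul -mulmxBl -[X in (X - _)%R]mulmx1 -mulmxBr; congr (C *m _ *m _).
  apply/matrixP => i j; rewrite !mxE -!expr2 sqr_sqrtr ?subr_ge0 ?(ltW (d1 _))//.
  by case: eqP => [_|_]; rewrite ?mulr1n ?mulr0n ?subr0.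
pose fp y := (Num.max (phi y) 0)%:E; pose fm y := (Num.max (- phi y) 0)%:E.
have mfp : Rn_measurableE fp by apply/measurable_EFinP; exact: measurable_maxr.
have mfm : Rn_measurableE fm.
  apply/measurable_EFinP; apply: measurable_maxr => //.
  by apply: measurableT_comp => //.
have fp0 y : 0 <= fp y by rewrite lee_fin le_max lexx orbT.
have fm0 y : 0 <= fm y by rewrite lee_fin le_max lexx orbT.
have mP : Rn_measurableE P.
  by apply: emeasurable_funB; exact: (measurable_gint_affine V g uE EE).
split=> //.
pose psi z := `|phi (C *m z + mt)|%R.
have mpsi : Rn_measurable psi.
  apply: measurableT_comp => //; apply: (Rn_measurable_comp mphi).
  by apply: vmeas_add; [apply: vmeas_mul; exact: vmeas_tup2col|exact: vmeas_cst].
have psi0 z : (0 <= psi z)%R by exact: normr_ge0.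
pose c i := d ord0 i.
have meanE z w : (E *m w + (V *m (A *m z + ms) + g) = C *m mehler c z w + mt)%R.
  have <- : (E *m w + C *m diag_mx d *m z = C *m mehler c z w)%R.
    rewrite /E -!mulmxA -mulmxDr; congr (_ *m _); apply/colP => i.
    by rewrite !mul_diag_mx !mxE addrC.
  by rewrite mtE mulmxDr (mulmxA V) VA (addrC g) !addrA.
have cond i : (c i ^+ 2 * (p - 1) <= q - 1)%R.
  by apply: le_trans lampq; apply: ler_wpM2r => //; rewrite subr_ge0 ltW.
have nn (x : \bar R) : 0 <= x -> x \in `[0, +oo] by move=> x0; rewrite in_itv/= x0 leey.
rewrite /gaussLnorm (gint_iint _ uC CE); last 2 first.
- by apply: (measurableT_comp (measurable_poweR q)); apply: measurableT_comp => //; exact/measurable_EFinP.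
- by move=> v; exact: poweR_ge0.
rewrite (gint_iint _ uA AE); last 2 first.
- by apply: (measurableT_comp (measurable_poweR p)); exact: measurableT_comp.
- by move=> v; exact: poweR_ge0.
apply: le_trans (mehler_contract q1 p1 d1 cond mpsi psi0).
apply: gt0_ler_poweR.
- by rewrite invr_ge0 ltW.
- by apply: nn; apply: iint_ge0 => v; exact: poweR_ge0.
- by apply: nn; apply: iint_ge0 => v; exact: poweR_ge0.
have mA : Rn_measurableE (fun z => `|P (A *m z + ms)%R|).
  exact: (measurableT_comp (@abse_measurable R setT) (Rn_measurableE_lin A ms mP)).
have mpsiE : Rn_measurableE (fun v => (psi v)%:E) by exact/measurable_EFinP.
apply: le_iint.
- exact: (measurableT_comp (measurable_poweR p) mA).
- apply: (measurableT_comp (measurable_poweR p)).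
  by apply: (@Rn_measurableE_mehler _ _ c (fun v => (psi v)%:E)).
- by move=> v; exact: poweR_ge0.
move=> z; apply: gt0_ler_poweR; first exact: ltW.
- exact: nn.
- by apply: nn; apply: iint_ge0 => w; rewrite lee_fin psi0.
(* The positive and the negative part of [phi] are each dominated by its absolute value, which
   bounds the modulus of [P] by the image of [psi]. *)
have le1 (F : 'cV[R]_n -> \bar R) : Rn_measurableE F -> (forall y, 0 <= F y) ->
    (forall y, F y <= `|phi y|%:E) ->
    gint (V *m (A *m z + ms) + g)%R Qd F <= iint G (fun w => (psi (mehler c z w))%:E).
  move=> mF F0 Fle; rewrite (gint_iint _ uE EE)//; apply: le_iint => //.
  - by apply: (Rn_measurableE_lin E (V *m (A *m z + ms) + g)%R).
  - apply: (Rn_measurableE_comp mpsiE).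
    by apply: vmeas_mehler; [exact: vmeas_cst|exact: vmeas_tup2col].
  - by move=> w; rewrite meanE; exact: Fle.
apply: abse_sub_le.
- by rewrite (gint_iint _ uE EE mfp fp0); apply: iint_ge0 => w; exact: fp0.
- by rewrite (gint_iint _ uE EE mfm fm0); apply: iint_ge0 => w; exact: fm0.
- by apply: le1 => // y; rewrite lee_fin ge_max ler_norm normr_ge0.
- by apply: le1 => // y; rewrite lee_fin ge_max normr_ge0 -normrN ler_norm.
Qed.

End gaussian_contraction.

(** * The evolution operator and its covariances *)

Section operator_norm.
Context {R : realType}.

Lemma enorm_ge0 n (x : 'cV[R]_n) : 0 <= enorm x.
Proof. exact: sqrtr_ge0. Qed.

Lemma sqr_enorm n (x : 'cV[R]_n) : enorm x ^+ 2 = \sum_i x i 0 ^+ 2.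
Proof. by rewrite sqr_sqrtr// sumr_ge0// => i _; rewrite sqr_ge0. Qed.

Lemma sqr_enormE n (x : 'cV[R]_n) : enorm x ^+ 2 = (x^T *m x) ord0 ord0.
Proof. by rewrite sqr_enorm mxE; apply: eq_bigr => i _; rewrite mxE expr2. Qed.

Lemma le_coord_enorm n (x : 'cV[R]_n) i : `|x i 0| <= enorm x.
Proof.
rewrite -(ler_pXn2r (ltn0Sn 1)) ?nnegrE ?enorm_ge0// sqr_enorm real_normK ?num_real//.
by rewrite (bigD1 i)//= lerDl sumr_ge0// => j _; rewrite sqr_ge0.
Qed.

Lemma enorm_le_sum n (x : 'cV[R]_n) : enorm x <= \sum_i `|x i 0|.
Proof.
have s0 : 0 <= \sum_i `|x i 0| by exact: sumr_ge0.
rewrite -(ler_pXn2r (ltn0Sn 1)) ?nnegrE ?enorm_ge0// sqr_enorm [leRHS]expr2 mulr_suml.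
apply: ler_sum => i _; rewrite -(real_normK (num_real _)) expr2 ler_wpM2l//.
by rewrite (bigD1 i)//= lerDl sumr_ge0.
Qed.

Lemma enormZ n k (x : 'cV[R]_n) : enorm (k *: x) = `|k| * enorm x.
Proof.
apply/eqP; rewrite -(eqrXn2 (ltn0Sn 1)) ?mulr_ge0 ?enorm_ge0// exprMn !sqr_enorm.
rewrite mulr_sumr; apply/eqP; apply: eq_bigr => i _.
by rewrite mxE exprMn real_normK ?num_real.
Qed.

Lemma enorm_eq0 n (x : 'cV[R]_n) : enorm x = 0 -> x = 0.
Proof.
move=> x0; apply/colP => i; rewrite mxE; apply/eqP; rewrite -normr_le0 -x0.
exact: le_coord_enorm.
Qed.

(** The supremum is meaningful once the set is bounded; the sum of the absolute entries is a
    bound. *)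
Lemma enorm_le_opnorm n (M : 'M[R]_n) x : enorm x <= 1 -> enorm (M *m x) <= opnorm M.
Proof.
move=> x1; apply: ub_le_sup; last by exists x.
exists (\sum_i \sum_j `|M i j|) => _ [y y1 <-].
apply: (le_trans (enorm_le_sum _)); apply: ler_sum => i _; rewrite mxE.
apply: (le_trans (ler_norm_sum _ _ _)); apply: ler_sum => j _; rewrite normrM.
by rewrite ler_piMr// (le_trans (le_coord_enorm _ _)).
Qed.

Lemma opnorm_ge0 n (M : 'M[R]_n) : 0 <= opnorm M.
Proof.
apply: le_trans (enorm_le_opnorm M (x := 0) _); first exact: enorm_ge0.
by rewrite -(scale0r 0) enormZ normr0 mul0r.
Qed.

Lemma opnormP n (M : 'M[R]_n) x : enorm (M *m x) <= opnorm M * enorm x.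
Proof.
have [x0|x0] := eqVneq (enorm x) 0.
  by rewrite (enorm_eq0 x0) mulmx0 -{1}(scale0r 0) enormZ normr0 mul0r mulr_ge0 ?opnorm_ge0 ?enorm_ge0.
have {}x0 : 0 < enorm x by rewrite lt_neqAle eq_sym x0 enorm_ge0.
rewrite -ler_pdivrMr// mulrC.
have -> : (enorm x)^-1 * enorm (M *m x) = enorm (M *m ((enorm x)^-1 *: x)).
  by rewrite -scalemxAr enormZ ger0_norm// invr_ge0 ltW.
by apply: enorm_le_opnorm; rewrite enormZ ger0_norm ?invr_ge0 ?(ltW x0)// mulVf// gt_eqF.
Qed.

Lemma entry_le_opnorm n (M : 'M[R]_n) i j : `|M i j| <= opnorm M.
Proof.
have -> : M i j = (M *m (delta_mx j 0 : 'cV[R]_n)) i 0 by rewrite -colE mxE.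
apply: (le_trans (le_coord_enorm _ _)); apply: enorm_le_opnorm.
rewrite -(ler_pXn2r (ltn0Sn 1)) ?nnegrE ?enorm_ge0// sqr_enorm expr1n.
rewrite (bigD1 j)//= big1 => [|k kj]; rewrite mxE ?eqxx ?(negbTE kj)/= ?expr0n//.
Qed.

End operator_norm.

(** * Uniqueness for linear differential equations *)

Section linear_ode.
Context {R : realType} (n : nat) (A : R -> 'M[R]_n) (K : R).
Hypothesis bA : forall r i j, `|A r i j| <= K.

Lemma energy_term_le (k a x y : R) : 0 <= a <= k -> 0 <= x -> 0 <= y ->
  2 * (a * x) * y <= k * (x ^+ 2 + y ^+ 2).
Proof.
move=> /andP[a0 ak] x0 y0; apply: (@le_trans _ _ (2 * (k * x) * y)).
  by rewrite ler_wpM2r// ler_wpM2l// ler_wpM2r.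
have : 0 <= k * (x - y) ^+ 2 by rewrite mulr_ge0 ?sqr_ge0// (le_trans a0).
by nra.
Qed.

(* The energy [sum W_ij^2] satisfies [|e'| <= 2 n K e], hence [e = 0] on both sides of a zero. *)
Lemma ode_uniqueness m (W : R -> 'M[R]_(n, m)) r :
  (forall t i j, is_derive t (1 : R) (fun tau => W tau i j) ((A t *m W t) i j)) ->
  W r = 0 -> forall t, W t = 0.
Proof.
move=> dW W0.
pose e t := \sum_i \sum_j W t i j ^+ 2.
pose de t := \sum_i \sum_j (2 * (A t *m W t) i j * W t i j).
have e0 t : 0 <= e t by apply: sumr_ge0 => i _; apply: sumr_ge0 => j _; rewrite sqr_ge0.
have dij t i j : is_derive t (1 : R) (fun tau => W tau i j ^+ 2) (2 * (A t *m W t) i j * W t i j).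
  have H : is_derive t (1 : R) (fun tau => W tau i j ^+ 2) _ := is_deriveX 2 (dW t i j).
  apply: (is_derive_eq H); rewrite expr1 /GRing.scale/=; ring.
have de' t : is_derive t (1 : R) e (de t).
  have -> : e = \sum_i \sum_j (fun tau => W tau i j ^+ 2).
    by apply/funext => tau; rewrite fct_sumE; apply: eq_bigr => i _; rewrite fct_sumE.
  by apply: is_derive_sum => i; apply: is_derive_sum => j; exact: dij.
pose c := K * n%:R.
have K0 (i : 'I_n) : 0 <= K by exact: le_trans (bA 0 i i).
have deb t : `|de t| <= 2 * c * e t.
  rewrite /de; apply: (le_trans (ler_norm_sum _ _ _)).
  apply: (@le_trans _ _ (\sum_i \sum_j \sum_k (K * (W t k j ^+ 2 + W t i j ^+ 2)))).
    apply: ler_sum => i _; apply: (le_trans (ler_norm_sum _ _ _)); apply: ler_sum => j _.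
    rewrite mxE mulr_sumr mulr_suml; apply: (le_trans (ler_norm_sum _ _ _)); apply: ler_sum => k _.
    rewrite !normrM ger0_norm//.
    rewrite -(real_normK (num_real (W t k j))) -(real_normK (num_real (W t i j))).
    by apply: energy_term_le => //; rewrite normr_ge0 bA.
  rewrite (_ : \sum_i \sum_j \sum_k _ = 2 * c * e t)//.
  have -> : \sum_i \sum_j \sum_k (K * (W t k j ^+ 2 + W t i j ^+ 2)) =
      \sum_(i < n) (K * e t) + \sum_i \sum_j \sum_(k < n) (K * W t i j ^+ 2).
    rewrite -big_split/=; apply: eq_bigr => i _.
    have -> : e t = \sum_j \sum_k W t k j ^+ 2 by rewrite /e exchange_big.
    rewrite mulr_sumr -big_split/=; apply: eq_bigr => j _.
    rewrite mulr_sumr -big_split/=; apply: eq_bigr => k _; ring.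
  have -> : \sum_i \sum_j \sum_(k < n) (K * W t i j ^+ 2) = c * e t.
    rewrite /e /c mulr_sumr; apply: eq_bigr => i _; rewrite mulr_sumr; apply: eq_bigr => j _.
    by rewrite sumr_const card_ord -[LHS]mulr_natr; ring.
  by rewrite sumr_const card_ord -[X in X + _]mulr_natr /c; ring.
have er : e r = 0.
  by rewrite /e W0; apply: big1 => i _; apply: big1 => j _; rewrite mxE expr0n.
(* With [s = 2 * c] the product is nondecreasing, which treats the times before [r]; with
   [s = - (2 * c)] it is nonincreasing, which treats those after. *)
pose E s t := e t * expR (s * t).
have dE s t : is_derive t (1 : R) (E s) ((de t + s * e t) * expR (s * t)).
  have H1 : is_derive t (1 : R) (fun t => expR (s * t)) (s * expR (s * t)).
    have H2 : is_derive t (1 : R) (fun t => s * t) s.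
      have := is_deriveZ s (@is_derive_id _ _ t (1 : R)).
      by move=> H; apply: (is_derive_eq H); rewrite /GRing.scale/= mulr1.
    have := @is_derive1_comp _ expR (fun t => s * t) t _ _ (is_derive_expR _) H2.
    by move=> H; apply: (is_derive_eq H); rewrite mulrC.
  have := is_deriveM (de' t) H1.
  move=> H; apply: (is_derive_eq H); rewrite /GRing.scale/=; ring.
have et0 t : e t = 0.
  have [tr|rt] := leP t r.
    have := @derive_ge0_le_cc _ (E (2 * c)) _ t r tr (fun x _ => dE (2 * c) x).
    rewrite /E er mul0r => H; apply/eqP; rewrite eq_le e0 andbT.
    rewrite -(pmulr_lle0 _ (expR_gt0 (2 * c * t))); apply: H => x _.
    rewrite mulr_ge0 ?expR_ge0//; have := deb x; rewrite ler_norml => /andP[+ _].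
    by rewrite -[X in _ -> X <= _](addNr (2 * c * e x)) lerD2r.
  have := @derive_ge0_le_cc _ (- E (- (2 * c))) _ r t (ltW rt) (fun x _ => is_deriveN (dE (- (2 * c)) x)).
  rewrite /E !fctE er mul0r oppr0 oppr_ge0 => H; apply/eqP; rewrite eq_le e0 andbT.
  rewrite -(pmulr_lle0 _ (expR_gt0 (- (2 * c) * t))); apply: H => x _.
  rewrite -mulNr mulr_ge0 ?expR_ge0//; have := deb x; rewrite ler_norml => /andP[_].
  by rewrite opprD mulNr opprK addrC subr_ge0.
move=> t; apply/matrixP => i j; rewrite mxE; apply/eqP; rewrite -sqrf_eq0 eq_le sqr_ge0 andbT -(et0 t).
rewrite /e (bigD1 i)//= (bigD1 j)//= -addrA lerDl addr_ge0//; first by apply: sumr_ge0 => ? _; rewrite sqr_ge0.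
by apply: sumr_ge0 => ? _; apply: sumr_ge0 => ? _; rewrite sqr_ge0.
Qed.

End linear_ode.

(** * Continuity and integration of matrix-valued functions *)

Section matrix_functions.
Context {R : realType}.
Notation mu := (@lebesgue_measure R).

Lemma continuous_at_sumf (I : finType) (F : I -> R -> R) x :
  (forall i, {for x, continuous (F i)}) -> {for x, continuous (fun r => \sum_i F i r)}.
Proof.
move=> cF; rewrite (_ : (fun r => _) = \sum_i F i); last by apply/funext => r; rewrite fct_sumE.
apply: (big_ind (fun f : R -> R => {for x, continuous f})) => //.
- exact: cvg_cst.
- by move=> f g cf cg; apply: cvgD; [exact: cf|exact: cg].
Qed.

Lemma continuous_sumf (I : finType) (F : I -> R -> R) :
  (forall i, continuous (F i)) -> continuous (fun r => \sum_i F i r).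
Proof. by move=> cF x; apply: continuous_at_sumf => i; exact: cF. Qed.

Definition mxcont m k (F : R -> 'M[R]_(m, k)) := forall i j, continuous (fun r => F r i j).

Lemma mxcont_mul m k l (F : R -> 'M[R]_(m, k)) (G : R -> 'M[R]_(k, l)) :
  mxcont F -> mxcont G -> mxcont (fun r => F r *m G r).
Proof.
move=> cF cG i j; under eq_fun do rewrite mxE.
by apply: continuous_sumf => u x; apply: cvgM; [exact: cF|exact: cG].
Qed.

Lemma mxcont_cst m k (M : 'M[R]_(m, k)) : mxcont (fun=> M).
Proof. by move=> i j x; exact: cvg_cst. Qed.

Lemma mxcont_tr m k (F : R -> 'M[R]_(m, k)) : mxcont F -> mxcont (fun r => (F r)^T).
Proof. by move=> cF i j; under eq_fun do rewrite mxE; exact: cF. Qed.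

Definition mxint (D : set R) m k (F : R -> 'M[R]_(m, k)) : 'M[R]_(m, k) :=
  \matrix_(i, j) \int[mu]_(r in D) F r i j.

Definition mxintegrable (D : set R) m k (F : R -> 'M[R]_(m, k)) :=
  forall i j, mu.-integrable D (EFin \o (fun r => F r i j)).

Lemma integrable_sumf (D : set R) (I : finType) (F : I -> R -> R) : measurable D ->
  (forall i, mu.-integrable D (EFin \o F i)) ->
  mu.-integrable D (EFin \o (fun r => \sum_i F i r)) /\
  \int[mu]_(r in D) (\sum_i F i r) = \sum_i \int[mu]_(r in D) F i r.
Proof.
move=> mD iF.
have E : EFin \o (fun r => \sum_i F i r) = (fun r => \sum_i (EFin \o F i) r)%E.
  by apply/funext => r /=; rewrite sumEFin.
split; first by rewrite E; apply: integrable_sum.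
rewrite /Rintegral (_ : (fun r => (\sum_i F i r)%:E) = (fun r => \sum_i (EFin \o F i) r)%E)//.
rewrite integral_sum// sum_fine// => i _.
by apply: (integrable_fin_num _ (iF i)).
Qed.

Lemma mxint_mull (D : set R) m k l (M : 'M[R]_(l, m)) (F : R -> 'M[R]_(m, k)) : measurable D ->
  mxintegrable D F ->
  mxintegrable D (fun r => M *m F r) /\ mxint D (fun r => M *m F r) = M *m mxint D F.
Proof.
move=> mD iF.
have iMF i j u : mu.-integrable D (EFin \o (fun r => M i u * F r u j)).
  rewrite (_ : _ \o _ = (fun r => (M i u)%:E * (EFin \o (fun r => F r u j)) r)%E).
    exact: integrableZl.
  by apply/funext => r /=; rewrite EFinM.
split=> [i j|].
  have [+ _] := @integrable_sumf D _ (fun u r => M i u * F r u j) mD (iMF i j).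
  by congr (mu.-integrable D _); apply/funext => r /=; rewrite mxE.
apply/matrixP => i j; rewrite !mxE.
under eq_Rintegral do rewrite mxE.
have [_ ->] := @integrable_sumf D _ (fun u r => M i u * F r u j) mD (iMF i j).
by apply: eq_bigr => u _; rewrite mxE RintegralZl.
Qed.

Lemma mxint_tr (D : set R) m k (F : R -> 'M[R]_(m, k)) :
  mxint D (fun r => (F r)^T) = (mxint D F)^T.
Proof. by apply/matrixP => i j; rewrite !mxE; under eq_Rintegral do rewrite mxE. Qed.

Lemma mxintegrable_tr (D : set R) m k (F : R -> 'M[R]_(m, k)) :
  mxintegrable D F -> mxintegrable D (fun r => (F r)^T).
Proof. by move=> iF i j; under eq_fun do rewrite mxE; exact: iF. Qed.

Lemma mxint_mulr (D : set R) m k l (F : R -> 'M[R]_(m, k)) (N : 'M[R]_(k, l)) : measurable D ->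
  mxintegrable D F ->
  mxintegrable D (fun r => F r *m N) /\ mxint D (fun r => F r *m N) = mxint D F *m N.
Proof.
move=> mD iF; have [i1 e1] := mxint_mull N^T mD (mxintegrable_tr iF).
have E : (fun r => F r *m N) = (fun r => (N^T *m (F r)^T)^T).
  by apply/funext => r; rewrite trmx_mul !trmxK.
rewrite E; split; first exact: mxintegrable_tr.
by rewrite mxint_tr e1 mxint_tr trmx_mul !trmxK.
Qed.

Lemma mxint_conj (D : set R) m k l h (M : 'M[R]_(l, m)) (F : R -> 'M[R]_(m, k)) (N : 'M[R]_(k, h)) :
  measurable D -> mxintegrable D F ->
  mxintegrable D (fun r => M *m F r *m N) /\ mxint D (fun r => M *m F r *m N) = M *m mxint D F *m N.
Proof.
move=> mD iF; have [i1 e1] := mxint_mull M mD iF; have [i2 e2] := mxint_mulr N mD i1.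
by rewrite e2 e1.
Qed.

Lemma eq_mxint (D : set R) m k (F G : R -> 'M[R]_(m, k)) : (forall r, D r -> F r = G r) ->
  mxint D F = mxint D G.
Proof.
move=> FG; apply/matrixP => i j; rewrite !mxE; apply: eq_Rintegral => r /[!inE] Dr.
by rewrite FG.
Qed.

Lemma mxint_split m k (F : R -> 'M[R]_(m, k)) s t : s <= t -> mxintegrable `]-oo, t] F ->
  mxint `]-oo, t] F = mxint `[s, t] F + mxint `]-oo, s] F.
Proof.
move=> st iF; apply/matrixP => i j; rewrite !mxE.
have := Rintegral_itvB (iF i j) (_ : (-oo <= BRight s)%O) (_ : (BRight s <= BRight t)%O).
rewrite Rintegral_itv_obnd_cbnd.
  by move=> <-//; rewrite subrK.
apply: integrableS (iF i j) => //.
by apply: subset_itvr; rewrite bnd_simp.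
Qed.

Lemma qform_mxint (D : set R) m (F : R -> 'M[R]_m) x : measurable D -> mxintegrable D F ->
  qform (mxint D F) x = \int[mu]_(r in D) qform (F r) x.
Proof.
move=> mD iF; have [_ e] := mxint_conj x^T x mD iF.
by rewrite /qform -e mxE.
Qed.

(** Up to the factor [k^-1] this is the exponential density of rate [k = - om] evaluated at [T - r],
    whose total mass is one. *)
Lemma expR_decay_integrable (om T : R) : om < 0 ->
  mu.-integrable `]-oo, T] (EFin \o (fun r => expR (om * (T - r)))).
Proof.
move=> om0; pose k := - om; have k0 : 0 < k by rewrite oppr_gt0.
pose g r := exponential_pdf k (-1 * r + T).
have mg : measurable_fun setT g.
  by apply: (measurableT_comp (measurable_exponential_pdf k)); mfun.
have g0 r : 0 <= g r by apply: exponential_pdf_ge0; exact: ltW.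
have ig : mu.-integrable setT (EFin \o g).
  apply/integrableP; split; first exact/measurable_EFinP.
  under eq_integral do rewrite /= ger0_norm//.
  rewrite (@integral_lebE R (EFin \o g)); [|exact/measurable_EFinP|by move=> r; rewrite lee_fin].
  have := @integral_affine R (-1) T (EFin \o exponential_pdf k).
  rewrite normrN normr1 mul1e => <-; rewrite ?oppr_eq0 ?oner_eq0//.
  - rewrite -integral_lebE.
    + by rewrite integral_exponential_pdf// ltry.
    + by apply/measurable_EFinP; exact: measurable_exponential_pdf.
    + by move=> r; rewrite lee_fin exponential_pdf_ge0// ltW.
  - by apply/measurable_EFinP; exact: measurable_exponential_pdf.
  - by move=> r; rewrite lee_fin exponential_pdf_ge0// ltW.
have ikg : mu.-integrable `]-oo, T] (fun r => (k^-1)%:E * (EFin \o g) r)%E.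
  by apply: integrableZl => //; apply: integrableS ig.
apply: le_integrable ikg => //.
  apply/measurable_EFinP; apply: measurable_funTS; mfun.
move=> r /=; rewrite in_itv/= => rT; rewrite lee_fin.
rewrite /g exponential_pdfE; last lra.
rewrite mulrA mulVf ?gt_eqF// mul1r.
by rewrite (_ : - k * (-1 * r + T) = om * (T - r))//; rewrite /k; ring.
Qed.

Lemma decay_integrable (g : R -> R) (om T C : R) : om < 0 -> continuous g ->
  (forall r, r <= T -> `|g r| <= C * expR (om * (T - r))) ->
  mu.-integrable `]-oo, T] (EFin \o g).
Proof.
move=> om0 cg gb.
have iC : mu.-integrable `]-oo, T] (fun r => C%:E * (EFin \o (fun r => expR (om * (T - r)))) r)%E.
  by apply: integrableZl => //; exact: expR_decay_integrable.
apply: le_integrable iC => //.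
  by apply/measurable_EFinP; apply: measurable_funTS; exact: continuous_measurable_fun.
move=> r /=; rewrite in_itv/= => rT; rewrite lee_fin.
exact: le_trans (gb r rT) (ler_norm _).
Qed.

End matrix_functions.

(** * Covariances along the evolution family *)

Section evolution.
Context {R : realType} (n : nat) (A B : R -> 'M[R]_n) (f : R -> 'cV[R]_n) (U : R -> R -> 'M[R]_n).
Context (KA KB Kf mu0 om M : R).
Context (bA : forall r, opnorm (A r) <= KA) (bB : forall r, opnorm (B r) <= KB)
  (bf : forall r, enorm (f r) <= Kf)
  (cB : mxcont B) (cf : forall i, continuous (fun r => f r i 0))
  (mu0_gt0 : 0 < mu0) (coerB : forall r x, mu0 * enorm x <= enorm (B r *m x))
  (evU : is_evolution_operator A U) (om_lt0 : om < 0)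
  (decU : forall s r, s <= r -> opnorm (U r s) <= M * expR (om * (r - s))).
Notation mu := (@lebesgue_measure R).

Lemma evol_id s : U s s = 1%:M. Proof. by have [] := evU s. Qed.

Lemma evol_derive s t i j : is_derive t (1 : R) (fun tau => U tau s i j) ((A t *m U t s) i j).
Proof. by have [_] := evU s; apply. Qed.

(** Both sides solve the same linear equation in the first time and agree at [r]. *)
Lemma evol_comp t r s : U t r *m U r s = U t s.
Proof.
apply/eqP; rewrite -subr_eq0; apply/eqP.
pose W tau := U tau r *m U r s - U tau s.
apply: (@ode_uniqueness R n A KA _ n W r) => [u i j|u i j|].
- exact: le_trans (entry_le_opnorm _ _ _) (bA _).
- have H1 : is_derive u (1 : R) (\sum_k (fun tau => U tau r i k * U r s k j))
      (\sum_k (A u *m U u r) i k * U r s k j).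
    apply: is_derive_sum => k.
    have H : is_derive u (1 : R) (fun tau => U tau r i k * U r s k j) _ :=
      is_deriveM (evol_derive r u i k) (is_derive_cst (U r s k j) u (1 : R)).
    by apply: (is_derive_eq H); rewrite scaler0 add0r /GRing.scale/= mulrC.
  have H2 := is_deriveB H1 (evol_derive s u i j).
  rewrite (_ : (fun tau => W tau i j) = (\sum_k (fun tau => U tau r i k * U r s k j)) - (fun tau => U tau s i j)).
    by apply: (is_derive_eq H2); rewrite /W mulmxBr !mulmxA [RHS]mxE [in RHS]mxE [in RHS]mxE mxE.
  apply/funext => tau.
  rewrite -[RHS]/((\sum_k (fun tau => U tau r i k * U r s k j)) tau - U tau s i j) fct_sumE.
  by rewrite /W !mxE.
- by rewrite /W evol_id mul1mx subrr.
Qed.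

Lemma evol_unit t s : U t s \in unitmx.
Proof. by have /mulmx1_unit[] : U t s *m U s t = 1%:M by rewrite evol_comp evol_id. Qed.

Lemma M_ge0 : 0 <= M.
Proof.
by have := le_trans (opnorm_ge0 _) (decU (lexx 0)); rewrite subrr mulr0 expR0 mulr1.
Qed.

Lemma evol_bound s r i j : s <= r -> `|U r s i j| <= M * expR (om * (r - s)).
Proof. by move=> sr; exact: le_trans (entry_le_opnorm _ _ _) (decU sr). Qed.

Lemma evol_boundM s r i j : s <= r -> `|U r s i j| <= M.
Proof.
move=> sr; apply: (le_trans (evol_bound i j sr)); rewrite ler_piMr ?M_ge0//.
by rewrite -expR0 ler_expR nmulr_rle0// subr_ge0.
Qed.

Lemma evol_cont_left s : mxcont (fun r => U r s).
Proof.
by move=> i j t; apply: differentiable_continuous; apply/derivable1_diffP; have [] := evol_derive s t i j.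
Qed.

(* [U(T,r') - U(T,r) = U(T,r') (U(r,T) - U(r',T)) U(T,r)] transfers continuity from the
   first to the second argument, as [U(T,.)] is bounded on [`]-oo, T]]. *)
Lemma evol_cont_at (T r : R) k l : r < T -> {for r, continuous (fun r' : R => U T r' k l)}.
Proof.
move=> rT.
pose b r' := M * \sum_u \sum_v `|U r T u v - U r' T u v| * `|U T r v l|.
have br : b r = 0.
  by rewrite /b big1 ?mulr0// => u _; rewrite big1// => v _; rewrite subrr normr0 mul0r.
have cb : continuous b.
  move=> x; apply: cvgM; first exact: cvg_cst.
  apply: (@continuous_sumf _ _ (fun u r' => \sum_v `|U r T u v - U r' T u v| * `|U T r v l|)).
  move=> u; apply: (@continuous_sumf _ _ (fun v r' => `|U r T u v - U r' T u v| * `|U T r v l|)).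
  move=> v y; apply: cvgM; last exact: cvg_cst.
  apply: (@cvg_norm _ R^o); apply: cvgB; first exact: cvg_cst.
  exact: evol_cont_left.
apply/cvgrPdist_lt => e e0; have /cvgrPdist_lt/(_ e e0) := cb r.
have := lt_nbhsl rT; apply: filterS2 => r' r'T; rewrite br sub0r normrN.
apply: le_lt_trans; apply: le_trans (ler_norm _); rewrite distrC.
have -> : U T r' k l - U T r k l = (U T r' *m (U r T - U r' T) *m U T r) k l.
  rewrite mulmxBr mulmxBl -mulmxA (evol_comp r T r) evol_id mulmx1 evol_comp evol_id mul1mx.
  by rewrite mxE [in RHS]mxE.
rewrite mxE (le_trans (ler_norm_sum _ _ _))// /b exchange_big /= mulr_sumr.
apply: ler_sum => v _; rewrite normrM mulr_sumr.
rewrite mxE; apply: (@le_trans _ _ ((\sum_u `|U T r' k u| * `|U r T u v - U r' T u v|) * `|U T r v l|)).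
  rewrite ler_wpM2r// (le_trans (ler_norm_sum _ _ _))//; apply: ler_sum => u _.
  by rewrite normrM mxE [in X in _ * `|_ + X| <= _]mxE.
rewrite mulr_suml; apply: ler_sum => u _; rewrite -mulrA ler_wpM2r ?mulr_ge0//.
by apply: evol_boundM; exact: ltW.
Qed.

Lemma evol_cont t : mxcont (fun r => U t r).
Proof.
move=> i j r; pose T : R := r + 1.
rewrite (_ : (fun r => U t r i j) = (fun r => \sum_k U t T i k * U T r k j)); last first.
  by apply/funext => u; rewrite -(evol_comp t T u) mxE.
apply: continuous_at_sumf => k; apply: cvgM; first exact: cvg_cst.
by apply: evol_cont_at; rewrite /T ltrDl.
Qed.

Lemma Qkernel_cont t : mxcont (fun r => Qkernel U B t r).
Proof.
apply: mxcont_mul; last by apply: mxcont_tr; exact: evol_cont.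
apply: mxcont_mul; last exact: mxcont_tr.
by apply: mxcont_mul => //; exact: evol_cont.
Qed.

Lemma Qkernel_conj t T r : Qkernel U B t r = U t T *m Qkernel U B T r *m (U t T)^T.
Proof. by rewrite /Qkernel -(evol_comp t T r) trmx_mul !mulmxA. Qed.

Lemma KB_ge0 : 0 <= KB. Proof. exact: le_trans (opnorm_ge0 _) (bB 0). Qed.

Lemma UB_bound T r i j : r <= T -> `|(U T r *m B r) i j| <= (n%:R * M * KB) * expR (om * (T - r)).
Proof.
move=> rT; rewrite mxE; apply: (le_trans (ler_norm_sum _ _ _)).
apply: (@le_trans _ _ (\sum_(k < n) (M * expR (om * (T - r)) * KB))).
  apply: ler_sum => k _; rewrite normrM; apply: ler_pM => //; first exact: evol_bound.
  exact: le_trans (entry_le_opnorm _ _ _) (bB _).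
by rewrite sumr_const card_ord -mulr_natr le_eqVlt; apply/orP; left; apply/eqP; ring.
Qed.

Lemma decay_le1 T r : r <= T -> expR (om * (T - r)) <= 1.
Proof. by move=> rT; rewrite -expR0 ler_expR nmulr_rle0// subr_ge0. Qed.

Lemma Qkernel_integrableT T : mxintegrable `]-oo, T] (fun r => Qkernel U B T r).
Proof.
move=> i j; apply: (@decay_integrable _ _ om T (n%:R * (n%:R * M * KB) ^+ 2)) => //.
  exact: Qkernel_cont.
move=> r rT; rewrite /Qkernel -(mulmxA (U T r *m B r)) -trmx_mul mxE.
apply: (le_trans (ler_norm_sum _ _ _)).
set c := n%:R * M * KB; set e := expR _.
have c0 : 0 <= c by rewrite !mulr_ge0 ?M_ge0 ?KB_ge0.
have e0 : 0 <= e by exact: expR_ge0.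
(* Keeping the decay of one factor and bounding the other by [1] produces the single exponential
   that [decay_integrable] asks for. *)
apply: (@le_trans _ _ (\sum_(k < n) ((c * e) * (c * 1)))).
  apply: ler_sum => k _; rewrite normrM; apply: ler_pM => //; first exact: UB_bound.
  rewrite mxE (le_trans (UB_bound j k rT))// ler_wpM2l//; exact: decay_le1.
by rewrite sumr_const card_ord -mulr_natr le_eqVlt; apply/orP; left; apply/eqP; ring.
Qed.

(** The endpoint may exceed [t], where the decay estimate on [U t r] stops; conjugation by [U t T]
    transports the estimate. Differentiating [hQ] at [t] requires such endpoints. *)
Lemma Qkernel_integrable t T : mxintegrable `]-oo, T] (fun r => Qkernel U B t r).
Proof.
rewrite (_ : (fun r => _) = (fun r => U t T *m Qkernel U B T r *m (U t T)^T)).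
  by have [] := mxint_conj (U t T) (U t T)^T (measurable_itv _) (@Qkernel_integrableT T).
by apply/funext => r; rewrite -Qkernel_conj.
Qed.

Lemma Qkernel_mxint t T :
  mxint `]-oo, T] (fun r => Qkernel U B t r) = U t T *m Qinf U B T *m (U t T)^T.
Proof.
have [_ <-] := mxint_conj (U t T) (U t T)^T (measurable_itv _) (@Qkernel_integrableT T).
by apply: eq_mxint => r _; rewrite -Qkernel_conj.
Qed.

(** Together with [ginf_rec], this says that the transition from [s] to [t] carries the Gaussian
    measure at [s] to the one at [t]. *)
Lemma Qinf_rec s t : s <= t -> Qinf U B t = Qst U B t s + U t s *m Qinf U B s *m (U t s)^T.
Proof.
move=> st; rewrite -[LHS]/(mxint `]-oo, t] (fun r => Qkernel U B t r)).
by rewrite (mxint_split st)// -?Qkernel_mxint//; exact: Qkernel_integrable.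
Qed.

Lemma ginf_rec s t : s <= t -> ginf U f t = gst U f t s + U t s *m ginf U f s.
Proof.
move=> st.
have iT T : mxintegrable `]-oo, T] (fun r => U T r *m f r).
  move=> i j; rewrite ord1.
  apply: (@decay_integrable _ _ om T (n%:R * M * Kf)) => //.
    by apply: mxcont_mul; [exact: evol_cont|move=> u v; rewrite ord1; exact: cf].
  move=> r rT; rewrite mxE; apply: (le_trans (ler_norm_sum _ _ _)).
  apply: (@le_trans _ _ (\sum_(k < n) (M * expR (om * (T - r)) * Kf))).
    apply: ler_sum => k _; rewrite normrM; apply: ler_pM => //; first exact: evol_bound.
    exact: le_trans (le_coord_enorm _ _) (bf _).
  by rewrite sumr_const card_ord -mulr_natr le_eqVlt; apply/orP; left; apply/eqP; ring.
have gE T : ginf U f T = mxint `]-oo, T] (fun r => U T r *m f r).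
  by apply/matrixP => i j; rewrite !mxE ord1.
have gsE : gst U f t s = mxint `[s, t] (fun r => U t r *m f r).
  by apply/matrixP => i j; rewrite !mxE ord1.
have [_ e] := mxint_mull (U t s) (measurable_itv _) (iT s).
rewrite !gE gsE (mxint_split st)// -e; congr (_ + _).
by apply: eq_mxint => r _; rewrite mulmxA evol_comp.
Qed.

Lemma qform_Qkernel t r x :
  qform (Qkernel U B t r) x = enorm ((B r)^T *m ((U t r)^T *m x)) ^+ 2.
Proof. by rewrite sqr_enormE /qform !trmx_mul !trmxK !mulmxA. Qed.

Lemma B_unit r : B r \in unitmx.
Proof.
rewrite -unitmx_tr unitmxE unitfE; apply/negP => /det0P[v v0 vB].
have Bv : B r *m v^T = 0 by rewrite -[LHS]trmxK trmx_mul trmxK vB trmx0.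
have := coerB r v^T; rewrite Bv.
have -> : enorm (0 : 'cV[R]_n) = 0 by rewrite -(scale0r 0) enormZ normr0 mul0r.
rewrite pmulr_rle0// => ev; move/negP: v0; apply; rewrite -(inj_eq trmx_inj) trmx0; apply/eqP.
by apply: enorm_eq0; apply/eqP; rewrite eq_le ev enorm_ge0.
Qed.

Lemma qform_Qkernel_gt0 t r x : x != 0 -> 0 < qform (Qkernel U B t r) x.
Proof.
move=> x0; rewrite qform_Qkernel exprn_gt0// lt_neqAle enorm_ge0 andbT eq_sym.
apply: contra x0 => /eqP/enorm_eq0 e0.
have uB : (B r)^T \in unitmx by rewrite unitmx_tr B_unit.
have uU : (U t r)^T \in unitmx by rewrite unitmx_tr evol_unit.
by rewrite -[x](mulKmx uU) -[_^T *m x](mulKmx uB) e0 !mulmx0.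
Qed.

(** By [Qkernel_mxint] this is [qform (U t r *m Qinf U B r *m (U t r)^T) x]. As an integral with a
    moving endpoint it is differentiated by the fundamental theorem of calculus, without
    differentiating [U] in its second argument. *)
Definition hQ t x r : R := qform (mxint `]-oo, r] (fun u => Qkernel U B t u)) x.

Lemma hQ_derive t x r : is_derive r (1 : R) (hQ t x) (qform (Qkernel U B t r) x).
Proof.
pose k u := qform (Qkernel U B t u) x.
have -> : hQ t x = fun y => \int[mu]_(u in [set` Interval -oo%O (BRight y)]) k u.
  by apply/funext => y; rewrite /hQ qform_mxint//; exact: Qkernel_integrable.
have ik : mu.-integrable [set` Interval -oo%O (BRight (r + 1))] (EFin \o k).
  have [+ _] := mxint_conj x^T x (measurable_itv _) (@Qkernel_integrable t (r + 1)).
  by move=> /(_ ord0 ord0).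
have ck : continuous k.
  apply: (@mxcont_mul _ _ _ _ (fun u => x^T *m Qkernel U B t u) (fun=> x)); last exact: mxcont_cst.
  by apply: mxcont_mul; [exact: mxcont_cst|exact: Qkernel_cont].
have [|dk ek] := @continuous_FTC1 R k -oo%O r (r + 1) _ ik (ltNyr _) (ck r); first by rewrite ltrDl.
by apply: (DeriveDef dk); rewrite -derive1E.
Qed.

Lemma hQ_ge0 t x r : 0 <= hQ t x r.
Proof.
rewrite /hQ qform_mxint//; last exact: Qkernel_integrable.
by apply: Rintegral_ge0 => u _; rewrite qform_Qkernel sqr_ge0.
Qed.

Lemma hQ_cont t x : continuous (hQ t x).
Proof.
by move=> r; apply: differentiable_continuous; apply/derivable1_diffP; have [] := hQ_derive t x r.
Qed.

(** The nonnegative function [hQ t x] has positive slope, so the mean value theorem on the last unit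
    of time makes its value at [t] positive. *)
Lemma Qinf_posdef t : posdef (Qinf U B t).
Proof.
split=> [|x x0].
  rewrite -[X in X^T]/(mxint `]-oo, t] (fun r => Qkernel U B t r)) -mxint_tr.
  by apply: eq_mxint => r _; rewrite /Qkernel !trmx_mul !trmxK !mulmxA.
have t1 : t - 1 < t by rewrite ltrBlDr ltrDl.
have [|c _ E] := @MVT R (hQ t x) (fun r => qform (Qkernel U B t r) x) (t - 1) t t1 (fun r _ => hQ_derive t x r).
  by apply: continuous_subspaceT; exact: hQ_cont.
have : 0 < hQ t x t - hQ t x (t - 1) by rewrite E mulr_gt0 ?qform_Qkernel_gt0// subr_gt0.
rewrite subr_gt0; apply: le_lt_trans; exact: hQ_ge0.
Qed.

Definition kap r : R := opnorm (sqrtm (Qinf U B r) *m invmx (B r)^T) ^+ 2.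

(** The form is the squared norm of the root [S] applied to [y]; inserting the transpose of [B r]
    and its inverse brings out the operator norm in [kap]. *)
Lemma qform_Qinf_le r y : qform (Qinf U B r) y <= kap r * enorm ((B r)^T *m y) ^+ 2.
Proof.
have [QT Q0] := Qinf_posdef r.
have [ST SS] := sqrtmP QT (fun x => posdef_ge0 x (Qinf_posdef r)).
set S := sqrtm _ in ST SS *.
have uB : (B r)^T \in unitmx by rewrite unitmx_tr B_unit.
have -> : qform (Qinf U B r) y = enorm (S *m y) ^+ 2.
  by rewrite sqr_enormE /qform -SS trmx_mul ST !mulmxA.
rewrite -{1}(mulKmx uB y) (mulmxA S) -exprMn ler_pXn2r ?nnegrE ?mulr_ge0 ?opnorm_ge0 ?enorm_ge0//.
exact: opnormP.
Qed.

Lemma hQ_le t x r : hQ t x r <= kap r * qform (Qkernel U B t r) x.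
Proof.
rewrite /hQ Qkernel_mxint qform_Qkernel -{1}[U t r]trmxK qform_conj.
exact: qform_Qinf_le.
Qed.

Lemma kap_gt0 r : (0 < n)%N -> 0 < kap r.
Proof.
move=> n0; pose y : 'cV[R]_n := delta_mx (Ordinal n0) ord0.
have y0 : y != 0.
  by apply/eqP => /colP/(_ (Ordinal n0)); rewrite !mxE !eqxx => /eqP; rewrite oner_eq0.
have [_ /(_ y y0) Q0] := Qinf_posdef r.
have := lt_le_trans Q0 (qform_Qinf_le r y).
rewrite lt_neqAle => /andP[+ _]; rewrite lt_neqAle sqr_ge0 andbT.
by apply: contra => /eqP <-; rewrite mul0r.
Qed.

End evolution.

(** * The differential equation of the exponent *)

Section exponent.
Context {R : realType}.

Lemma is_derive_quadratic (F : R -> R) x l :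
  (forall h, `|F (x + h) - F x - l * h| <= h ^+ 2) -> is_derive x (1 : R) F l.
Proof.
move=> H.
have c : h^-1 *: (F (h *: (1 : R) + x) - F x) @[h --> 0^'] --> l.
  apply/cvgrPdist_lt => e e0; near=> h.
  have h0 : h != 0 by near: h; exact: nbhs_dnbhs_neq.
  have he : `|h| < e.
    by near: h; apply: dnbhs0_lt.
  apply: le_lt_trans he.
  have := H h; rewrite -(ler_pM2l (_ : 0 < `|h|^-1)) ?invr_gt0 ?normr_gt0//.
  rewrite -(real_normK (num_real h)) expr2 mulKf ?normr_eq0//; apply: le_trans.
  rewrite -normfV -normrM distrC /GRing.scale/= mulr1 (addrC h) le_eqVlt; apply/orP; left; apply/eqP.
  by congr `|_|; field.
apply: DeriveDef; first by apply/cvg_ex; exists l.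
by apply/cvg_lim.
Unshelve. all: by end_near.
Qed.

(** The positive part has a corner at [0], but its square has a quadratic Taylor remainder across
    it. *)
Lemma is_derive_sqr_pos x : is_derive x (1 : R) (fun y => Num.max y 0 ^+ 2) (2 * Num.max x 0).
Proof.
apply: is_derive_quadratic => h.
have [x0|x0] := leP x 0; have [h0|h0] := leP (x + h) 0; rewrite ler_norml; apply/andP; split; nra.
Qed.

(* Where [p <= 1] the sign of [p'] is unknown; [max (p - 1) 0 ^+ 2] ignores these points. *)
Lemma exponent_ge (p dp : R -> R) (q t : R) : 1 < q -> p t = q ->
  {within `]-oo, t], continuous p} -> (forall s, s < t -> is_derive s (1 : R) p (dp s)) ->
  (forall s, s < t -> 1 < p s -> dp s <= 0) -> forall s, s <= t -> q <= p s.
Proof.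
move=> q1 pt cp dp' dp0 s st.
pose F x := - Num.max (p x - 1) 0 ^+ 2.
have dF x : x < t -> is_derive x (1 : R) F (- (2 * Num.max (p x - 1) 0 * dp x)).
  move=> xt.
  have H1 : is_derive x (1 : R) (fun y => p y - 1) (dp x).
    have H := is_deriveB (dp' x xt) (is_derive_cst (1 : R) x (1 : R)).
    by apply: (is_derive_eq H); rewrite subr0.
  have H2 := is_deriveN (@is_derive1_comp _ (fun y => Num.max y 0 ^+ 2) _ x _ _ (is_derive_sqr_pos (p x - 1)) H1).
  exact: H2.
have : F s <= F t.
  apply: (@derive_ge0_le _ F (fun x => - (2 * Num.max (p x - 1) 0 * dp x))) => //.
  - by move=> x /andP[_ xt]; exact: dF.
  - have cps : {within `[s, t], continuous p}.
      by apply: continuous_subspaceW cp; apply: subset_itvr.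
    have cG : continuous (fun y : R => - Num.max y 0 ^+ 2).
      move=> y; apply: differentiable_continuous; apply/derivable1_diffP.
      by have [] := is_deriveN (is_derive_sqr_pos y).
    have c1 : {within `[s, t], continuous (fun y => p y - 1)}.
      by move=> x; apply: cvgB; [exact: cps|exact: cvg_cst].
    by move=> x; apply: (cvg_comp _ _ (c1 x) (cG (p x - 1))).
  - move=> x /andP[_ xt]; rewrite oppr_ge0.
    have [p1|p1] := leP (p x - 1) 0; first by rewrite mulr0 mul0r.
    rewrite pmulr_rle0; last by rewrite mulr_gt0.
    by apply: dp0 => //; rewrite -subr_gt0.
rewrite /F pt lerN2 [Num.max (q - 1) 0]max_l; last by rewrite subr_ge0 ltW.
(* If [p s <= 1] the comparison would give [(q - 1) ^+ 2 <= 0], against [1 < q]. *)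
have [p1|p1] := leP (p s - 1) 0.
  rewrite expr0n/= => /(lt_le_trans _) H.
  by have := H 0; rewrite exprn_gt0 ?subr_gt0// ltxx => /(_ isT).
rewrite ler_pXn2r ?nnegrE ?subr_ge0 ?(ltW q1) ?(ltW p1)//; last by rewrite -subr_ge0 ltW.
by rewrite lerD2r.
Qed.

Lemma exponent_monotone (p kap : R -> R) (q t s : R) : 1 < q -> p t = q -> s < t ->
  {within `]-oo, t], continuous p} ->
  (forall r, r < t -> is_derive r (1 : R) p (- p r / (p r / (p r - 1) * kap r))) ->
  (forall r, 0 < kap r) ->
  q < p s /\ forall h dh : R -> R, (forall r, is_derive r (1 : R) h (dh r)) ->
    (forall r, h r <= kap r * dh r) -> h s * (p s - 1) <= h t * (q - 1).
Proof.
move=> q1 pt st cp dp kap0.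
have pge r : r <= t -> q <= p r.
  apply: (exponent_ge q1 pt cp dp) => u ut pu.
  have := kap0 u; rewrite mulNr oppr_le0 => k0.
  by rewrite divr_ge0 ?mulr_ge0 ?invr_ge0 ?subr_ge0 ?(ltW k0)//; lra.
(* Cancelling [p r] and [p r - 1] in the equation is legitimate only now that [1 < q <= p r] is
   known. *)
have dp' r : r < t -> is_derive r (1 : R) p (- ((p r - 1) / kap r)).
  move=> rt; apply: (is_derive_eq (dp r rt)); have pr := pge r (ltW rt).
  by field; rewrite !gt_eqF//; lra.
have cps : {within `[s, t], continuous p}.
  by apply: continuous_subspaceW cp; apply: subset_itvr.
split.
  have [|c /[!in_itv]/= /andP[sc ct] E] := @MVT R p (fun r => - ((p r - 1) / kap r)) s t st _ cps.
    by move=> r /[!in_itv]/= /andP[_ rt]; exact: dp'.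
  rewrite -pt -subr_lt0 E nmulr_rlt0 ?subr_gt0// oppr_lt0 divr_gt0// subr_gt0.
  exact: lt_le_trans (pge c (ltW ct)).
move=> h dh dh' hle; rewrite -{1}pt.
have ch : continuous h.
  by move=> r; apply: differentiable_continuous; apply/derivable1_diffP; have [] := dh' r.
apply: (@derive_ge0_le _ (fun r => h r * (p r - 1)) (fun r => (p r - 1) * (dh r - h r / kap r))).
- exact: ltW.
- move=> r /andP[_ rt].
  have H1 := is_deriveB (dp' r rt) (is_derive_cst (1 : R) r (1 : R)).
  have H2 : is_derive r (1 : R) (fun r => h r * (p r - 1)) _ := is_deriveM (dh' r) H1.
  by apply: (is_derive_eq H2); rewrite /GRing.scale/= subr0 -[(p - _) r]/(p r - 1); field; rewrite gt_eqF.
- move=> x; apply: cvgM; first exact: (continuous_subspaceT ch).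
  by apply: cvgB; [exact: cps|exact: cvg_cst].
- move=> r /andP[_ rt]; have pr := pge r (ltW rt).
  rewrite mulr_ge0 ?subr_ge0//; first by apply: ltW; exact: lt_le_trans pr.
  by rewrite ler_pdivrMr// mulrC.
Qed.

End exponent.

Theorem theorem3p3 (R : realType) (n : nat)
  (A B : R -> 'M[R]_n) (f : R -> 'cV[R]_n) (U : R -> R -> 'M[R]_n)
  (q t : R) (p : R -> R) :
  (0 < n)%N ->
  (* A, B, f continuous and bounded *)
  (forall i j : 'I_n, continuous (fun r => A r i j)) ->
  (forall i j : 'I_n, continuous (fun r => B r i j)) ->
  (forall i : 'I_n, continuous (fun r => f r i 0)) ->
  (exists K : R, forall r, opnorm (A r) <= K) ->
  (exists K : R, forall r, opnorm (B r) <= K) ->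
  (exists K : R, forall r, enorm (f r) <= K) ->
  (* ||B(r) x|| >= mu0 ||x|| *)
  (exists mu0 : R, 0 < mu0 /\
     forall r (x : 'cV[R]_n), mu0 * enorm x <= enorm (B r *m x)) ->
  (* U is the evolution operator of xi' = A(t) xi *)
  is_evolution_operator A U ->
  (* omega_0(U) < 0 *)
  (exists omega : R, omega < 0 /\ exists M : R,
     forall s r, s <= r -> opnorm (U r s) <= M * expR (omega * (r - s))) ->
  (* q in (1, oo) *)
  1 < q ->
  (* p(., t) solves p'(s) = - p(s) / c(p(s), s) for s <= t, p(t) = q *)
  p t = q ->
  {within `]-oo, t], continuous p} ->
  (forall s, s < t -> is_derive s (1 : R) p (- p s / cfun U B (p s) s)) ->
  forall s, s < t ->
  forall phi : 'cV[R]_n -> R,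
    Rn_measurable phi ->
    (gaussLnorm q (ginf U f t) (Qinf U B t) (fun y => (phi y)%:E) < +oo)%E ->
    Rn_measurableE (Pst U B f s t phi) /\
    (gaussLnorm (p s) (ginf U f s) (Qinf U B s) (Pst U B f s t phi)
      <= gaussLnorm q (ginf U f t) (Qinf U B t) (fun y => (phi y)%:E))%E.
Proof.
move=> n0 _ cB cf [KA bA] [KB bB] [Kf bf] [mu0 [mu00 coerB]] evU [om [om0 [M decU]]] q1 pt cp dp s st phi mphi _.
have pQ r := Qinf_posdef bA bB cB mu00 coerB evU om0 decU r.
have kap0 r := kap_gt0 bA bB cB mu00 coerB evU om0 decU r n0.
have [qps mono] := exponent_monotone q1 pt st cp dp kap0.
have ps1 : 0 < p s - 1 by rewrite subr_gt0; exact: lt_trans q1 qps.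
apply: (@gauss_contract R n (U t s) (Qinf U B s) (Qinf U B t) (Qst U B t s) (ginf U f s) (ginf U f t)
  (gst U f t s) (p s) q ((q - 1) / (p s - 1)) phi) => //.
- by rewrite -subr_gt0.
- by rewrite ltr_pdivrMr// mul1r ltrD2r.
- by rewrite divfK// gt_eqF.
- exact: (evol_unit bA evU).
- move=> x.
  (* At [r = s] the function [hQ] is the form of the transported covariance, and at [r = t] it is by
     definition the form of [Qinf U B t]; the monotone quantity compares the two with ratio
     [(q - 1) / (p s - 1)]. *)
  have := mono _ _ (hQ_derive bA bB cB evU om0 decU t x) (hQ_le bA bB cB mu00 coerB evU om0 decU t x).
  rewrite /hQ (Qkernel_mxint bA bB cB evU om0 decU) -[mxint `]-oo, t] _]/(Qinf U B t) => H.
  by rewrite mulrAC ler_pdivlMr// (mulrC (q - 1)).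
- exact: (Qinf_rec bA bB cB evU om0 decU (ltW st)).
- exact: (ginf_rec bA bf cf evU om0 decU (ltW st)).
Qed.
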